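(* The canonical basis of $\mathbf S^{\imath}$ is $\mathbf B_d^\jmath\cap\mathbf S^{\imath}=\{\{A\}\mid A\in{}^\imath\Xi_d\}$, where $\mathbf B_d^\jmath=\{\{A\}\mid A\in\Xi_d\}$ is the canonical basis of $\mathbf S^{\jmath}$.
   Context: Let $\mathcal A=\mathbb Z[v,v^{-1}]$, $n,d\ge1$, $N=2n+1$, $D=2d+1$; $\mathbb N=\{0,1,2,\dots\}$, and $|U|=\dim U$. For an odd prime power $q$ equip $\mathbb F_q^D$ with a nondegenerate symmetric bilinear form with isometry group $O(D)$, and let $X$ be the set of flags $V=(0=V_0\subseteq V_1\subseteq\cdots\subseteq V_N=\mathbb F_q^D)$ with $V_i=V_{N-i}^\perp$ for all $i$. Let $\Xi_d$ be the set of $N\times N$ matrices $A=(a_{ij})$ over $\mathbb N$ with $\sum a_{ij}=D$ and $a_{ij}=a_{N+1-i,N+1-j}$. The $O(D)$-orbits $\mathcal O_A$ on $X\times X$ are indexed by $A\in\Xi_d$: $(V,V')\in\mathcal O_A$ iff $a_{ij}=|(V_{i-1}+V_i\cap V'_j)/(V_{i-1}+V_i\cap V'_{j-1})|$ for all $i,j$. $\mathbf S^{\jmath}$ is the free $\mathcal A$-module with basis $e_A$ ($A\in\Xi_d$), $e_A$ being the characteristic function of $\mathcal O_A$, an algebra under convolution. Standard basis: $[A]=v^{-d_A}e_A$, where $d_A$ is the dimension (over $\overline{\mathbb F}_q$) of $\mathcal O_A$ minus the dimension of its image under the first projection $X\times X\to X$. Canonical basis of $\mathbf S^{\jmath}$: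 over $\overline{\mathbb F}_q$ let $d(A)=\dim\mathcal O_A$, $A'\le A$ iff $\mathcal O_{A'}\subseteq\overline{\mathcal O_A}$, $\mathrm{IC}_A$ the intersection complex of $\overline{\mathcal O_A}$ shifted so that its restriction to $\mathcal O_A$ is the constant sheaf in degree $0$. Put $P_{A',A}=\sum_i\dim\mathscr H^i_{\mathcal O_{A'}}(\mathrm{IC}_A)v^{i-d(A)+d(A')}$ (stalk cohomology at a point of $\mathcal O_{A'}$), $\{A\}=\sum_{A'\le A}P_{A',A}[A']$. The bar involution of $\mathbf S^{\jmath}$ is the additive map with $\overline{v^kx}=v^{-k}\overline x$ fixing every $\{A\}$. ${}^\imath\Xi_d\subset\Xi_d$ consists of the $A$ with $a_{n+1,n+1}=1$ and all other entries in row $n+1$ and column $n+1$ zero. ${}^\imath X\subset X$ is the set of flags with $V_n$ maximal isotropic; $\mathbf S^{\imath}\subset\mathbf S^{\jmath}$ is the subalgebra of functions supported on ${}^\imath X\times{}^\imath X$, i.e. the $\mathcal A$-span of $[A]$, $A\in{}^\imath\Xi_d$. The bar involution of $\mathbf S^{\imath}$ is the restriction of that of $\mathbf S^{\jmath}$. The canonical basis of $\mathbf S^{\imath}$ is its $\mathcal A$-basis $\{b_A\}_{A\in{}^\imath\Xi_d}$ uniquely determined by $\overline{b_A}=b_A$ and $b_A\in[A]+\sum_{A'\in{}^\imath\Xi_d,\,A'\sqsubset A}v^{-1}\mathbb Z[v^{-1}][A']$. Here $A'\sqsubseteq A$ iff $A,A'$ have the same row sums and the same column sums, $\sum_{r\le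 i,s\ge j}a'_{rs}\le\sum_{r\le i,s\ge j}a_{rs}$ for $i<j$ and $\sum_{r\ge i,s\le j}a'_{rs}\le\sum_{r\ge i,s\le j}a_{rs}$ for $i>j$; $\sqsubset$ is the strict version. *)

(* Defs.v *)
From HB Require Import structures.
From mathcomp Require Import all_boot all_order all_algebra all_field.
From mathcomp Require Import boolp classical_sets functions cardinality fsbigop.
From mathcomp Require Import mpoly.
Set Implicit Arguments.
Unset Strict Implicit.
Unset Printing Implicit Defensive.
Import Order.TTheory GRing.Theory Num.Theory.
Local Open Scope classical_set_scope.
Local Open Scope ring_scope.

Definition vfrac : {fraction {poly int}} := tofrac 'X.

Definition is_laurent : {pred {fraction {poly int}}} :=
  fun x => `[< exists (p : {poly int}) (m : nat), x = tofrac p / vfrac ^+ m >].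

Lemma vfrac_neq0 : vfrac != 0.
Proof. by rewrite /vfrac tofrac_eq0 polyX_eq0. Qed.

Lemma is_laurent_subring : subring_closed is_laurent.
Proof.
have v0 m : vfrac ^+ m != 0 by rewrite expf_neq0 // vfrac_neq0.
split.
- by apply/asboolP; exists 1, 0%N; rewrite expr0 divr1 tofrac1.
- move=> x y /asboolP [p [m ->]] /asboolP [q [r ->]]; apply/asboolP.
  exists (p * 'X^r - q * 'X^m), (m + r)%N.
  rewrite tofracB !tofracM !tofracXn -/vfrac exprD.
  by rewrite -mulNr addf_div ?v0 // mulNr.
- move=> x y /asboolP [p [m ->]] /asboolP [q [r ->]]; apply/asboolP.
  by exists (p * q), (m + r)%N; rewrite tofracM exprD mulf_div.
Qed.
HB.instance Definition _ :=
  GRing.isSubringClosed.Build {fraction {poly int}} is_laurent is_laurent_subring.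

Record Laurent := MkLaurent {
  laurent_val :> {fraction {poly int}};
  laurent_valP : laurent_val \in is_laurent }.
HB.instance Definition _ := [isSub for laurent_val].
HB.instance Definition _ := [Choice of Laurent by <:].
HB.instance Definition _ := [SubChoice_isSubComNzRing of Laurent by <:].

Lemma is_laurent_vpow (z : int) : vfrac ^ z \in is_laurent.
Proof.
apply/asboolP; case: z => m.
  by exists ('X^m), 0%N; rewrite expr0 divr1 tofracXn.
by exists 1, m.+1; rewrite tofrac1 div1r.
Qed.

Definition vpow (z : int) : Laurent := MkLaurent (is_laurent_vpow z).

(* v^-1 Z[v^-1] *)
Definition negative_laurent (x : Laurent) : Prop :=
  exists p : {poly int}, x = \sum_(i < size p) vpow (- (i.+1)%:Z) *~ p`_i.

(* The points of a [cspace] of type [c] are given by "homogeneous" coordinate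
   vectors, [coord c x v] meaning that [v] is one of the coordinate vectors of
   [x]: for flags, the coordinates are the adapted bases of the flag. The
   topology and the regular functions are those of the quotient, so that a set
   is closed, resp. a function is regular, iff it is so as a set, resp.
   function, of coordinate vectors. Points of distinct types lie in distinct
   components. *)

Section Zariski.
Variable k : fieldType.

Record cspace := CSpace {
  cpt :> Type;
  ctype : Type;
  cdim : nat;
  coord : ctype -> cpt -> 'rV[k]_cdim -> Prop }.

Definition evalr m (p : {mpoly k[m]}) (v : 'rV[k]_m) : k := p.@[fun i => v 0 i].

Definition prod_space (S T : cspace) : cspace :=
  @CSpace (S * T)%type (ctype S * ctype T)%type (cdim S + cdim T)
    (fun c x v => coord c.1 x.1 (lsubmx v) /\ coord c.2 x.2 (rsubmx v)).

Definition affine_space (r : nat) : cspace :=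
  @CSpace 'rV[k]_r unit r (fun _ x v => v = x).

Section OneSpace.
Variable T : cspace.

Definition zclosed (Z : set T) : Prop :=
  forall c : ctype T, exists S : set {mpoly k[cdim T]},
    forall (x : T) v, coord c x v -> (Z x <-> forall p, S p -> evalr p v = 0).

Definition zclosure (Z : set T) : set T :=
  [set x | forall C, zclosed C -> Z `<=` C -> C x].

Definition relclosed (S Z : set T) : Prop := exists2 C, zclosed C & Z = S `&` C.

Definition irreducible_in (S Z : set T) : Prop :=
  [/\ relclosed S Z, Z !=set0 &
      forall Z1 Z2, relclosed S Z1 -> relclosed S Z2 -> Z = Z1 `|` Z2 ->
        Z = Z1 \/ Z = Z2].

Definition has_chain (S : set T) (m : nat) : Prop :=
  exists Z : nat -> set T,
    (forall i, (i <= m)%N -> irreducible_in S (Z i)) /\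
    (forall i, (i < m)%N -> Z i `<` Z i.+1).

(* Krull dimension; 0 if S is empty or of infinite dimension *)
Definition zdim (S : set T) : nat :=
  xget 0%N [set m | has_chain S m /\ ~ has_chain S m.+1].

Definition regular_on (S : set T) (f : T -> k) : Prop :=
  forall x, S x -> forall c v, coord c x v ->
    exists p q : {mpoly k[cdim T]}, evalr q v != 0 /\
      forall y w, S y -> coord c y w -> evalr q w != 0 ->
        f y = evalr p w / evalr q w.

Lemma zclosed0 : zclosed set0.
Proof.
move=> c; exists [set 1] => x v _; split=> // /(_ 1 erefl).
by rewrite /evalr meval1 => /eqP; rewrite oner_eq0.
Qed.

Lemma zclosedU (C1 C2 : set T) : zclosed C1 -> zclosed C2 -> zclosed (C1 `|` C2).
Proof.
move=> h1 h2 c; have [S1 HS1] := h1 c; have [S2 HS2] := h2 c.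
exists [set p | exists p1 p2, [/\ S1 p1, S2 p2 & p = p1 * p2]] => x v xv.
have [a1 b1] := HS1 _ _ xv; have [a2 b2] := HS2 _ _ xv; split.
  move=> [x1|x2] p [p1 [p2 [Sp1 Sp2 ->]]]; rewrite /evalr mevalM.
    by have := a1 x1 _ Sp1; rewrite /evalr => ->; rewrite mul0r.
  by have := a2 x2 _ Sp2; rewrite /evalr => ->; rewrite mulr0.
move=> H; apply: contrapT => /not_orP [n1 n2].
have : ~ (forall p, S1 p -> evalr p v = 0) by move=> /b1.
move=> /existsNP [p1 /not_implyP [Sp1 np1]].
have : ~ (forall p, S2 p -> evalr p v = 0) by move=> /b2.
move=> /existsNP [p2 /not_implyP [Sp2 np2]].
have := H (p1 * p2) (ex_intro _ p1 (ex_intro _ p2 (And3 Sp1 Sp2 erefl))).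
by rewrite /evalr mevalM => /eqP; rewrite mulf_eq0 => /orP [] /eqP.
Qed.

Lemma zclosed_zclosure (Z : set T) : zclosed (zclosure Z).
Proof.
move=> c; exists [set p | exists C, [/\ zclosed C, Z `<=` C &
  forall x w, coord c x w -> C x -> evalr p w = 0]] => x v xv; split.
  by move=> clx p [C [hC ZC pC]]; apply: pC xv _; apply: clx.
move=> H C hC ZC; have [S HS] := hC c.
apply/(HS _ _ xv) => p Sp; apply: H; exists C; split=> // y w yw Cy.
by move/(HS _ _ yw): Cy; apply.
Qed.

Lemma regular_onS (S S' : set T) f :
  S' `<=` S -> regular_on S f -> regular_on S' f.
Proof.
move=> SS' rf x S'x c v xv; have [p [q [qv H]]] := rf x (SS' _ S'x) c v xv.
by exists p, q; split=> // y w /SS'; apply: H.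
Qed.

End OneSpace.

Arguments zclosed0 : clear implicits.
Arguments zclosed_zclosure [T] Z.

(* The small etale site of a locally closed subset Y of T. An object is an open subset [Y `\` et_rem] of Y together with r polynomials
   in r variables over its regular functions; it stands for the etale scheme
   over that open subset cut out by these polynomials and the invertibility of
   their Jacobian determinant. Every etale scheme over an affine scheme that is
   itself affine has such a presentation, so these objects generate the etale
   topos. As k is algebraically closed and everything is reduced, schemes and
   morphisms are determined by k-points. *)

Section EtaleSite.
Variables (T : cspace) (Y : set T).

Record etale := Etale {
  et_rem : set T;
  et_remP : zclosed et_rem;
  et_dim : nat;
  et_eq : 'I_et_dim -> T -> {mpoly k[et_dim]};
  et_reg : forall i m, regular_on (Y `\` et_rem) (fun x => (et_eq i x)@_m);
  et_bounded : exists b, forall i x, (Y `\` et_rem) x -> (msize (et_eq i x) <= b)%N }.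

Definition et_pts (E : etale) : set (prod_space T (affine_space (et_dim E))) :=
  [set z | [/\ (Y `\` et_rem E) z.1,
    forall i, evalr (et_eq i z.1) z.2 = 0 &
    \det (\matrix_(i, j) evalr (mderiv j (et_eq i z.1)) z.2) != 0]].

Arguments et_pts : clear implicits.

Record ethom (E E' : etale) := EtHom {
  eth_fun :> T -> 'rV[k]_(et_dim E) -> 'rV[k]_(et_dim E');
  eth_pts : forall z, et_pts E z -> et_pts E' (z.1, eth_fun z.1 z.2);
  eth_reg : forall j, regular_on (et_pts E) (fun z => eth_fun z.1 z.2 0 j) }.

Definition is_idhom E (f : ethom E E) : Prop :=
  forall z, et_pts E z -> f z.1 z.2 = z.2.

Definition is_comphom E E' E'' (h : ethom E E'') (g : ethom E' E'')
    (f : ethom E E') : Prop :=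
  forall z, et_pts E z -> h z.1 z.2 = g z.1 (f z.1 z.2).

(* the base change of E to the complement of a closed subset C *)
Section Punctured.
Variables (C : set T) (hC : zclosed C).

Lemma et_off_sub (E : etale) : Y `\` (et_rem E `|` C) `<=` Y `\` et_rem E.
Proof. by move=> x [Yx nx]; split=> // rx; apply: nx; left. Qed.

Lemma et_off_bounded (E : etale) : exists b, forall i x,
  (Y `\` (et_rem E `|` C)) x -> (msize (@et_eq E i x) <= b)%N.
Proof.
by have [b Hb] := et_bounded E; exists b => i x /et_off_sub; apply: Hb.
Qed.

Definition et_off (E : etale) : etale :=
  @Etale (et_rem E `|` C) (zclosedU (@et_remP E) hC) (et_dim E) (@et_eq E)
    (fun i m => regular_onS (@et_off_sub E) (et_reg i m)) (et_off_bounded E).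

Lemma et_off_pts (E : etale) z :
  et_pts (et_off E) z <-> et_pts E z /\ ~ C z.1.
Proof.
split=> [[[Yz nz] e j]|[[[Yz nz] e j] nC]].
  split; last by move=> Cz; apply: nz; right.
  by split=> //; split=> // rz; apply: nz; left.
by split=> //; split=> // -[].
Qed.

Section OffHom.
Variables (E E' : etale) (f : ethom E E').

Lemma eth_off_pts z :
  et_pts (et_off E) z -> et_pts (et_off E') (z.1, f z.1 z.2).
Proof. by move=> /et_off_pts [Ez nC]; apply/et_off_pts; split=> //; exact: (eth_pts f Ez). Qed.

Lemma eth_off_reg j :
  regular_on (et_pts (et_off E)) (fun z => f z.1 z.2 0 j).
Proof. by apply: regular_onS (eth_reg f j) => z /et_off_pts []. Qed.

Definition eth_off : ethom (et_off E) (et_off E') := EtHom eth_off_pts eth_off_reg.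
End OffHom.

Section OffIncl.
Variable E : etale.

Lemma eth_incl_pts z : et_pts (et_off E) z -> et_pts E (z.1, z.2).
Proof. by case: z => x t /et_off_pts []. Qed.

Lemma eth_incl_reg j :
  regular_on (et_pts (et_off E))
    (fun z : prod_space T (affine_space (et_dim E)) => z.2 0 j).
Proof.
move=> z _ c v _; exists 'X_(rshift (cdim T) j), 1.
split; first by rewrite /evalr meval1 oner_eq0.
move=> y w _ [_ /= <-] _.
by rewrite /evalr meval1 divr1 mevalXU mxE.
Qed.

Definition eth_incl : ethom (et_off E) E :=
  @EtHom (et_off E) E (fun _ t => t) eth_incl_pts eth_incl_reg.
End OffIncl.
End Punctured.

Definition jointly_surjective (E : etale) (I : Type) (Ei : I -> etale)
    (f : forall i, ethom (Ei i) E) : Prop :=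
  forall z, et_pts E z -> exists i t, et_pts (Ei i) (z.1, t) /\ f i z.1 t = z.2.

Record presheaf := Presheaf {
  sec :> etale -> zmodType;
  res : forall E E', ethom E E' -> {additive sec E' -> sec E};
  res_id : forall E (f : ethom E E) s, is_idhom f -> res f s = s;
  res_comp : forall E E' E'' (h : ethom E E'') (g : ethom E' E'') (f : ethom E E') s,
    is_comphom h g f -> res h s = res f (res g s) }.

Arguments res {p E E'} f.

(* The fibre products of the usual sheaf condition are replaced by all the
   objects that lie over two members of the covering. *)
Definition is_sheaf (F : presheaf) : Prop :=
  forall (E : etale) (I : Type) (Ei : I -> etale) (f : forall i, ethom (Ei i) E),
    jointly_surjective f ->
  forall s : (forall i, F (Ei i)),
    (forall i j E' (a : ethom E' (Ei i)) (b : ethom E' (Ei j)),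
       (forall z, et_pts E' z -> f i z.1 (a z.1 z.2) = f j z.1 (b z.1 z.2)) ->
       res a (s i) = res b (s j)) ->
  exists! t : F E, forall i, res (f i) t = s i.

Record shhom (F G : presheaf) := ShHom {
  sh_fun :> forall E, {additive F E -> G E};
  sh_nat : forall E E' (f : ethom E E') s, sh_fun E (res f s) = res f (sh_fun E' s) }.

Definition injective_sheaf (I : presheaf) : Prop :=
  is_sheaf I /\
  forall (F G : presheaf) (u : shhom F G) (f : shhom F I),
    is_sheaf F -> is_sheaf G -> (forall E, injective (u E)) ->
  exists h : shhom G I, forall E s, h E (u E s) = f E s.

Record complex := Complex {
  cx_obj :> nat -> presheaf;
  cx_d : forall i, shhom (cx_obj i) (cx_obj i.+1);
  cx_dd : forall i E s, cx_d i.+1 E (cx_d i E s) = 0;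
  cx_inj : forall i, injective_sheaf (cx_obj i) }.

(* A complex [K] in the derived category of Z_l-sheaves on Y, given by objects
   K_n of D(Y, Z/l^n) with compatible isomorphisms between K_n and the derived
   reduction of K_(n+1) modulo l^n, is presented by a complex M of injective
   sheaves of abelian groups representing the derived tensor product of K with
   Q_l/Z_l, that is, the colimit of the K_n along multiplication by l. Then K_n
   is the subcomplex M[l^n] of the sections killed by l^n: it consists of
   injective Z/l^n-sheaves and represents RHom(Z/l^n, M) = K_n, so that derived
   direct images along open immersions are computed termwise on M[l^n]. The
   transition map from K_(n+1) to K_n is multiplication by l. *)

Section Cohomology.
Variables (M : complex) (l : nat).

(* s is the differential of a section of M[l^n] over E *)
Definition coboundary (n i : nat) (E : etale) : M i E -> Prop :=
  match i return M i E -> Prop with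
  | 0%N => fun s => s = 0
  | j.+1 => fun s => exists r : M j E, r *+ l ^ n = 0 /\ cx_d M j E r = s
  end.

(* Representatives of elements of the stalk at x of the i-th cohomology sheaf
   of Rj_* j^* K_n, with j the inclusion of the complement of C in Y: cocycles
   on the part off C of an etale neighbourhood of x. *)
Record cogerm (C : set T) (hC : zclosed C) (n i : nat) (x : T) := CoGerm {
  cg_nbhd : etale;
  cg_pt : 'rV[k]_(et_dim cg_nbhd);
  cg_ptP : et_pts cg_nbhd (x, cg_pt);
  cg_sec : M i (et_off hC cg_nbhd);
  cg_tors : cg_sec *+ l ^ n = 0;
  cg_cocycle : cx_d M i _ cg_sec = 0 }.

(* the combination of the classes of the z_j with coefficients c_j vanishes *)
Definition comb_eq0 C (hC : zclosed C) n i x r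
    (c : 'I_r -> int) (z : 'I_r -> cogerm hC n i x) : Prop :=
  exists (E : etale) (t : 'rV[k]_(et_dim E)) (a : forall j, ethom E (cg_nbhd (z j))),
    [/\ et_pts E (x, t),
        forall j, a j x t = cg_pt (z j) &
        coboundary n (\sum_j res (eth_off hC (a j)) (cg_sec (z j)) *~ c j)].

Definition killed_by C (hC : zclosed C) n i x (c : int) (z : cogerm hC n i x) : Prop :=
  comb_eq0 (fun _ : 'I_1 => c) (fun _ => z).

(* c [z] = c' [z'] *)
Definition eq_mul C (hC : zclosed C) n i x (c c' : int)
    (z z' : cogerm hC n i x) : Prop :=
  comb_eq0 (fun j : 'I_2 => if j == 0 then c else - c')
           (fun j : 'I_2 => if j == 0 then z else z').

Definition stalk_germ := @cogerm set0 (zclosed0 T).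

Section Transition.
Variables (n i : nat) (x : T) (z : stalk_germ n.+1 i x).

Lemma transition_tors : cg_sec z *+ l *+ l ^ n = 0.
Proof. by rewrite -mulrnA -expnS cg_tors. Qed.

Lemma transition_cocycle : cx_d M i _ (cg_sec z *+ l) = 0.
Proof. by rewrite raddfMn cg_cocycle mul0rn. Qed.

Definition transition : stalk_germ n i x :=
  CoGerm (cg_ptP z) transition_tors transition_cocycle.
End Transition.

(* elements of H^i(K)_x = lim_n H^i(K_n)_x *)
Record adic_class (i : nat) (x : T) := AdicClass {
  ac_germ :> forall n, stalk_germ n i x;
  ac_compat : forall n, eq_mul 1 1 (transition (ac_germ n.+1)) (ac_germ n) }.

(* elements of Z_l = lim_n Z/l^n *)
Record adic_int := AdicInt {
  ai_rep :> nat -> int;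
  ai_compat : forall n, (ai_rep n.+1 = ai_rep n %[mod (l ^ n)%N%:Z])%Z }.

(* H^i(K)_x tensored with Q has dimension r over Q_l: there are r elements of
   H^i(K)_x independent over Z_l and spanning it up to l-power multiples. *)
Definition has_stalk_dim (i : nat) (x : T) (r : nat) : Prop :=
  exists e : 'I_r -> adic_class i x,
    (forall c : 'I_r -> adic_int,
       (forall n, comb_eq0 (fun j => c j n) (fun j => e j n)) ->
       forall j n, (c j n = 0 %[mod (l ^ n)%N%:Z])%Z) /\
    (forall y : adic_class i x, exists (m : nat) (c : 'I_r -> adic_int),
       forall n, comb_eq0
         (fun j => if unlift ord0 j is Some j' then - c j' n else (l ^ m)%N%:Z)
         (fun j => if unlift ord0 j is Some j' then e j' n else y n)).

(* the dimension at a point of the orbit S *)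
Definition stalk_dim (i : nat) (S : set T) : nat :=
  xget 0%N [set r | exists2 x, S x & has_stalk_dim i x r].

(* the attaching map from H^i(K_n)_x to H^i(Rj_* j^* K_n)_x *)
Section Attaching.
Variables (C : set T) (hC : zclosed C) (n i : nat) (x : T) (z : stalk_germ n i x).

Lemma attach_pts (E : etale) y :
  et_pts (et_off hC E) y -> et_pts (et_off (zclosed0 T) E) (y.1, y.2).
Proof. by case: y => y t /et_off_pts [Ey _]; apply/et_off_pts; split. Qed.

Definition attach_hom (E : etale) : ethom (et_off hC E) (et_off (zclosed0 T) E) :=
  @EtHom (et_off hC E) (et_off (zclosed0 T) E) (fun _ t => t)
    (@attach_pts E) (@eth_incl_reg C hC E).

Lemma attach_tors : res (attach_hom (cg_nbhd z)) (cg_sec z) *+ l ^ n = 0.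
Proof. by rewrite -raddfMn cg_tors raddf0. Qed.

Lemma attach_cocycle : cx_d M i _ (res (attach_hom (cg_nbhd z)) (cg_sec z)) = 0.
Proof. by rewrite sh_nat cg_cocycle raddf0. Qed.

Definition attach : cogerm hC n i x :=
  CoGerm (cg_ptP z) attach_tors attach_cocycle.
End Attaching.

(* K restricts to the constant sheaf Z_l in degree 0 on the open subset S. As
   M vanishes in negative degrees, H^0(K_n) is the sheaf of sections of M^0
   killed by l^n and by the differential; u n is the section 1 of Z/l^n. *)
Definition constant_on (S : set T) : Prop :=
  (exists u : forall (n : nat) (E : etale), M 0%N E,
    [/\ forall n E E' (f : ethom E E'),
          (forall z, et_pts E' z -> S z.1) -> res f (u n E') = u n E,
        forall n E, (forall z, et_pts E z -> S z.1) ->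
          [/\ u n E *+ l ^ n = 0, cx_d M 0%N E (u n E) = 0 & u n.+1 E *+ l = u n E],
        forall n E (c : int), (forall z, et_pts E z -> S z.1) ->
          et_pts E !=set0 -> u n E *~ c = 0 -> (c = 0 %[mod (l ^ n)%N%:Z])%Z &
        forall n x (z : stalk_germ n 0 x), S x ->
          exists (c : int) (E : etale) (t : 'rV[k]_(et_dim E))
                 (a : ethom E (cg_nbhd z)),
            [/\ et_pts E (x, t), a x t = cg_pt z,
                (forall y, et_pts E y -> S y.1) &
                res (eth_off (zclosed0 T) a) (cg_sec z) =
                  u n (et_off (zclosed0 T) E) *~ c]]) /\
  (forall n i x (z : stalk_germ n i.+1 x), S x -> killed_by 1 z).

(* H^i(K) tensored with Q vanishes along S *)
Definition vanishes_along (i : nat) (S : set T) : Prop :=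
  exists m : nat, forall n x (z : stalk_germ n i x), S x ->
    killed_by (l ^ m)%N%:Z z.

(* The attaching map H^i(K) -> H^i(Rj_* j^* K), j the inclusion of the
   complement of the closure of S in Y, is an isomorphism along S after
   tensoring with Q. *)
Definition attaching_iso (i : nat) (S : set T) : Prop :=
  exists m : nat, forall n x, S x ->
    (forall z : stalk_germ n i x,
       killed_by 1 (attach (zclosed_zclosure S) z) -> killed_by (l ^ m)%N%:Z z) /\
    (forall w : cogerm (zclosed_zclosure S) n i x, exists z : stalk_germ n i x,
       eq_mul 1 (l ^ m)%N%:Z (attach (zclosed_zclosure S) z) w).

End Cohomology.
End EtaleSite.
End Zariski.

Section IndexSets.
Variables n d : nat.

(* The rows and columns 1, .., 2n+1 are numbered 0, .., 2n; the entries are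
   bounded by their sum 2d+1, which makes the index set finite. *)
Definition in_Xi (A : 'M['I_(d.*2.+2)]_(n.*2.+1)) : bool :=
  (\sum_i \sum_j (A i j : nat) == d.*2.+1)%N &&
  [forall i, forall j, A i j == A (rev_ord i) (rev_ord j)].

Record Xi := MkXi { Xi_mx :> 'M['I_(d.*2.+2)]_(n.*2.+1); XiP : in_Xi Xi_mx }.
HB.instance Definition _ := [isSub for Xi_mx].
HB.instance Definition _ := [Finite of Xi by <:].

Definition mid : 'I_(n.*2.+1) := inord n.

Definition in_iXi (A : Xi) : bool :=
  [&& A mid mid == 1%N :> nat,
      [forall j, (j != mid) ==> (A mid j == 0%N :> nat)] &
      [forall i, (i != mid) ==> (A i mid == 0%N :> nat)]].

Definition iXi := {A : Xi | in_iXi A}.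

Definition sqle (A' A : Xi) : Prop :=
  [/\ forall i, (\sum_j (A' i j : nat) = \sum_j (A i j : nat))%N,
      forall j, (\sum_i (A' i j : nat) = \sum_i (A i j : nat))%N,
      forall i j : 'I_(n.*2.+1), (i < j)%N ->
        (\sum_(r : 'I_(n.*2.+1) | (r <= i)%N) \sum_(s : 'I_(n.*2.+1) | (j <= s)%N) (A' r s : nat) <=
         \sum_(r : 'I_(n.*2.+1) | (r <= i)%N) \sum_(s : 'I_(n.*2.+1) | (j <= s)%N) (A r s : nat))%N &
      forall i j : 'I_(n.*2.+1), (j < i)%N ->
        (\sum_(r : 'I_(n.*2.+1) | (i <= r)%N) \sum_(s : 'I_(n.*2.+1) | (s <= j)%N) (A' r s : nat) <=
         \sum_(r : 'I_(n.*2.+1) | (i <= r)%N) \sum_(s : 'I_(n.*2.+1) | (s <= j)%N) (A r s : nat))%N].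

Definition sqlt (A' A : Xi) : Prop := sqle A' A /\ A' <> A.

End IndexSets.

Section Orbits.
Variables (n d : nat) (k : fieldType) (Q : 'M[k]_(d.*2.+1)).

Definition flag_type := {ffun 'I_(n.*2.+2) -> {vspace 'rV[k]_(d.*2.+1)}}.

(* The coordinates of a flag of dimension vector c are the invertible matrices
   whose first c_i rows span its i-th term. *)
Definition flag_space : cspace k :=
  @CSpace k flag_type ('I_(n.*2.+2) -> nat) (d.*2.+1 * d.*2.+1)
    (fun c V w => let g : 'M[k]_(d.*2.+1) := vec_mx w in
       [/\ g \in unitmx, forall i, \dim (V i) = c i &
           forall i, V i = <<[seq row j g | j : 'I_(d.*2.+1) <- enum 'I_(d.*2.+1) & (j < c i)%N]>>%VS]).

Definition flag_pairs : cspace k := prod_space flag_space flag_space.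

Definition is_flag (V : flag_type) : Prop :=
  [/\ V ord0 = 0%VS, V ord_max = fullv,
      forall i : 'I_(n.*2.+1), (V (widen_ord (leqnSn _) i) <= V (lift ord0 i))%VS &
      forall i w, w \in V i <->
        forall u, u \in V (rev_ord i) -> u *m Q *m w^T = 0].

Definition orbO (A : Xi n d) : set flag_pairs :=
  [set VW | [/\ is_flag VW.1, is_flag VW.2 &
    forall i j : 'I_(n.*2.+1),
      let Vi := VW.1 (lift ord0 i) in
      let Vi1 := VW.1 (widen_ord (leqnSn _) i) in
      let Wj := VW.2 (lift ord0 j) in
      let Wj1 := VW.2 (widen_ord (leqnSn _) j) in
      (A i j : nat) = (\dim (Vi1 + Vi :&: Wj) - \dim (Vi1 + Vi :&: Wj1))%N]].

Definition orb_le (A' A : Xi n d) : Prop := orbO A' `<=` zclosure (orbO A).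

Definition orb_dim (A : Xi n d) : nat := zdim (orbO A).

Definition proj_dim (A : Xi n d) : nat :=
  zdim ([set VW.1 | VW in orbO A] : set flag_space).

(* K is the l-adic intersection complex of the closure of the orbit of A, with
   its Goresky-MacPherson-Deligne definition: it is constant of rank 1 in degree
   0 on the orbit, and on every smaller orbit, of codimension c, the cohomology
   vanishes in degrees >= c and the attaching map is an isomorphism in degrees
   < c. *)
Definition is_IC (l : nat) (A : Xi n d) (K : complex (zclosure (orbO A))) : Prop :=
  constant_on K l (orbO A) /\
  forall B, orb_le B A -> B <> A -> forall i,
    ((orb_dim A <= i + orb_dim B)%N -> vanishes_along K l i (orbO B)) /\
    ((i + orb_dim B < orb_dim A)%N -> attaching_iso K l i (orbO B)).

Definition Sj := {ffun Xi n d -> Laurent^o}.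

Definition eb (A : Xi n d) : Sj := [ffun B => (B == A)%:R].

(* the exponent is -d_A *)
Definition std (A : Xi n d) : Sj :=
  vpow ((proj_dim A)%:Z - (orb_dim A)%:Z) *: eb A.

Definition Si : set Sj :=
  [set x | exists c : iXi n d -> Laurent, x = \sum_A c A *: std (val A)].

Section Canonical.
Variables (l : nat) (IC : forall A : Xi n d, complex (zclosure (orbO A))).

Definition ICpoly (A' A : Xi n d) : Laurent :=
  \sum_(i \in [set: nat])
    vpow (i%:Z - (orb_dim A)%:Z + (orb_dim A')%:Z) *+ stalk_dim (IC A) l i (orbO A').

Definition can (A : Xi n d) : Sj :=
  \sum_(A' | `[< orb_le A' A >]) ICpoly A' A *: std A'.

Definition Bj : set Sj := [set can A | A in [set: Xi n d]].

Definition is_bar (bar : {additive Sj -> Sj}) : Prop :=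
  (forall (z : int) x, bar (vpow z *: x) = vpow (- z) *: bar x) /\
  (forall A, bar (can A) = can A).
End Canonical.

Definition is_basis_Si (b : iXi n d -> Sj) : Prop :=
  (forall A, Si (b A)) /\
  (forall x, Si x -> exists! c : {ffun iXi n d -> Laurent}, x = \sum_A c A *: b A).

(* for the bar involution of S^i obtained by restricting [bar] *)
Definition is_canonical_basis_Si (bar : Sj -> Sj) (b : iXi n d -> Sj) : Prop :=
  [/\ is_basis_Si b,
      forall A, bar (b A) = b A &
      forall A, exists c : iXi n d -> Laurent,
        (forall A', negative_laurent (c A')) /\
        b A = std (val A) +
          \sum_(A' : iXi n d | `[< sqlt (val A') (val A) >]) c A' *: std (val A')].

End Orbits.

(* Main.v *)
(** Every A' <= A satisfies A' [<=] A in the combinatorial order, since the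
    conditions dim (V_i + W_j) <= r are closed; in particular A' has the row and
    column sums of A. As the middle row and column of an element of Xi_d are
    symmetric, A' lies in iXi_d as soon as A does (a symmetric row of sum 1 is
    concentrated in the middle). The stalk dimensions of the intersection complex
    give P_{A,A} = 1 and P_{A',A} in v^-1 Z[v^-1] for A' < A, so that {A} is
    unitriangular over the standard basis, and it is bar invariant. Conversely,
    two bar invariant elements of this form differ by a bar invariant combination
    of standard basis elements with coefficients in v^-1 Z[v^-1]; its leading
    coefficients are invariant under v -> v^-1, hence vanish.

    The stalk dimensions are read off by giving each germ of H^0 along the orbit
    an l-adic value. That values are additive and unique rests on the fact that
    the etale neighbourhoods of a point form a filtered system, which uses local
    sections of the coordinates of a flag (the big cell). The orbits are nonempty
    because over an algebraically closed field of characteristic different from 2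
    the form is congruent to any symmetric permutation matrix. *)

Require Import Defs.
From mathcomp Require Import all_boot all_order all_algebra all_field.
From mathcomp Require Import boolp classical_sets.
From mathcomp Require Import fsbigop mpoly zify.
Import Order.TTheory GRing.Theory Num.Theory.
Set Implicit Arguments.
Unset Strict Implicit.
Unset Printing Implicit Defensive.
Local Open Scope classical_set_scope.
Local Open Scope ring_scope.

(** * Regular functions and polynomials with regular coefficients *)

(** Regular functions are local fractions in an adapted basis of a flag, which the flag does not
    determine, whereas an etale object is cut out by polynomials whose coefficients are regular
    functions of the flag itself. Shrinking a neighbourhood to the locus where a regular function is
    nonzero means rewriting that fraction as such an equation, and this is where a regular choice of
    adapted bases enters. Filteredness then reduces to shrinking: two maps to an etale object that
    agree at a point agree where a determinant of divided differences is invertible.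

    [stalk_dim] chooses a rank with default 0. Hence the rank of a constant sheaf has to be shown
    both to exist and to be unique, and an empty orbit would spoil P_{A,A} = 1.

    Closure order and combinatorial order meet in one function, the corner sums dim (V_i meet W_j),
    which grow under degeneration.

    [bar] is prescribed on the elements {A} only. Its triangularity on the standard basis is
    recovered by inverting the expansion of {A}, by induction on [rank_fun], a natural number that
    refines the order; a leading term is one of maximal [rank_fun]. *)

Section LocalFractions.
Variables (k : fieldType) (m : nat) (I : Type) (D : set I) (coo : I -> 'rV[k]_m).
Local Notation ev := (@evalr k _).

(** The index type will consist of pairs of a point and one of its coordinate vectors: the fraction
    is in the vector, while the function depends on the point alone. *)
Definition loc_frac (v : 'rV[k]_m) (f : I -> k) : Prop :=
  exists p q : {mpoly k[m]}, ev q v != 0 /\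
    forall i, D i -> ev q (coo i) != 0 -> f i = ev p (coo i) / ev q (coo i).

Lemma evalrM (p q : {mpoly k[m]}) v : ev (p * q) v = ev p v * ev q v.
Proof. by rewrite /ev mevalM. Qed.

Lemma evalrD (p q : {mpoly k[m]}) v : ev (p + q) v = ev p v + ev q v.
Proof. by rewrite /ev mevalD. Qed.

Lemma evalr1 v : ev (1 : {mpoly k[m]}) v = 1.
Proof. by rewrite /ev meval1. Qed.

Lemma evalr0 v : ev (0 : {mpoly k[m]}) v = 0.
Proof. by rewrite /evalr meval0. Qed.

Lemma evalrC c v : ev (c%:MP_[m]) v = c.
Proof. by rewrite /ev mevalC. Qed.

Lemma evalrXU i v : ev ('X_i : {mpoly k[m]}) v = v 0 i.
Proof. by rewrite /ev mevalXU. Qed.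

Variable v : 'rV[k]_m.

Lemma loc_frac_ext f g : (forall i, D i -> f i = g i) -> loc_frac v f -> loc_frac v g.
Proof.
move=> fg [p [q [qv H]]]; exists p, q; split=> // i Di qi.
by rewrite -fg // H.
Qed.

Lemma loc_frac_poly p : loc_frac v (fun i => ev p (coo i)).
Proof.
by exists p, 1; rewrite evalr1 oner_neq0; split=> // i _ _; rewrite evalr1 divr1.
Qed.

Lemma loc_fracC c : loc_frac v (fun=> c).
Proof.
by apply: loc_frac_ext (loc_frac_poly c%:MP) => i _; rewrite evalrC.
Qed.

Lemma loc_frac_coo j : loc_frac v (fun i => coo i 0 j).
Proof.
by apply: loc_frac_ext (loc_frac_poly 'X_j) => i _; rewrite evalrXU.
Qed.

Lemma loc_fracD f g : loc_frac v f -> loc_frac v g -> loc_frac v (fun i => f i + g i).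
Proof.
move=> [p [q [qv H]]] [p' [q' [qv' H']]]; exists (p * q' + p' * q), (q * q').
rewrite evalrM mulf_neq0 //; split=> // i Di; rewrite evalrM mulf_eq0.
by move=> /norP[qi qi']; rewrite H // H' // evalrD !evalrM addf_div.
Qed.

Lemma loc_fracM f g : loc_frac v f -> loc_frac v g -> loc_frac v (fun i => f i * g i).
Proof.
move=> [p [q [qv H]]] [p' [q' [qv' H']]]; exists (p * p'), (q * q').
rewrite evalrM mulf_neq0 //; split=> // i Di; rewrite evalrM mulf_eq0.
by move=> /norP[qi qi']; rewrite H // H' // !evalrM mulf_div.
Qed.

Lemma loc_frac_sum (J : Type) (r : seq J) (P : pred J) (f : J -> I -> k) :
  (forall j, P j -> loc_frac v (f j)) -> loc_frac v (fun i => \sum_(j <- r | P j) f j i).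
Proof.
move=> H; elim: r => [|j r IH].
  by apply: loc_frac_ext (loc_fracC 0) => i _; rewrite big_nil.
case Pj: (P j); last by apply: loc_frac_ext IH => i _; rewrite big_cons Pj.
apply: loc_frac_ext (loc_fracD (H j Pj) IH) => i _.
by rewrite big_cons Pj.
Qed.

Lemma loc_frac_prod (J : Type) (r : seq J) (P : pred J) (f : J -> I -> k) :
  (forall j, P j -> loc_frac v (f j)) -> loc_frac v (fun i => \prod_(j <- r | P j) f j i).
Proof.
move=> H; elim: r => [|j r IH].
  by apply: loc_frac_ext (loc_fracC 1) => i _; rewrite big_nil.
case Pj: (P j); last by apply: loc_frac_ext IH => i _; rewrite big_cons Pj.
apply: loc_frac_ext (loc_fracM (H j Pj) IH) => i _.
by rewrite big_cons Pj.
Qed.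

Lemma loc_fracX f e : loc_frac v f -> loc_frac v (fun i => f i ^+ e).
Proof.
move=> H; elim: e => [|e IH].
  by apply: loc_frac_ext (loc_fracC 1) => i _; rewrite expr0.
by apply: loc_frac_ext (loc_fracM H IH) => i _; rewrite exprS.
Qed.

Lemma loc_frac_comp r (p : {mpoly k[r]}) (f : 'I_r -> I -> k) :
  (forall j, loc_frac v (f j)) -> loc_frac v (fun i => p.@[fun j => f j i]).
Proof.
move=> H; apply: (@loc_frac_ext (fun i => \sum_(e <- msupp p) p@_e * \prod_(j < r) f j i ^+ e j)).
  by move=> i _; rewrite mevalE.
apply: loc_frac_sum => e _; apply: loc_fracM (loc_fracC _) _.
by apply: loc_frac_prod => j _; apply: loc_fracX.
Qed.

Lemma loc_frac_det r (M : I -> 'M[k]_r) :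
  (forall a b, loc_frac v (fun i => M i a b)) -> loc_frac v (fun i => \det (M i)).
Proof.
move=> H; rewrite /determinant; apply: loc_frac_sum => s _.
by apply: loc_fracM (loc_fracC _) _; apply: loc_frac_prod.
Qed.

End LocalFractions.

Section Regular.
Variable k : fieldType.
Local Notation ev := (@evalr k _).

Lemma regular_onE (T : cspace k) (S : set T) (f : T -> k) :
  regular_on S f <-> forall x, S x -> forall c v, Defs.coord c x v ->
    loc_frac [set i : T * 'rV[k]_(cdim T) | S i.1 /\ Defs.coord c i.1 i.2] snd v (fun i => f i.1).
Proof.
split=> H x Sx c v cv; have [p [q [qv Hpq]]] := H x Sx c v cv.
  by exists p, q; split=> // -[y w] [/= Sy cw]; apply: Hpq.
by exists p, q; split=> // y w Sy cw qw; apply: (Hpq (y, w)).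
Qed.

Section Closure.
Variables (T : cspace k) (S : set T).

Lemma regular_on_ext f g : (forall x, S x -> f x = g x) -> regular_on S f -> regular_on S g.
Proof.
move=> fg H x Sx c v cv; have [p [q [qv Hpq]]] := H x Sx c v cv.
by exists p, q; split=> // y w Sy cw qw; rewrite -fg //; apply: Hpq.
Qed.

Lemma regular_onC a : regular_on S (fun=> a).
Proof. by apply/regular_onE => x Sx c v cv; apply: loc_fracC. Qed.

Lemma regular_onD f g : regular_on S f -> regular_on S g -> regular_on S (fun x => f x + g x).
Proof.
move=> /regular_onE Hf /regular_onE Hg; apply/regular_onE => x Sx c v cv.
by apply: loc_fracD; [apply: Hf Sx _ _ cv|apply: Hg Sx _ _ cv].
Qed.

Lemma regular_onM f g : regular_on S f -> regular_on S g -> regular_on S (fun x => f x * g x).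
Proof.
move=> /regular_onE Hf /regular_onE Hg; apply/regular_onE => x Sx c v cv.
by apply: loc_fracM; [apply: Hf Sx _ _ cv|apply: Hg Sx _ _ cv].
Qed.

Lemma regular_on_sum (J : Type) (r : seq J) (P : pred J) (f : J -> T -> k) :
  (forall j, P j -> regular_on S (f j)) -> regular_on S (fun x => \sum_(j <- r | P j) f j x).
Proof.
move=> H; apply/regular_onE => x Sx c v cv; apply: loc_frac_sum => j Pj.
by have /regular_onE := H j Pj; move=> /(_ x Sx c v cv).
Qed.

Lemma regular_on_comp r (p : {mpoly k[r]}) (f : 'I_r -> T -> k) :
  (forall j, regular_on S (f j)) -> regular_on S (fun x => p.@[fun j => f j x]).
Proof.
move=> H; apply/regular_onE => x Sx c v cv.
apply: (@loc_frac_comp _ _ _ _ _ v r p (fun j (i : T * 'rV[k]_(cdim T)) => f j i.1)) => j.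
by have /regular_onE := H j; move=> /(_ x Sx c v cv).
Qed.

Lemma regular_on_det r (M : T -> 'M[k]_r) :
  (forall a b, regular_on S (fun x => M x a b)) -> regular_on S (fun x => \det (M x)).
Proof.
move=> H; apply/regular_onE => x Sx c v cv.
apply: (@loc_frac_det _ _ _ _ _ v r (fun i : T * 'rV_(cdim T) => M i.1)) => a b.
by have /regular_onE := H a b; move=> /(_ x Sx c v cv).
Qed.

End Closure.

(* [g] is a lift of [h] to coordinate vectors by local fractions. *)
Lemma regular_on_pull (T T' : cspace k) (S : set T) (S' : set T')
    (h : T -> T') (f : T' -> k) :
  (forall x, S x -> S' (h x)) ->
  (forall c x v, S x -> Defs.coord c x v -> exists c' (g : T * 'rV[k]_(cdim T) -> 'rV[k]_(cdim T')),
    [/\ forall y w, S y -> Defs.coord c y w -> Defs.coord c' (h y) (g (y, w)) &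
        forall j, loc_frac [set i | S i.1 /\ Defs.coord c i.1 i.2] snd v (fun i => g i 0 j)]) ->
  regular_on S' f -> regular_on S (f \o h).
Proof.
move=> hS hg rf; apply/regular_onE => x Sx c v cv.
have [c' [g [gc gl]]] := hg c x v Sx cv.
have [p [q [qv Hpq]]] := rf (h x) (hS x Sx) c' _ (gc x v Sx cv).
pose comp (p : {mpoly k[cdim T']}) (i : T * 'rV[k]_(cdim T)) := ev p (g i).
have lp r : loc_frac [set i | S i.1 /\ Defs.coord c i.1 i.2] snd v (comp r).
  by apply: (@loc_frac_comp _ _ _ _ _ v _ r (fun j i => g i 0 j)).
have [pp [pq [pqv Hp]]] := lp p; have [qp [qq [qqv Hq]]] := lp q.
have qpv : ev qp v != 0.
  apply: contra_neq qv => qp0.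
  by have := Hq (x, v) (conj Sx cv) qqv; rewrite /comp /= qp0 mul0r.
exists (pp * qq * qq), (pq * qp * qq); rewrite !evalrM !mulf_neq0 //; split=> // -[y w] [Sy cw] /=.
rewrite !evalrM !mulf_eq0 => /norP[/norP[pqw qpw] qqw].
have eq := Hq (y, w) (conj Sy cw) qqw; have ep := Hp (y, w) (conj Sy cw) pqw.
have gqw : ev q (g (y, w)) != 0 by rewrite [ev q _]eq /= mulf_neq0 ?invr_neq0.
rewrite /= (Hpq (h y) _ (hS y Sy) (gc y w Sy cw) gqw) [ev q _]eq [ev p _]ep /=.
by rewrite invf_div mulf_div -[RHS]mulf_div divff // mulr1.
Qed.


End Regular.

Section RegularPolynomials.
Variables (k : fieldType) (T : cspace k) (S : set T).

(** The uniform degree bound lets evaluation and substitution be written as one finite sum over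
    monomials, the same at all points. *)
Definition regpoly r (F : T -> {mpoly k[r]}) : Prop :=
  (forall m, regular_on S (fun x => (F x)@_m)) /\
  exists b, forall x, S x -> (msize (F x) <= b)%N.

Lemma regpoly_ext r (F G : T -> {mpoly k[r]}) :
  (forall x, S x -> F x = G x) -> regpoly F -> regpoly G.
Proof.
move=> FG [rF [b bF]]; split=> [m|].
  by apply: regular_on_ext (rF m) => x Sx; rewrite FG.
by exists b => x Sx; rewrite -FG // bF.
Qed.

Lemma regpolyC r (c : T -> k) : regular_on S c -> regpoly (fun x => (c x)%:MP_[r]).
Proof.
move=> rc; split=> [m|].
  apply: (@regular_on_ext _ _ _ (fun x => c x * (m == 0%MM)%:R)).
    by move=> x _; rewrite mcoeffC.
  by apply: regular_onM rc _; apply: regular_onC.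
by exists 1%N => x _; rewrite msizeC leq_b1.
Qed.

Lemma regpoly_cst r (p : {mpoly k[r]}) : regpoly (fun=> p).
Proof.
by split=> [m|]; [apply: regular_onC|exists (msize p)].
Qed.

Lemma regpolyD r (F G : T -> {mpoly k[r]}) :
  regpoly F -> regpoly G -> regpoly (fun x => F x + G x).
Proof.
move=> [rF [b bF]] [rG [c bG]]; split=> [m|].
  apply: regular_on_ext (regular_onD (rF m) (rG m)) => x _.
  by rewrite mcoeffD.
exists (maxn b c) => x Sx; apply: leq_trans (msizeD_le _ _) _.
by rewrite geq_max !leq_max bF // bG // orbT.
Qed.

Lemma regpolyM r (F G : T -> {mpoly k[r]}) :
  regpoly F -> regpoly G -> regpoly (fun x => F x * G x).
Proof.
move=> [rF [b bF]] [rG [c bG]]; split=> [m|].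
  apply: (@regular_on_ext _ _ _ (fun x =>
    \sum_(e : 'X_{1..r < (mdeg m).+1, (mdeg m).+1} | m == (e.1 + e.2)%MM)
      ((F x)@_e.1 * (G x)@_e.2))).
    by move=> x _; rewrite mcoeffM.
  by apply: regular_on_sum => e _; apply: regular_onM.
exists (b + c).+1 => x Sx; apply: leq_trans (msizeM_le _ _) _.
by rewrite ltnS leq_add ?bF ?bG.
Qed.

Lemma regpoly_sum r (J : Type) (s : seq J) (P : pred J) (F : J -> T -> {mpoly k[r]}) :
  (forall j, P j -> regpoly (F j)) -> regpoly (fun x => \sum_(j <- s | P j) F j x).
Proof.
move=> H; elim: s => [|j s IH].
  by apply: regpoly_ext (regpoly_cst 0) => x _; rewrite big_nil.
case Pj: (P j); last by apply: regpoly_ext IH => i _; rewrite big_cons Pj.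
by apply: regpoly_ext (regpolyD (H j Pj) IH) => i _; rewrite big_cons Pj.
Qed.

Lemma regpoly_prod r (J : Type) (s : seq J) (P : pred J) (F : J -> T -> {mpoly k[r]}) :
  (forall j, P j -> regpoly (F j)) -> regpoly (fun x => \prod_(j <- s | P j) F j x).
Proof.
move=> H; elim: s => [|j s IH].
  by apply: regpoly_ext (regpoly_cst 1) => x _; rewrite big_nil.
case Pj: (P j); last by apply: regpoly_ext IH => i _; rewrite big_cons Pj.
by apply: regpoly_ext (regpolyM (H j Pj) IH) => i _; rewrite big_cons Pj.
Qed.

Lemma regpolyX r (F : T -> {mpoly k[r]}) e : regpoly F -> regpoly (fun x => F x ^+ e).
Proof.
move=> H; elim: e => [|e IH].
  by apply: regpoly_ext (regpoly_cst 1) => x _; rewrite expr0.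
by apply: regpoly_ext (regpolyM H IH) => x _; rewrite exprS.
Qed.

Lemma regpoly_comp r r' (F : T -> {mpoly k[r]}) (G : 'I_r -> T -> {mpoly k[r']}) :
  regpoly F -> (forall i, regpoly (G i)) ->
  regpoly (fun x => comp_mpoly [tuple G i x | i < r] (F x)).
Proof.
move=> [rF [b bF]] rG.
apply: (@regpoly_ext _ (fun x => \sum_(m : 'X_{1..r < b})
  ((F x)@_m)%:MP * \prod_(i < r) G i x ^+ m i)).
  move=> x Sx; rewrite (comp_mpolywE _ (bF x Sx)); apply: eq_bigr => m _.
  by rewrite mul_mpolyC; congr (_ *: _); apply: eq_bigr => i _; rewrite tnth_mktuple.
apply: regpoly_sum => m _; apply: regpolyM; first exact: regpolyC.
by apply: regpoly_prod => i _; apply: regpolyX.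
Qed.

End RegularPolynomials.

Lemma regpolyS (k : fieldType) (T : cspace k) (S S' : set T) r (F : T -> {mpoly k[r]}) :
  S' `<=` S -> regpoly S F -> regpoly S' F.
Proof.
move=> SS [rF [b bF]]; split=> [m|]; first exact: regular_onS (rF m).
by exists b => x /SS; apply: bF.
Qed.

Section RegularEvaluation.
Variables (k : fieldType) (T : cspace k) (S : set T).

Lemma regular_on_fst (r : nat) (S' : set (prod_space T (affine_space k r))) (f : T -> k) :
  (forall z, S' z -> S z.1) -> regular_on S f -> regular_on S' (fun z => f z.1).
Proof.
move=> SS rf; apply: (@regular_on_pull _ _ _ S' S fst f) => //.
move=> c [x t] w S'x cw; exists c.1, (fun i => lsubmx i.2); split.
  by move=> [y u] v S'y [].
move=> j; apply: loc_frac_ext (loc_frac_coo _ _ _ (lshift r j)) => i _.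
by rewrite mxE.
Qed.

Lemma regular_on_snd (r : nat) (S' : set (prod_space T (affine_space k r))) (j : 'I_r) :
  regular_on S' (fun z => z.2 0 j).
Proof.
apply/regular_onE => z S'z c v cv.
apply: loc_frac_ext (loc_frac_coo _ _ _ (rshift (cdim T) j)) => -[[y t] w] /= [_ [_ /= <-]].
by rewrite mxE.
Qed.

Lemma regular_on_eval (T' : cspace k) (S' : set T') r (F : T' -> {mpoly k[r]})
    (f : 'I_r -> T' -> k) :
  regpoly S' F -> (forall j, regular_on S' (f j)) ->
  regular_on S' (fun z => (F z).@[fun j => f j z]).
Proof.
move=> [rF [b bF]] rf.
apply: (@regular_on_ext _ _ _ (fun x => \sum_(m : 'X_{1..r < b})
  (F x)@_m * \prod_(i < r) f i x ^+ m i)).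
  move=> x Sx; rewrite [in RHS](mpolywE (bF x Sx)) raddf_sum; apply: eq_bigr => m _ /=.
  by rewrite mevalZ mevalX.
apply: regular_on_sum => m _; apply: regular_onM; first exact: rF.
apply: (@regular_on_ext _ _ _ (fun x => ('X_[m] : {mpoly k[r]}).@[fun j => f j x])).
  by move=> x _; rewrite mevalX.
exact: regular_on_comp.
Qed.

Lemma regpoly_fst r r' (S' : set (prod_space T (affine_space k r))) (F : T -> {mpoly k[r']}) :
  (forall z, S' z -> S z.1) -> regpoly S F ->
  @regpoly _ (prod_space T (affine_space k r)) S' r' (fun z => F z.1).
Proof.
move=> SS [rF [b bF]]; split=> [m|].
  by apply: (@regular_on_fst _ _ (fun x => (F x)@_m)).
by exists b => z /SS; apply: bF.
Qed.
End RegularEvaluation.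

(** * Divided differences *)

Section PolynomialCalculus.
Variable k : fieldType.
Local Notation ev := (@evalr k _).

Lemma mpoly_ring_ind r (P : {mpoly k[r]} -> Prop) :
  (forall c, P c%:MP) -> (forall i, P 'X_i) ->
  (forall p q, P p -> P q -> P (p + q)) ->
  (forall p q, P p -> P q -> P (p * q)) -> forall p, P p.
Proof.
move=> PC PX PD PM p; have P0 : P 0 by rewrite -mpolyC0.
elim/mpolyind: p => // c m p _ _ Pp; apply: (PD) => //.
rewrite -mul_mpolyC; apply: (PM) => //; rewrite mpolyXE_id.
apply: (big_ind P); [by rewrite -mpolyC1|exact: PM|].
by move=> i _; elim: (m i) => [|e IH]; rewrite ?expr0 -?mpolyC1 // exprS; apply: PM.
Qed.

Lemma mderivXU r (i j : 'I_r) : mderiv j ('X_i : {mpoly k[r]}) = (i == j)%:R.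
Proof.
rewrite mderivX mnm1E; case: eqP => [->|_]; last by rewrite scale0r.
rewrite scale1r (_ : (U_(j) - U_(j))%MM = 0%MM) ?mpolyX0 //.
by apply/mnmP => a; rewrite mnmBE subnn mnm0E.
Qed.

Lemma mderiv_comp r s (g : 'I_r -> {mpoly k[s]}) (a : 'I_s) (p : {mpoly k[r]}) :
  mderiv a (comp_mpoly [tuple g i | i < r] p) =
  \sum_i comp_mpoly [tuple g i | i < r] (mderiv i p) * mderiv a (g i).
Proof.
elim/mpoly_ring_ind: p => [c|i|p q IHp IHq|p q IHp IHq].
- rewrite comp_mpolyC mderivC big1 // => i _.
  by rewrite mderivC comp_mpoly0 mul0r.
- rewrite comp_mpolyXU -tnth_nth tnth_mktuple (bigD1 i) //= big1 => [|j ji].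
    by rewrite addr0 mderivXU eqxx comp_mpoly1 mul1r.
  by rewrite mderivXU eq_sym (negbTE ji) comp_mpoly0 mul0r.
- rewrite comp_mpolyD mderivD IHp IHq -big_split; apply: eq_bigr => i _.
  by rewrite mderivD comp_mpolyD mulrDl.
- rewrite rmorphM mderivM IHp IHq mulr_suml mulr_sumr -big_split.
  apply: eq_bigr => i _ /=; rewrite mderivM comp_mpolyD !rmorphM /= mulrDl.
  by rewrite mulrAC mulrA.
Qed.

Definition ren r s (h : 'I_r -> 'I_s) (p : {mpoly k[r]}) : {mpoly k[s]} :=
  comp_mpoly [tuple 'X_(h i) | i < r] p.

Lemma evalr_ren r s (h : 'I_r -> 'I_s) p w :
  ev (ren h p) w = ev p (\row_i w 0 (h i)).
Proof.
rewrite /ren /evalr comp_mpoly_meval; apply: meval_eq => i.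
by rewrite tnth_mktuple mevalXU mxE.
Qed.

Lemma mderiv_ren r s (h : 'I_r -> 'I_s) a p :
  mderiv a (ren h p) = \sum_(i | h i == a) ren h (mderiv i p).
Proof.
rewrite /ren mderiv_comp [RHS]big_mkcond; apply: eq_bigr => i _.
by rewrite mderivXU; case: eqP => _; rewrite ?mulr1 ?mulr0.
Qed.

Lemma regpoly_ren (T : cspace k) (S : set T) r s (h : 'I_r -> 'I_s) (F : T -> {mpoly k[r]}) :
  regpoly S F -> regpoly S (fun x => ren h (F x)).
Proof.
move=> rF; apply: (@regpoly_comp _ _ _ _ _ F (fun i _ => 'X_(h i))) => // i.
exact: regpoly_cst.
Qed.

(** Constants and variables have such an [M], and products inherit it from pq - p'q' = p (q - q') +
    (p - p') q'. On the diagonal this becomes the Leibniz rule. *)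
Lemma divided_differences r (p : {mpoly k[r]}) :
  exists M : 'I_r -> {mpoly k[r + r]},
    (forall s s', ev p s - ev p s' = \sum_j ev (M j) (row_mx s s') * (s 0 j - s' 0 j)) /\
    (forall s j, ev (M j) (row_mx s s) = ev (mderiv j p) s).
Proof.
elim/mpoly_ring_ind: p => [c|i|p q [M [M1 M2]] [N [N1 N2]]|p q [M [M1 M2]] [N [N1 N2]]].
- exists (fun=> 0); split=> [s s'|s j].
    by rewrite !evalrC subrr big1 // => j _; rewrite mul0r.
  by rewrite mderivC !evalr0.
- exists (fun j => (j == i)%:R); split=> [s s'|s j].
    rewrite !evalrXU (bigD1 i) //= eqxx evalr1 mul1r big1 ?addr0 // => j /negbTE ->.
    by rewrite evalr0 mul0r.
  by rewrite mderivXU eq_sym; case: eqP => _; rewrite ?evalr1 // mulr0n !evalr0.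
- exists (fun j => M j + N j); split=> [s s'|s j].
    rewrite !evalrD opprD addrACA M1 N1 -big_split; apply: eq_bigr => j _.
    by rewrite evalrD mulrDl.
  by rewrite mderivD !evalrD M2 N2.
- exists (fun j => ren (@lshift r r) p * N j + M j * ren (@rshift r r) q).
  have El s s' f : ev (ren (@lshift r r) f) (row_mx s s') = ev f s.
    by rewrite evalr_ren; congr ev; apply/rowP => j; rewrite mxE row_mxEl.
  have Er s s' f : ev (ren (@rshift r r) f) (row_mx s s') = ev f s'.
    by rewrite evalr_ren; congr ev; apply/rowP => j; rewrite mxE row_mxEr.
  split=> [s s'|s j].
    transitivity (ev p s * (ev q s - ev q s') + (ev p s - ev p s') * ev q s').
      by rewrite !evalrM mulrBr mulrBl addrA subrK.
    rewrite M1 N1 mulr_sumr mulr_suml -big_split; apply: eq_bigr => j _ /=.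
    by rewrite evalrD !evalrM El Er mulrDl mulrA [in X in _ + X]mulrAC.
  by rewrite mderivM !evalrD !evalrM El Er M2 N2 addrC.
Qed.
End PolynomialCalculus.

(** * Extensions and fibre products of etale objects *)

Section Morphisms.
Variables (k : fieldType) (T : cspace k) (Y : set T).
Local Notation ev := (@evalr k _).
Implicit Types E : etale Y.

Section Composition.
Variables (E E' E'' : etale Y) (g : ethom E' E'') (f : ethom E E').

Lemma ethom_comp_pts z :
  et_pts (E := E) z -> et_pts (E := E'') (z.1, g z.1 (f z.1 z.2)).
Proof. by move=> /(eth_pts f) /(eth_pts g). Qed.

Lemma regular_on_ethom (h : T -> 'rV[k]_(et_dim E') -> k) :
  regular_on (et_pts (E := E')) (fun z => h z.1 z.2) ->
  regular_on (et_pts (E := E)) (fun z => h z.1 (f z.1 z.2)).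
Proof.
move=> rh; apply: (@regular_on_pull _ (prod_space T (affine_space k _)) (prod_space T (affine_space k _))
  (et_pts (E := E)) (et_pts (E := E')) (fun z => (z.1, f z.1 z.2)) (fun z => h z.1 z.2)) => //.
  by move=> z /(eth_pts f).
move=> c x v Ex cv; exists c, (fun i => row_mx (lsubmx i.2) (f i.1.1 i.1.2)); split.
  by move=> y w Ey [c1 c2]; split; rewrite /= ?row_mxKl ?row_mxKr.
move=> j; case: (split_ordP j) => a ->.
  apply: (@loc_frac_ext _ _ _ _ _ v
    (fun i : prod_space T (affine_space k (et_dim E)) * 'rV[k]_(cdim T + et_dim E) =>
      i.2 0 (lshift (et_dim E) a))).
    by move=> i _; rewrite row_mxEl mxE.
  exact: (@loc_frac_coo _ _ _ _ snd v (lshift (et_dim E) a)).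
have /regular_onE/(_ x Ex c v cv) := eth_reg f a; move=> H; apply: loc_frac_ext H => i _.
by rewrite row_mxEr.
Qed.

Lemma ethom_comp_reg j :
  regular_on (et_pts (E := E)) (fun z => g z.1 (f z.1 z.2) 0 j).
Proof. exact: (@regular_on_ethom (fun x t => g x t 0 j) (eth_reg g j)). Qed.

Definition ethom_comp : ethom E E'' :=
  @EtHom _ _ _ E E'' (fun x t => g x (f x t)) ethom_comp_pts ethom_comp_reg.
End Composition.

(* Adding to E as many new variables as new equations G whose Jacobian with
   respect to the new variables is invertible. *)
Section Extension.
Variables (E : etale Y) (C : set T) (hC : zclosed C) (q : nat).
Let p := et_dim E.
Variable G : 'I_q -> T -> {mpoly k[p + q]}.
Hypothesis rG : forall i, regpoly (Y `\` (et_rem E `|` C)) (G i).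

Definition ext_eq (i : 'I_(p + q)) (x : T) : {mpoly k[p + q]} :=
  match split i with
  | inl a => ren (@lshift p q) (et_eq a x)
  | inr b => G b x
  end.

Lemma et_regpoly (a : 'I_p) : regpoly (Y `\` et_rem E) (@et_eq _ _ _ E a).
Proof.
split; first by move=> m; apply: et_reg.
by have [b Hb] := et_bounded E; exists b => x; apply: Hb.
Qed.

Lemma ext_regpoly i : regpoly (Y `\` (et_rem E `|` C)) (ext_eq i).
Proof.
rewrite /ext_eq; case: (split i) => a //.
by apply: regpoly_ren; apply: regpolyS (et_regpoly a); apply: et_off_sub.
Qed.

Lemma ext_bounded : exists b, forall i x,
  (Y `\` (et_rem E `|` C)) x -> (msize (ext_eq i x) <= b)%N.
Proof.
have H i := (ext_regpoly i).2; have [f Hf] := choice H.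
exists (\max_i f i)%N => i x Yx; apply: leq_trans (Hf i x Yx) _.
exact: (leq_bigmax i).
Qed.

Definition ext : etale Y :=
  @Etale _ _ Y (et_rem E `|` C) (zclosedU (@et_remP _ _ _ E) hC) (p + q) ext_eq
    (fun i m => (ext_regpoly i).1 m) ext_bounded.

Lemma ext_pts x (w : 'rV_(p + q)) :
  et_pts (E := ext) (x, w) <->
  [/\ et_pts (E := E) (x, lsubmx w), ~ C x, forall b, ev (G b x) w = 0 &
      \det (\matrix_(a, b) ev (mderiv (rshift p b) (G a x)) w) != 0].
Proof.
have lE (f : {mpoly k[p]}) : ev (ren (@lshift p q) f) w = ev f (lsubmx w).
  by rewrite evalr_ren; congr ev; apply/rowP => j; rewrite !mxE.
(* The equations of [E] do not involve the new variables, so the Jacobian matrix is block lower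
   triangular. *)
have Jac : \det (\matrix_(i, j) ev (mderiv j (ext_eq i x)) w) =
   \det (\matrix_(i, j) ev (mderiv j (@et_eq _ _ _ E i x)) (lsubmx w)) *
   \det (\matrix_(a, b) ev (mderiv (rshift p b) (G a x)) w).
  rewrite -(det_lblock _ (\matrix_(a, b) ev (mderiv (lshift q b) (G a x)) w)).
  congr (\det _); apply/matrixP => i j; rewrite !mxE /ext_eq.
  case: (split i) => a; rewrite !mxE -{1}(splitK j); case: (split j) => b /=; rewrite !mxE.
  - rewrite mderiv_ren (bigD1 b) //= big1 ?addr0 ?lE // => j'.
    by move=> /andP[/eqP /lshift_inj ->]; rewrite eqxx.
  - rewrite mderiv_ren big1 ?evalr0 // => j' /eqP /(congr1 val) /= e.
    by have := ltn_ord j'; rewrite e ltnNge leq_addr.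
  - by [].
  - by [].
split=> [[/= [Yx nx] eqs det]|[[/= [Yx nx] eqs det] nC Geq Gdet]].
  move: det; rewrite Jac mulf_eq0 => /norP[detE detG].
  split=> //.
  - split=> //=; first by split=> // rx; apply: nx; left.
    move=> i; have := eqs (lshift q i); rewrite /ext_eq.
    by rewrite (unsplitK (inl i)) lE.
  - by move=> Cx; apply: nx; right.
  - move=> b; have := eqs (rshift p b); rewrite /ext_eq.
    by rewrite (unsplitK (inr b)).
split=> /=; first by split=> // -[].
  move=> i; rewrite /ext_eq; case: (split i) => a //; rewrite lE; exact: eqs.
by rewrite Jac mulf_neq0.
Qed.

Lemma ext_proj_pts z : et_pts (E := ext) z -> et_pts (E := E) (z.1, lsubmx z.2).
Proof. by case: z => x w /ext_pts []. Qed.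

Lemma ext_proj_reg j : regular_on (et_pts (E := ext))
  (fun z : prod_space T (affine_space k (p + q)) => (lsubmx z.2 : 'rV_p) 0 j).
Proof.
apply: (@regular_on_ext _ (prod_space T (affine_space k (p + q))) _ (fun z => z.2 0 (lshift q j))).
  by move=> z _; rewrite mxE.
exact: (@regular_on_snd k T (p + q)).
Qed.

Definition ext_proj : ethom ext E :=
  @EtHom _ _ _ ext E (fun _ w => lsubmx w) ext_proj_pts ext_proj_reg.
End Extension.

Section FibreProduct.
Variables E1 E2 : etale Y.
Let p := et_dim E1.
Let q := et_dim E2.

Lemma etprod_reg (i : 'I_q) : regpoly (Y `\` (et_rem E1 `|` et_rem E2))
  (fun x => ren (@rshift p q) (@et_eq _ _ _ E2 i x)).
Proof.
apply: regpoly_ren; apply: regpolyS (et_regpoly i) => x [Yx nx].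
by split=> // rx; apply: nx; right.
Qed.

(** Over [E1], the equations of [E2] in fresh variables have an invertible Jacobian exactly at the
    points of [E2], so the fibre product is an extension of [E1]. *)
Definition etprod : etale Y := ext (@et_remP _ _ _ E2) etprod_reg.

Lemma etprod_pts x (w : 'rV_(p + q)) :
  et_pts (E := etprod) (x, w) <->
  et_pts (E := E1) (x, lsubmx w) /\ et_pts (E := E2) (x, rsubmx w).
Proof.
have rE (f : {mpoly k[q]}) : ev (ren (@rshift p q) f) w = ev f (rsubmx w).
  by rewrite evalr_ren; congr ev; apply/rowP => j; rewrite !mxE.
have J : (\matrix_(a < q, b < q) ev (mderiv (rshift p b) (ren (@rshift p q) (@et_eq _ _ _ E2 a x))) w)
  = \matrix_(a, b) ev (mderiv b (@et_eq _ _ _ E2 a x)) (rsubmx w).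
  apply/matrixP => a b; rewrite !mxE mderiv_ren (bigD1 b) //= big1 ?addr0 ?rE // => j'.
  by move=> /andP[/eqP /rshift_inj ->]; rewrite eqxx.
split=> [/ext_pts[E1x n2 eq det]|[E1x [/= [Yx nx] eq det]]].
  split=> //; split=> /=; last by rewrite -J.
    by case: E1x => -[].
  by move=> i; rewrite -rE eq.
by apply/ext_pts; split=> //; [move=> b; rewrite rE eq|rewrite J].
Qed.

Definition etprod_fst : ethom etprod E1 := ext_proj (@et_remP _ _ _ E2) etprod_reg.

Lemma etprod_snd_pts z : et_pts (E := etprod) z -> et_pts (E := E2) (z.1, rsubmx z.2).
Proof. by case: z => x w /etprod_pts []. Qed.

Lemma etprod_snd_reg j : regular_on (et_pts (E := etprod))
  (fun z : prod_space T (affine_space k (p + q)) => (rsubmx z.2 : 'rV_q) 0 j).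
Proof.
apply: (@regular_on_ext _ (prod_space T (affine_space k (p + q))) _ (fun z => z.2 0 (rshift p j))).
  by move=> z _; rewrite mxE.
exact: (@regular_on_snd k T (p + q)).
Qed.

Definition etprod_snd : ethom etprod E2 :=
  @EtHom _ _ _ etprod E2 (fun _ w => rsubmx w) etprod_snd_pts etprod_snd_reg.
End FibreProduct.

End Morphisms.

(** * Etale neighbourhoods form a filtered system *)

Section Refinement.
Variables (k : fieldType) (T : cspace k).
Local Notation ev := (@evalr k _).

(** A coordinate vector chosen regularly on an open neighbourhood of [x], all of whose points have
    the type [c]. *)
Definition local_section (x : T) : Prop :=
  exists (c : ctype T) (R : set T) (sg : T -> 'rV[k]_(cdim T)),
    [/\ zclosed R, ~ R x, forall y, ~ R y -> Defs.coord c y (sg y) &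
        forall j, regular_on (~` R) (fun y => sg y 0 j)].

Variables (Y : set T) (x : T).
Hypothesis sec_x : local_section x.
Implicit Types E : etale Y.

(** Divided differences are taken monomial by monomial, so those of the family are linear in its
    coefficients and remain regular in the base point. *)
Lemma dd_family (S : set T) r (F : T -> {mpoly k[r]}) : regpoly S F ->
  exists M : 'I_r -> T -> {mpoly k[r + r]},
    [/\ forall j, regpoly S (M j),
        forall y s s', S y -> ev (F y) s - ev (F y) s' =
          \sum_j ev (M j y) (row_mx s s') * (s 0 j - s' 0 j) &
        forall y s j, S y -> ev (M j y) (row_mx s s) = ev (mderiv j (F y)) s].
Proof.
move=> [rF [b bF]].
have [N HN] := choice (fun m : 'X_{1..r < b} => @divided_differences k r 'X_[m]).
exists (fun j y => \sum_(m : 'X_{1..r < b}) ((F y)@_m)%:MP * N m j).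
have Eev n (c : 'X_{1..r < b} -> k) (f : 'X_{1..r < b} -> {mpoly k[n]}) v :
    ev (\sum_m (c m)%:MP * f m) v = \sum_m c m * ev (f m) v.
  by rewrite /evalr raddf_sum; apply: eq_bigr => m _; rewrite /= mevalM mevalC.
have FE y : S y -> F y = \sum_(m : 'X_{1..r < b}) ((F y)@_m)%:MP * 'X_[m].
  by move=> Sy; rewrite {1}(mpolywE (bF y Sy)); apply: eq_bigr => m _; rewrite mul_mpolyC.
split=> [j|y s s' Sy|y s j Sy].
- apply: regpoly_sum => m _; apply: regpolyM; last exact: regpoly_cst.
  by apply: regpolyC; apply: rF.
- rewrite (FE y Sy) !Eev -sumrB.
  under eq_bigr do rewrite -mulrBr (HN _).1 mulr_sumr.
  rewrite exchange_big; apply: eq_bigr => j _ /=.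
  rewrite -(FE y Sy) Eev mulr_suml; apply: eq_bigr => m _.
  by rewrite mulrA.
- rewrite Eev [in RHS](FE y Sy) raddf_sum /=.
  under [in RHS]eq_bigr do rewrite mderiv_mulC.
  by rewrite Eev; apply: eq_bigr => m _; rewrite (HN _).2.
Qed.

(* Near x, phi is a quotient p/q of polynomials in the coordinates of x and t.
   As these coordinates are not functions of x, they are replaced by those given
   by the section at x; E' adds to E a variable that inverts pq. *)
Lemma localize E t (phi : T -> 'rV[k]_(et_dim E) -> k) :
  et_pts (E := E) (x, t) -> regular_on (et_pts (E := E)) (fun z => phi z.1 z.2) ->
  phi x t != 0 ->
  exists (E' : etale Y) (t' : 'rV[k]_(et_dim E')) (f : ethom E' E),
    [/\ et_pts (E := E') (x, t'), f x t' = t &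
        forall z, et_pts (E := E') z -> phi z.1 (f z.1 z.2) != 0].
Proof.
move=> Ext rphi phi0; have [c [R [sg [cR nRx csg rsg]]]] := sec_x.
have [|p [q [qv Hpq]]] := rphi (x, t) Ext (c, tt) (row_mx (sg x) t).
  by split; rewrite /= ?row_mxKl ?row_mxKr //; apply: csg.
have cz y (u : 'rV_(et_dim E)) : ~ R y ->
    Defs.coord (c := prod_space T (affine_space k (et_dim E))) (c, tt) (y, u) (row_mx (sg y) u).
  by move=> nRy; split; rewrite /= ?row_mxKl ?row_mxKr //; apply: csg.
pose r := et_dim E; pose m := cdim T.
pose h : {mpoly k[m + r]} := p * q.
pose Gi (i : 'I_(m + r)) (y : T) : {mpoly k[r + 1]} :=
  match split i with inl a => (sg y 0 a)%:MP | inr b => 'X_(lshift 1 b) end.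
pose H (y : T) := comp_mpoly [tuple Gi i y | i < m + r] h.
pose G (_ : 'I_1) (y : T) : {mpoly k[r + 1]} := 'X_(rshift r 0) * H y - 1.
have rG b : regpoly (Y `\` (et_rem E `|` R)) (G b).
  rewrite /G; apply: regpolyD; last exact: regpoly_cst.
  apply: regpolyM; first exact: regpoly_cst.
  apply: regpoly_comp; first exact: regpoly_cst.
  move=> i; rewrite /Gi; case: (split i) => a; last exact: regpoly_cst.
  by apply: regpolyC; apply: regular_onS (rsg a) => y [_ ny] Ry; apply: ny; right.
have HE y w : ev (H y) w = ev h (row_mx (sg y) (lsubmx w)).
  rewrite /H /evalr comp_mpoly_meval; apply: meval_eq => i; rewrite tnth_mktuple /Gi.
  case: (split_ordP i) => a ->.
    by rewrite mevalC row_mxEl.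
  by rewrite mevalXU row_mxEr mxE.
have GE b y w : ev (G b y) w = w 0 (rshift r 0) * ev h (row_mx (sg y) (lsubmx w)) - 1.
  by rewrite /G -HE /evalr mevalB mevalM mevalXU meval1.
have dG y w : \det (\matrix_(a, b) ev (mderiv (rshift r b) (G a y)) w) = ev h (row_mx (sg y) (lsubmx w)).
  rewrite det_mx11 mxE /G mderivB mderivM mderivXU eqxx -HE.
  rewrite -mpolyC1 mderivC subr0 mpolyC1 mul1r.
  suff -> : mderiv (rshift r 0) (H y) = 0 by rewrite mulr0 addr0.
  rewrite mderiv_comp big1 // => i _; rewrite /Gi; case: (split i) => a.
    by rewrite mderivC mulr0.
  rewrite mderivXU; case: eqP => [/(congr1 val) /= e|_]; last by rewrite mulr0.
  by have := ltn_ord a; rewrite e addn0 ltnn.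
have hx : ev h (row_mx (sg x) t) != 0.
  rewrite evalrM mulf_neq0 //; apply: contra_neq phi0 => p0.
  by rewrite (Hpq (x, t) _ Ext (cz _ _ nRx) qv) p0 mul0r.
exists (ext cR rG), (row_mx t (const_mx (ev h (row_mx (sg x) t))^-1)), (ext_proj cR rG).
split=> [||[y w] /ext_pts [Eyw nRy]].
- apply/ext_pts; rewrite row_mxKl; split=> // [b|]; last by rewrite dG row_mxKl.
  by rewrite GE row_mxEr mxE row_mxKl mulVf // subrr.
- by rewrite /= row_mxKl.
- move=> /(_ 0); rewrite GE => /eqP; rewrite subr_eq0 => /eqP e det.
  move: det; rewrite dG evalrM mulf_eq0 => /norP[p0 q0].
  by rewrite /= (Hpq (y, lsubmx w) _ Eyw (cz _ _ nRy) q0) mulf_neq0 ?invr_neq0.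
Qed.

(* With f(s) - f(s') = M(s,s') (s - s') for the equations f of U, two points of U
   over the same base point coincide where M is invertible, and M(s,s) is the
   Jacobian matrix. So F is the localisation of the fibre product of E and E'
   over Y at det M(a,a'). *)
Lemma refine2 (E E' U : etale Y) (a : ethom E U) (a' : ethom E' U) t t' :
  et_pts (E := E) (x, t) -> et_pts (E := E') (x, t') -> a x t = a' x t' ->
  exists (F : etale Y) (u : 'rV[k]_(et_dim F)) (b : ethom F E) (b' : ethom F E'),
    [/\ et_pts (E := F) (x, u), b x u = t, b' x u = t' &
        forall z, et_pts (E := F) z -> a z.1 (b z.1 z.2) = a' z.1 (b' z.1 z.2)].
Proof.
move=> Et Et' aa'; pose P := etprod E E'; pose r := et_dim U.
have /choice[M HM] i := dd_family (@et_regpoly _ _ _ U i).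
pose c := ethom_comp a (etprod_fst E E'); pose c' := ethom_comp a' (etprod_snd E E').
pose J (y : T) (w : 'rV[k]_(et_dim P)) : 'M[k]_r :=
  \matrix_(i, j) ev (M i j y) (row_mx (c y w) (c' y w)).
have Px : et_pts (E := P) (x, row_mx t t').
  by apply/etprod_pts; rewrite row_mxKl row_mxKr.
have subU z : et_pts (E := P) z -> (Y `\` et_rem U) z.1 by move=> /(eth_pts c) [].
have rJ : regular_on (et_pts (E := P)) (fun z => \det (J z.1 z.2)).
  apply: (@regular_on_det _ (prod_space T (affine_space k (et_dim P))) _ _ (fun z => J z.1 z.2)) => i j.
  apply: (@regular_on_ext _ (prod_space T (affine_space k (et_dim P))) _
    (fun z => (M i j z.1).@[fun l => (row_mx (c z.1 z.2) (c' z.1 z.2)) 0 l])).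
    by move=> z _; rewrite mxE.
  apply: (@regular_on_eval _ (prod_space T (affine_space k (et_dim P))) _ _ (fun z => M i j z.1)).
    by apply: regpoly_fst subU _; have [] := HM i.
  move=> l; case: (split_ordP l) => l' ->.
    apply: (@regular_on_ext _ (prod_space T (affine_space k (et_dim P))) _
      (fun z => c z.1 z.2 0 l')); last exact: eth_reg.
    by move=> z _; rewrite row_mxEl.
  apply: (@regular_on_ext _ (prod_space T (affine_space k (et_dim P))) _
    (fun z => c' z.1 z.2 0 l')); last exact: eth_reg.
  by move=> z _; rewrite row_mxEr.
have Jx : \det (J x (row_mx t t')) != 0.
  have [/= Ux _] := eth_pts a Et; congr (_ != 0); congr (\det _).
  apply/matrixP => i j; have [_ _ HM3] := HM i.
  by rewrite !mxE /c /c' /= row_mxKl row_mxKr -aa' HM3.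
have [F [u [f [Fu fu Hf]]]] := localize (phi := fun y w => \det (J y w)) Px rJ Jx.
exists F, u, (ethom_comp (etprod_fst E E') f), (ethom_comp (etprod_snd E E') f).
split=> //=; rewrite ?fu ?row_mxKl ?row_mxKr // => z Fz.
have Pz := eth_pts f Fz; have := Hf z Fz.
set w := f z.1 z.2 in Pz *; set y := z.1 in Pz * => Jw.
have [Uy eq1 _] := eth_pts c Pz; have [_ eq2 _] := eth_pts c' Pz.
apply/eqP; rewrite -subr_eq0; apply/eqP; set v := (X in X = 0).
suff : J y w *m v^T = 0.
  move=> Jv; have Ju : J y w \in unitmx by rewrite unitmxE unitfE.
  by apply: trmx_inj; rewrite trmx0 -(mulKmx Ju v^T) Jv mulmx0.
apply/colP => i; have [_ HM2 _] := HM i; rewrite mxE [RHS]mxE.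
transitivity (ev (et_eq i y) (c y w) - ev (et_eq i y) (c' y w)).
  by rewrite (HM2 _ _ _ Uy); apply: eq_bigr => j _; rewrite !mxE.
by rewrite [ev _ _]eq1 [ev _ (c' _ _)]eq2 subrr.
Qed.

End Refinement.

Section TerminalObject.
Variables (k : fieldType) (T : cspace k) (Y : set T).

Definition et_top : etale Y :=
  @Etale k T Y set0 (@zclosed0 k T) 0 (fun _ _ => 0)
    (fun i m => @regular_onC k T _ _) (ex_intro _ _ (fun i _ _ => leqnn _)).

Lemma et_top_pts x t : Y x -> et_pts (E := et_top) (x, t).
Proof. by move=> Yx; split; [split|case|rewrite det_mx00 oner_neq0]. Qed.

Lemma to_top_pts (E : etale Y) z : et_pts (E := E) z -> et_pts (E := et_top) (z.1, 0).
Proof. by move=> -[[Yz _] _ _]; apply: et_top_pts. Qed.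

Definition to_top (E : etale Y) : ethom E et_top :=
  @EtHom k T Y E et_top (fun _ _ => 0) (@to_top_pts E)
    (fun j => @regular_on_ext _ _ _ (fun=> 0) _ (fun _ _ => esym (mxE _ _ _ _))
       (@regular_onC _ _ _ _)).
End TerminalObject.

Section Identity.
Variables (k : fieldType) (T : cspace k) (Y : set T) (E : etale Y).

Lemma et_id_pts z : et_pts (E := E) z -> et_pts (E := E) (z.1, z.2).
Proof. by case: z. Qed.

Definition et_id : ethom E E :=
  @EtHom k T Y E E (fun _ t => t) et_id_pts (fun j => @regular_on_snd k T _ _ j).
End Identity.

Section Filtered.
Variables (k : fieldType) (T : cspace k) (Y : set T) (x : T).
Hypothesis sec_x : local_section x.

(** Iterates [refine2]: a refinement of [F] that equalises one more pair keeps the equalities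
    already obtained, by composition. *)
Lemma refine_fam r (U E : 'I_r -> etale Y) (F : etale Y) u
    (a : forall j, ethom F (U j)) (b : forall j, ethom (E j) (U j))
    (t : forall j, 'rV[k]_(et_dim (E j))) :
  et_pts (E := F) (x, u) -> (forall j, et_pts (E := E j) (x, t j)) ->
  (forall j, a j x u = b j x (t j)) ->
  exists (F' : etale Y) (u' : 'rV[k]_(et_dim F')) (f : ethom F' F)
    (g : forall j, ethom F' (E j)),
    [/\ et_pts (E := F') (x, u'), f x u' = u, forall j, g j x u' = t j &
        forall j z, et_pts (E := F') z -> a j z.1 (f z.1 z.2) = b j z.1 (g j z.1 z.2)].
Proof.
move=> Fu Et ab.
suff [F' [u' [f [Fu' fu H]]]] : exists (F' : etale Y) (u' : 'rV[k]_(et_dim F')) (f : ethom F' F),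
    [/\ et_pts (E := F') (x, u'), f x u' = u & forall j, exists g : ethom F' (E j),
      g x u' = t j /\
      forall z, et_pts (E := F') z -> a j z.1 (f z.1 z.2) = b j z.1 (g z.1 z.2)].
  exists F', u', f, (fun j => projT1 (cid (H j))); split=> //.
    by move=> j; case: (cid (H j)) => g [].
  by move=> j; case: (cid (H j)) => g [].
(* Induction over a list of indices. The maps to the [E j] are only asserted to exist, one index at
   a time, and are chosen once the neighbourhood is final. *)
suff: forall s : seq 'I_r, exists (F' : etale Y) (u' : 'rV[k]_(et_dim F')) (f : ethom F' F),
    [/\ et_pts (E := F') (x, u'), f x u' = u & forall j, j \in s -> exists g : ethom F' (E j),
      g x u' = t j /\
      forall z, et_pts (E := F') z -> a j z.1 (f z.1 z.2) = b j z.1 (g z.1 z.2)].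
  move=> /(_ (enum 'I_r)) [F' [u' [f [H1 H2 H3]]]]; exists F', u', f; split=> // j.
  by apply: H3; rewrite mem_enum.
elim=> [|i s [F1 [u1 [f1 [Fu1 fu1 H1]]]]].
  exists F, u, (et_id F); split=> //.
have [|F2 [u2 [c [d [Fu2 cu du cd]]]]] := refine2 sec_x (a := ethom_comp (a i) f1) (a' := b i) Fu1 (Et i).
  by rewrite /= fu1 ab.
exists F2, u2, (ethom_comp f1 c); split=> //=; first by rewrite cu fu1.
move=> j; rewrite inE; case: eqP => [-> _|_ /= /H1 [g [gu gz]]].
  by exists d; split.
exists (ethom_comp g c); split=> /=; first by rewrite cu.
by move=> z Fz; apply: (gz (z.1, c z.1 z.2)); apply: (eth_pts c Fz).
Qed.

(** Maps to the terminal object always agree, so refining over it yields a neighbourhood that maps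
    to all the given ones. *)
Lemma common_nbhd r (E : 'I_r -> etale Y) (t : forall j, 'rV[k]_(et_dim (E j))) :
  Y x -> (forall j, et_pts (E := E j) (x, t j)) ->
  exists (F : etale Y) (u : 'rV[k]_(et_dim F)) (g : forall j, ethom F (E j)),
    et_pts (E := F) (x, u) /\ forall j, g j x u = t j.
Proof.
move=> Yx Et; have [F [u [f [g [H1 H2 H3 H4]]]]] :=
  @refine_fam r (fun=> et_top Y) E (et_top Y) 0 (fun=> to_top (et_top Y))
    (fun j => to_top (E j)) t (et_top_pts _ Yx) Et (fun=> erefl).
by exists F, u, g.
Qed.
End Filtered.

Section Germs.
Variables (k : fieldType) (T : cspace k) (Y : set T) (M : complex Y) (l : nat).
Variables (C : set T) (hC : zclosed C) (i : nat) (x : T).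
Hypothesis sec_x : local_section x.
Hypothesis Yx : Y x.

Lemma off_comp_res (p : presheaf Y) (E E' E'' : etale Y) (g : ethom E' E'') (f : ethom E E')
    (h : ethom E E'') s :
  (forall z, et_pts (E := E) z -> h z.1 z.2 = g z.1 (f z.1 z.2)) ->
  res p (eth_off hC h) s = res p (eth_off hC f) (res p (eth_off hC g) s).
Proof. by move=> hgf; apply: res_comp => z /et_off_pts [Ez _]; apply: hgf. Qed.

Lemma coboundary_res n j (E E' : etale Y) (f : ethom E E') (s : M j E') :
  coboundary l n s -> coboundary l n (res _ f s).
Proof.
case: j s => [|j] s /=; first by move=> ->; rewrite raddf0.
move=> [r [r0 <-]]; exists (res _ f r); split; last by rewrite sh_nat.
by rewrite -raddfMn r0 raddf0.
Qed.

(** [comb_eq0] asks for a neighbourhood mapping to those of all the germs, including the ones with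
    coefficient 0. It is obtained by refining a common neighbourhood against the one on which the
    germ [z j0] is killed. *)
Lemma comb_killed n r (c : 'I_r -> int) (z : 'I_r -> cogerm M l hC n i x) j0 :
  (forall j, j != j0 -> c j = 0) -> killed_by (c j0) (z j0) -> comb_eq0 c z.
Proof.
move=> c0 [E [t [a [Et at0 cob]]]].
have [G [v [g [Gv gv]]]] := common_nbhd sec_x Yx (fun j => cg_ptP (z j)).
have [|F [u [b [b' [Fu bu bu' bb']]]]] := refine2 sec_x (a := g j0) (a' := a ord0) Gv Et.
  by rewrite gv at0.
exists F, u, (fun j => ethom_comp (g j) b); split=> //.
  by move=> j; rewrite /= bu gv.
rewrite (bigD1 j0) //= big1 => [|j /c0 ->]; last by rewrite mulr0z.
rewrite addr0; move: cob; rewrite big_ord1 => /(coboundary_res (eth_off hC b')).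
rewrite raddfMz; congr coboundary; congr (_ *~ _).
by apply/esym; apply: off_comp_res => w Fw; apply: bb'.
Qed.

End Germs.

(** * Stalks of constant and of vanishing cohomology sheaves *)

Lemma eqz_modP (a b d : int) : (a = b %[mod d])%Z <-> (d %| a - b)%Z.
Proof. by split=> [/eqP|] H; [rewrite -eqz_mod_dvd|apply/eqP; rewrite eqz_mod_dvd]. Qed.

Lemma eqz_mod0P (a d : int) : (a = 0 %[mod d])%Z <-> (d %| a)%Z.
Proof. by rewrite eqz_modP subr0. Qed.

(** In Z_l a power of [l] is nonzero: the congruence fails at exponent [m + 1]. *)
Lemma exp_not_eqz0_mod l m : prime l ->
  ~ (forall n, ((l ^ m)%N%:Z = 0 %[mod (l ^ n)%N%:Z])%Z).
Proof.
move=> l_prime /(_ m.+1) /eqz_mod0P; rewrite dvdzE /= dvdn_Pexp2l ?prime_gt1 //.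
by rewrite ltnn.
Qed.

Section AdicIntegers.
Variable l : nat.

Definition adic_cst (c : int) : adic_int l := @AdicInt l (fun=> c) (fun=> erefl).

Lemma adic_opp_compat (c : adic_int l) n :
  (- c n.+1 = - c n %[mod (l ^ n)%N%:Z])%Z.
Proof.
apply/eqz_modP; rewrite -opprD rpredN; apply/eqz_modP.
exact: ai_compat.
Qed.

Definition adic_opp (c : adic_int l) : adic_int l :=
  @AdicInt l (fun n => - c n) (adic_opp_compat c).
End AdicIntegers.

Section Stalks.
Variables (k : fieldType) (T : cspace k) (Y : set T) (M : complex Y) (l : nat).
Variable x : T.
Hypothesis l_prime : prime l.
Hypothesis sec_x : local_section x.
Hypothesis Yx : Y x.

(** In positive dimension, [l ^ m] times the first basis class would be a vanishing combination, and
    independence would give [l ^ m = 0] in Z_l. *)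
Lemma killed_stalk_dim i r m :
  (forall n (z : stalk_germ M l n i x), killed_by (l ^ m)%N%:Z z) ->
  has_stalk_dim M l i x r -> r = 0%N.
Proof.
move=> kill [e [ind _]]; case: r e ind => // r e ind.
pose c (j : 'I_r.+1) := adic_cst l (if j == ord0 then (l ^ m)%N%:Z else 0).
case: (@exp_not_eqz0_mod l m l_prime) => n; apply: (ind c _ ord0 n) => n'.
apply: (comb_killed sec_x Yx (j0 := ord0)) => [j /negbTE jn|].
  by rewrite /c /= jn.
by apply: kill.
Qed.

Section Constant.
Variable S : set T.
Hypothesis Sx : S x.
Variable u : forall (n : nat) (E : etale Y), M 0%N E.
Arguments u : clear implicits.
Hypothesis u_res : forall n E E' (f : ethom E E'),
  (forall z, et_pts (E := E') z -> S z.1) -> res _ f (u n E') = u n E.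
Hypothesis u_sec : forall n E, (forall z, et_pts (E := E) z -> S z.1) ->
  [/\ u n E *+ l ^ n = 0, cx_d M 0%N E (u n E) = 0 & u n.+1 E *+ l = u n E].
Hypothesis u_ind : forall n E (c : int), (forall z, et_pts (E := E) z -> S z.1) ->
  et_pts (E := E) !=set0 -> u n E *~ c = 0 -> (c = 0 %[mod (l ^ n)%N%:Z])%Z.

(* [z] is [v] times the section 1 of Z/l^n on some etale neighbourhood of x. *)
Definition has_value n (z : stalk_germ M l n 0 x) (v : int) : Prop :=
  exists (E : etale Y) (t : 'rV[k]_(et_dim E)) (a : ethom E (cg_nbhd z)),
    [/\ et_pts (E := E) (x, t), a x t = cg_pt z,
        (forall y, et_pts (E := E) y -> S y.1) &
        res _ (eth_off (@zclosed0 k T) a) (cg_sec z) = u n (et_off (@zclosed0 k T) E) *~ v].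

Hypothesis u_span : forall n (z : stalk_germ M l n 0 x), exists v, has_value z v.

Lemma off0_pts (E : etale Y) z :
  et_pts (E := et_off (@zclosed0 k T) E) z <-> et_pts (E := E) z.
Proof. by split=> [/et_off_pts[]|Ez] //; apply/et_off_pts; split. Qed.

(** In degree 0 a coboundary is zero, so on a common neighbourhood over [S] the relation says that
    an integer multiple of [u n] vanishes, and [u n] has exact order [l ^ n]. Additivity and
    uniqueness of values modulo [l ^ n] are special cases. *)
Lemma comb_value n r (c : 'I_r -> int) (z : 'I_r -> stalk_germ M l n 0 x) (v : 'I_r -> int) :
  (forall j, has_value (z j) (v j)) ->
  comb_eq0 c z <-> (\sum_j c j * v j = 0 %[mod (l ^ n)%N%:Z])%Z.
Proof.
move=> zv.
pose E j := projT1 (cid (zv j)).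
pose zv1 j := cid (projT2 (cid (zv j))); pose t j := projT1 (zv1 j).
pose zv2 j := cid (projT2 (zv1 j)); pose b j := projT1 (zv2 j).
have bP j : [/\ et_pts (E := E j) (x, t j), b j x (t j) = cg_pt (z j),
    (forall y, et_pts (E := E j) y -> S y.1) &
    res _ (eth_off (@zclosed0 k T) (b j)) (cg_sec (z j)) =
      u n (et_off (@zclosed0 k T) (E j)) *~ v j] := projT2 (zv2 j).
have sumE F (g : forall j, ethom F (E j)) :
    \sum_j res _ (eth_off (@zclosed0 k T) (g j))
       (res _ (eth_off (@zclosed0 k T) (b j)) (cg_sec (z j))) *~ c j =
    u n (et_off (@zclosed0 k T) F) *~ (\sum_j c j * v j).
  rewrite mulrz_sumr; apply: eq_bigr => j _.
  have [_ _ SE ->] := bP j; rewrite raddfMz u_res; last by move=> w /off0_pts; apply: SE.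
  by rewrite -mulrzA mulrC.
have SF F (g : forall j, ethom F (E j)) : 'I_r ->
    forall w, et_pts (E := et_off (@zclosed0 k T) F) w -> S w.1.
  move=> j w /off0_pts /(eth_pts (g j)) /=.
  by have [_ _ SE _] := bP j; move=> /SE.
split=> [[F [w [a [Fw aw cob]]]]|/eqz_mod0P /dvdzP [q qE]].
  (* Without germs there is no map to an object over [S] on which to test [u], but then the sum is
     empty. *)
  case: (posnP r) => [r0|r0].
    by rewrite big1 // => j; have /lt0n_neq0/eqP/(_ r0) := leq_ltn_trans (leq0n _) (ltn_ord j).
  have [||F' [w' [f [g [Fw' fw gw fg]]]]] :=
      refine_fam sec_x (a := a) (b := b) (t := t) Fw.
  - by move=> j; case: (bP j).
  - by move=> j; case: (bP j) => _ -> _ _; apply: aw.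
  apply: (u_ind (SF _ g (Ordinal r0))); first by exists (x, w'); apply/off0_pts.
  rewrite -(sumE F' g) -[RHS](raddf0 (res (M 0%N) (eth_off (@zclosed0 k T) f))) -cob raddf_sum.
  apply: eq_bigr => j _; rewrite raddfMz; congr (_ *~ _).
  rewrite -(off_comp_res (h := ethom_comp (b j) (g j))).
    by apply/esym; apply: off_comp_res.
  by move=> y /(fg j) ->.
have [|F [w [g [Fw gw]]]] := common_nbhd sec_x (t := t) Yx.
  by move=> j; case: (bP j).
exists F, w, (fun j => ethom_comp (b j) (g j)); split=> //.
  by move=> j /=; rewrite gw; case: (bP j).
have -> : \sum_j res (M 0%N) (eth_off (@zclosed0 k T) (ethom_comp (b j) (g j))) (cg_sec (z j)) *~ c j
    = u n (et_off (@zclosed0 k T) F) *~ (\sum_j c j * v j).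
  rewrite -(sumE F g); apply: eq_bigr => j _; congr (_ *~ _).
  exact: off_comp_res.
case: (posnP r) => [r0|r0].
  rewrite big1 => [|j]; first by rewrite mulr0z.
  by have /lt0n_neq0/eqP/(_ r0) := leq_ltn_trans (leq0n _) (ltn_ord j).
have [u0 _ _] := u_sec n (SF _ g (Ordinal r0)).
by rewrite /= qE mulrC mulrzA -pmulrn u0 mul0rz.
Qed.

(** The transition map multiplies by [l], and [l] times the unit section of level [n.+1] is that of
    level [n]; the integer is unchanged. *)
Lemma value_transition n (z : stalk_germ M l n.+1 0 x) v :
  has_value z v -> has_value (transition z) v.
Proof.
move=> [E [t [a [Et at_ SE H]]]]; exists E, t, a; split=> //=.
have [|_ _ <-] := u_sec n (E := et_off (@zclosed0 k T) E); first by move=> y /off0_pts /SE.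
by rewrite raddfMn /= H !pmulrn -!mulrzA mulrC.
Qed.

(** The object witnessing the value of any germ at [x] lies over [S]; the zero germ on [Y] itself is
    always at hand. *)
Lemma unit_nbhd : exists (E : etale Y) (t : 'rV[k]_(et_dim E)),
  et_pts (E := E) (x, t) /\ (forall y, et_pts (E := E) y -> S y.1).
Proof.
pose z := @CoGerm k T Y M l set0 (@zclosed0 k T) 0 0 x _ 0 (et_top_pts 0 Yx)
  0 (mul0rn _ _) (raddf0 _).
by have [v [E [t [a [Et _ SE _]]]]] := u_span z; exists E, t.
Qed.

Section UnitGerms.
Variables (E0 : etale Y) (t0 : 'rV[k]_(et_dim E0)).
Hypothesis E0x : et_pts (E := E0) (x, t0).
Hypothesis E0S : forall y, et_pts (E := E0) y -> S y.1.

Lemma E0S_off y : et_pts (E := et_off (@zclosed0 k T) E0) y -> S y.1.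
Proof. by move=> /off0_pts /E0S. Qed.

Definition unit_germ n : stalk_germ M l n 0 x :=
  @CoGerm k T Y M l set0 (@zclosed0 k T) n 0 x E0 t0 E0x (u n (et_off (@zclosed0 k T) E0))
   (let: And3 h _ _ := u_sec n E0S_off in h)
   (let: And3 _ h _ := u_sec n E0S_off in h).

Lemma value_unit n : has_value (unit_germ n) 1.
Proof.
exists E0, t0, (et_id E0); split=> //=; rewrite mulr1z u_res //.
exact: E0S_off.
Qed.

Lemma unit_compat n : eq_mul 1 1 (transition (unit_germ n.+1)) (unit_germ n).
Proof.
apply/(@comb_value _ _ _ _ (fun=> 1)) => [j|].
  by case: ifP => _; [apply: value_transition|]; apply: value_unit.
by rewrite !big_ord_recl big_ord0 /=.
Qed.

Definition unit_class : adic_class M l 0 x := AdicClass unit_compat.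
End UnitGerms.

(** Values chosen level by level are automatically compatible, because transition preserves them and
    a germ determines its value modulo [l ^ n]. *)
Lemma class_value (y : adic_class M l 0 x) :
  exists v : adic_int l, forall n, has_value (y n) (v n).
Proof.
have [v Hv] := choice (fun n => u_span (y n)).
have vc n : (v n.+1 = v n %[mod (l ^ n)%N%:Z])%Z.
  apply/eqz_modP/eqz_mod0P.
  have H (j : 'I_2) : has_value (if j == 0 then transition (y n.+1) else y n)
      (if j == 0 then v n.+1 else v n).
    by case: ifP => _ //; apply: value_transition.
  by have /(comb_value _ H) := ac_compat y n; rewrite !big_ord_recl big_ord0 /= mul1r addr0 mulN1r.
by exists (AdicInt vc).
Qed.

Lemma constant_has_stalk_dim : has_stalk_dim M l 0 x 1.
Proof.
have [E0 [t0 [E0x E0S]]] := unit_nbhd.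
exists (fun=> unit_class E0x E0S); split=> [c Hc j n|y].
  have /(comb_value _ (fun=> value_unit E0x E0S n)) := Hc n.
  by rewrite big_ord1 mulr1 (ord1 j).
have [v Hv] := class_value y; exists 0%N, (fun=> v) => n.
apply/(@comb_value _ _ _ _ (fun j => if unlift ord0 j is Some _ then 1 else v n)).
  by move=> j; case: (unlift ord0 j) => [j'|] //; apply: value_unit.
rewrite !big_ord_recl big_ord0 unlift_none /=.
case: unliftP => [j _|//].
by rewrite expn0 mul1r mulr1 addr0 subrr.
Qed.

(** Z_l has rank one only. In rank 0, spanning would kill a power of [l] times the unit class; in
    rank at least 2, two basis classes with values v_0 and v_1 satisfy v_1 e_0 - v_0 e_1 = 0. *)
Lemma constant_stalk_dim r : has_stalk_dim M l 0 x r -> r = 1%N.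
Proof.
have [E0 [t0 [E0x E0S]]] := unit_nbhd.
case: r => [|[|r]] // [e [ind span]].
  have [m [c H]] := span (unit_class E0x E0S).
  case: (@exp_not_eqz0_mod l m l_prime) => n.
  have /(@comb_value _ _ _ _ (fun=> 1)) := H n; rewrite big_ord1 unlift_none mulr1.
  by apply=> j; case: unliftP => [[]|_] //; apply: value_unit.
have /choice [v Hv] j := class_value (e j).
pose j1 : 'I_r.+2 := lift ord0 ord0.
have v1 n : (v j1 n = 0 %[mod (l ^ n)%N%:Z])%Z.
  (* Independence applied to v_1 e_0 - v_0 e_1 = 0 gives v_1 = 0. Then e_1 itself vanishes, and a
     second use of independence, at level 1, gives 1 = 0 modulo [l]. *)
  pose c j := if j == ord0 then v j1 else if j == j1 then adic_opp (v ord0) else adic_cst l 0.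
  have := ind c _ ord0 n; apply => n'.
  apply/(comb_value _ (fun j => Hv j n')).
  rewrite !big_ord_recl /c /= big1 => [|j _]; last by rewrite mul0r.
  by rewrite addr0 mulNr mulrC subrr.
have := ind (fun j => adic_cst l (if j == j1 then 1 else 0)) _ j1 1%N.
rewrite /= ?eqxx => H.
suff /eqz_mod0P : (1 = 0 %[mod (l ^ 1)%N%:Z])%Z.
  by rewrite dvdzE /= expn1 dvdn1 => /eqP l1; move: l_prime; rewrite l1.
apply: H => n; apply/(comb_value _ (fun j => Hv j n)).
rewrite (bigD1 j1) //= mul1r big1 ?addr0 // => j /negbTE ->.
by rewrite mul0r.
Qed.

End Constant.
End Stalks.

Section StalkDimensions.
Variables (k : fieldType) (T : cspace k) (Y : set T) (M : complex Y) (l : nat).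
Variable S : set T.
Hypothesis l_prime : prime l.
Hypothesis sec_S : forall x, S x -> local_section x.
Hypothesis SY : S `<=` Y.

(** Either branch of [xget] gives 0: an admissible rank by assumption, and the default when there is
    none. *)
Lemma stalk_dim_eq0 i :
  (forall x r, S x -> has_stalk_dim M l i x r -> r = 0%N) -> stalk_dim M l i S = 0%N.
Proof.
move=> H; rewrite /stalk_dim; case: xgetP => // r _ [x Sx].
exact: H.
Qed.

Lemma vanishing_stalk_dim i : vanishes_along M l i S -> stalk_dim M l i S = 0%N.
Proof.
move=> [m Hm]; apply: stalk_dim_eq0 => x r Sx.
by apply: (killed_stalk_dim l_prime (sec_S Sx) (SY Sx) (m := m)) => n z; apply: Hm.
Qed.

Lemma constant_stalk_dimS i : constant_on M l S -> stalk_dim M l i.+1 S = 0%N.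
Proof.
move=> [_ H]; apply: stalk_dim_eq0 => x r Sx.
apply: (killed_stalk_dim l_prime (sec_S Sx) (SY Sx) (m := 0)) => n z.
by rewrite expn0; apply: H.
Qed.

Lemma constant_stalk_dim0 : S !=set0 -> constant_on M l S -> stalk_dim M l 0 S = 1%N.
Proof.
move=> [x Sx] [[u [u1 u2 u3 u4]] _].
have span y (Sy : S y) n (z : stalk_germ M l n 0 y) : exists v, has_value S u z v.
  by have [c [E [t [a H]]]] := u4 n y z Sy; exists c, E, t, a.
rewrite /stalk_dim; case: xgetP => [r _ [y Sy Hr]|].
  exact: (constant_stalk_dim l_prime (sec_S Sy) (SY Sy) u1 u2 u3 (span y Sy) Hr).
(* The default value 0 is ruled out, since rank 1 is attained at a point of the nonempty set [S]. *)
move=> /(_ 1%N) []; exists x => //.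
exact: (constant_has_stalk_dim (sec_S Sx) (SY Sx) u1 u2 u3 (span x Sx)).
Qed.
End StalkDimensions.

(** * Coordinate subspaces and minors *)

Section CoordinateSpans.
Variables (k : fieldType) (D : nat).
Implicit Types (g : 'M[k]_D) (X Z : pred 'I_D).

(** Initial segments [X] give the terms of a flag in its coordinates; other [X] occur for the flags
    built from labelled bases. *)
Definition cspan X g : {vspace 'rV[k]_D} :=
  <<[seq row j g | j : 'I_D <- enum 'I_D & X j]>>%VS.

Lemma row_cspan X g j : X j -> row j g \in cspan X g.
Proof. by move=> Xj; apply/memv_span/map_f; rewrite mem_filter Xj mem_enum. Qed.

Lemma cspan_sub X g (U : {vspace 'rV[k]_D}) : (forall j, X j -> row j g \in U) -> (cspan X g <= U)%VS.
Proof.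
move=> H; apply/span_subvP => v /mapP[j]; rewrite mem_filter => /andP[Xj _] ->.
exact: H.
Qed.

Lemma sub_cspan X Z g : (forall j, X j -> Z j) -> (cspan X g <= cspan Z g)%VS.
Proof. by move=> XZ; apply: cspan_sub => j /XZ; apply: row_cspan. Qed.

Lemma mulmx_cspan X g (y : 'rV_D) :
  (forall j, ~~ X j -> y 0 j = 0) -> y *m g \in cspan X g.
Proof.
move=> y0; rewrite mulmx_sum_row memv_suml // => j _.
case Xj: (X j); first by rewrite memvZ // row_cspan.
by rewrite y0 ?Xj // scale0r mem0v.
Qed.

Lemma cspanP X g (w : 'rV_D) : g \in unitmx ->
  reflect (forall j, ~~ X j -> (w *m invmx g) 0 j = 0) (w \in cspan X g).
Proof.
move=> ug; apply: (iffP idP) => [|H]; last by rewrite -(mulmxKV ug w) mulmx_cspan.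
move=> wX j Xj.
(* The linear form reading the coefficient of row [j]; it kills all the generators, as [j] lies
   outside [X]. *)
pose f : 'Hom('rV[k]_D, 'rV[k]_1) := linfun (mulmxr (invmx g *m delta_mx j ord0)).
have: w \in lker f.
  apply: subvP wX; apply: cspan_sub => i Xi; rewrite memv_ker lfunE /=.
  rewrite rowE mulmxA mulmxK // mul_delta_mx_cond (_ : i == j = false) //.
  by apply: contraNF Xj => /eqP <-.
rewrite memv_ker lfunE /= mulmxA -colE => /eqP /rowP /(_ 0).
by rewrite !mxE.
Qed.

Lemma free_rows m (B : 'M[k]_(m, D)) : row_free B -> free [seq row j B | j <- enum 'I_m].
Proof.
move=> fB; pose t := [tuple row j B | j < m].
rewrite (_ : map _ _ = t :> seq _) //; apply/freeP => c sum0 i.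
have c0 : (\row_j c j) *m B = 0.
  rewrite mulmx_sum_row -[RHS]sum0; apply: eq_bigr => j _.
  by rewrite mxE -tnth_nth tnth_mktuple.
have /rowP/(_ i) : (\row_j c j) = 0 by apply: (row_free_inj fB); rewrite mul0mx.
by rewrite !mxE.
Qed.

Lemma dim_cspan X g : g \in unitmx -> \dim (cspan X g) = #|X|.
Proof.
rewrite -row_free_unit => /free_rows fg.
have: free [seq row j g | j <- enum 'I_D & X j].
  have /perm_free e := perm_map (fun j => row j g) (permEl (perm_filterC X (enum 'I_D))).
  by move: fg; rewrite -e map_cat => /catl_free.
rewrite /free => /eqP; rewrite /cspan => ->; rewrite size_map cardE.
by rewrite enumT.
Qed.

Lemma cap_cspan X Z g : g \in unitmx ->
  (cspan X g :&: cspan Z g)%VS = cspan [pred j | X j && Z j] g.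
Proof.
move=> ug; apply/vspaceP => w; rewrite memv_cap; apply/andP/(cspanP _ _ ug).
  move=> [/(cspanP _ _ ug) wX /(cspanP _ _ ug) wZ] j; rewrite /= negb_and.
  by move=> /orP[/wX|/wZ].
by move=> w0; split; apply/(cspanP _ _ ug) => j Xj; apply: w0; rewrite /= negb_and Xj ?orbT.
Qed.

Lemma add_cspan X Z g :
  (cspan X g + cspan Z g)%VS = cspan [pred j | X j || Z j] g.
Proof.
apply/eqP; rewrite eqEsubv; apply/andP; split.
  by rewrite subv_add; apply/andP; split; apply: sub_cspan => j /= ->; rewrite ?orbT.
apply: cspan_sub => j /= /orP[Xj|Zj].
  exact/(subvP (addvSl _ _))/row_cspan.
exact/(subvP (addvSr _ _))/row_cspan.
Qed.

Lemma dim_rows m (B : 'M[k]_(m, D)) :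
  \dim <<[seq row j B | j : 'I_m <- enum 'I_m]>>%VS = \rank B.
Proof.
have sub m1 m2 (A1 : 'M[k]_(m1, D)) (A2 : 'M[k]_(m2, D)) : (A1 <= A2)%MS ->
    (<<[seq row j A1 | j : 'I_m1 <- enum 'I_m1]>> <= <<[seq row j A2 | j : 'I_m2 <- enum 'I_m2]>>)%VS.
  move=> /submxP [C ->]; apply/span_subvP => v /mapP[j _ ->].
  rewrite row_mul mulmx_sum_row memv_suml // => i _; rewrite memvZ //.
  by apply/memv_span/map_f; rewrite mem_enum.
have -> : <<[seq row j B | j : 'I_m <- enum 'I_m]>>%VS =
    <<[seq row j (row_base B) | j : 'I_(\rank B) <- enum 'I_(\rank B)]>>%VS.
  by apply/eqP; rewrite eqEsubv !sub ?eq_row_base.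
have := free_rows (row_base_free B); rewrite /free => /eqP ->.
by rewrite size_map size_enum_ord.
Qed.

End CoordinateSpans.

Section Minors.
Variable k : fieldType.

Lemma rank_minor m n (B : 'M[k]_(m, n)) p (f : 'I_p -> 'I_m) (h : 'I_p -> 'I_n) :
  \det (mxsub f h B) != 0 -> (p <= \rank B)%N.
Proof.
move=> det; have /eqP <- : \rank (mxsub f h B) == p.
  by rewrite -/(row_free _) row_free_unit unitmxE unitfE.
have -> : mxsub f h B = rowsub f 1%:M *m B *m colsub h 1%:M.
  by rewrite mul_rowsub_mx mul1mx mulmx_colsub mulmx1 -mxsubcr.
by apply: leq_trans (mxrankM_maxl _ _) (mxrankM_maxr _ _).
Qed.

Lemma minor_rank m n (B : 'M[k]_(m, n)) : exists (f : 'I_(\rank B) -> 'I_m)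
  (h : 'I_(\rank B) -> 'I_n), \det (mxsub f h B) != 0.
Proof.
pose C := rowsub (maxrankfun B) B.
have rC : row_full C^T by rewrite /row_full mxrank_tr; have := maxrowsub_free B.
exists (maxrankfun B), (fullrankfun rC).
have := fullrowsub_unit rC; rewrite -unitmx_tr unitmxE unitfE; congr (\det _ != 0).
by apply/matrixP => i j; rewrite !mxE.
Qed.
End Minors.

(** * Flags and relative positions *)

Section AdaptedBases.
Variables (k : fieldType) (D : nat).

(** Each step appends to the basis of [f m] a basis of a complement of [f m] in [f m.+1]. *)
Lemma adapted_basis m (f : nat -> {vspace 'rV[k]_D}) :
  (forall i, (i < m)%N -> (f i <= f i.+1)%VS) ->
  exists s : seq 'rV[k]_D, [/\ free s, size s = \dim (f m) &
    forall i, (i <= m)%N -> f i = <<take (\dim (f i)) s>>%VS].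
Proof.
elim: m => [|m IH] incf.
  exists (vbasis (f 0%N)); split=> [||i].
  - exact: basis_free (vbasisP _).
  - by rewrite size_tuple.
  rewrite leqn0 => /eqP ->; rewrite take_oversize ?size_tuple //.
  by rewrite (span_basis (vbasisP _)).
have [|s [fs ss Hs]] := IH; first by move=> i im; apply/incf/ltnW.
pose W := (f m.+1 :\: f m)%VS.
have fm : f m = <<s>>%VS by rewrite {1}(Hs m) // take_oversize // ss.
have fmS : f m.+1 = (<<s>> + <<vbasis W>>)%VS.
  rewrite (span_basis (vbasisP _)) -fm addvC addv_diff; apply/esym/addv_idPl.
  exact: incf.
have fr : free (s ++ vbasis W).
  rewrite cat_free fs (basis_free (vbasisP _)) /= (span_basis (vbasisP _)) -fm.
  by apply/directv_addP; rewrite capvC capv_diff.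
have sz : size (s ++ vbasis W) = \dim (f m.+1).
  by rewrite fmS -span_cat; apply/esym/eqP.
exists (s ++ vbasis W); split=> // i; rewrite leq_eqVlt => /orP[/eqP ->|im].
  by rewrite take_oversize ?sz // span_cat.
have le_im : (\dim (f i) <= \dim (f m))%N.
  have {im} : (i <= m)%N by []; move: (incf); elim: m {IH W s fs ss Hs fm fmS fr sz incf} => [|m IH] incf.
    by rewrite leqn0 => /eqP ->.
  rewrite leq_eqVlt => /orP[/eqP -> //|im]; apply: leq_trans (dimvS (incf m _)) => //.
  by apply: IH => // j jm; apply: incf; apply: ltnW.
by rewrite takel_cat ?ss // -Hs.
Qed.

Lemma take_rows (g : 'M[k]_D) m : (m <= D)%N ->
  take m [seq row j g | j : 'I_D <- enum 'I_D] = [seq row j g | j : 'I_D <- enum 'I_D & (j < m)%N].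
Proof.
move=> mD; rewrite -map_take; congr map.
apply: (inj_map val_inj); rewrite map_take val_enum_ord.
transitivity [seq i <- iota 0 D | (i < m)%N]; last by rewrite -val_enum_ord filter_map.
rewrite take_iota (minn_idPl mD); have := @filter_iota_ltn 0 D m; rewrite add0n => ->//.
Qed.

Lemma seq_rows (s : seq 'rV[k]_D) : size s = D -> free s ->
  exists2 g : 'M[k]_D, g \in unitmx & s = [seq row j g | j : 'I_D <- enum 'I_D].
Proof.
move=> sD fs; pose g : 'M[k]_D := \matrix_j s`_j.
have sE : s = [seq row j g | j : 'I_D <- enum 'I_D].
  apply: (@eq_from_nth _ 0); first by rewrite size_map size_enum_ord.
  rewrite sD => i iD; rewrite (nth_map (Ordinal iD)) ?size_enum_ord //.
  by rewrite rowK nth_enum_ord.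
exists g => //; rewrite -row_free_unit; apply: inj_row_free => v vg.
have /eqP sD' := sD; have /freeP := (fs : free (Tuple sD')).
move=> /(_ (fun i => v 0 i)) H; apply/rowP => i; rewrite mxE; apply: H.
by rewrite -[RHS]vg mulmx_sum_row; apply: eq_bigr => j _; rewrite rowK.
Qed.

End AdaptedBases.

Section Flags.
Variables (n d : nat) (k : fieldType).
Local Notation N := n.*2.+1.
Local Notation D := d.*2.+1.
Local Notation flag := (flag_type n d k).
Implicit Types V W : flag.

Definition is_chain V : Prop :=
  [/\ V ord0 = 0%VS, V ord_max = fullv &
      forall i : 'I_N, (V (widen_ord (leqnSn _) i) <= V (lift ord0 i))%VS].

Lemma chain_sub V (i j : 'I_N.+1) : is_chain V -> (i <= j)%N -> (V i <= V j)%VS.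
Proof.
move=> [_ _ inc] ij.
have H m (im : (i + m < N.+1)%N) : (V i <= V (Ordinal im))%VS.
  elim: m im => [|m IH] im.
    by rewrite (_ : Ordinal im = i) //; apply: val_inj; rewrite /= addn0.
  have im' : (i + m < N)%N by rewrite addnS in im.
  apply: subv_trans (IH (leqW im')) _.
  have := inc (Ordinal im'); rewrite (_ : widen_ord _ _ = Ordinal (leqW im')); last exact: val_inj.
  rewrite (_ : lift _ _ = Ordinal im) //; apply: val_inj => /=.
  by rewrite /bump leq0n add1n addnS.
have jE : (i + (j - i) < N.+1)%N by rewrite subnKC.
by have := H _ jE; rewrite (_ : Ordinal jE = j) //; apply: val_inj; rewrite /= subnKC.
Qed.

Lemma chain_coord V : is_chain V ->
  exists c w, Defs.coord (c := flag_space n d k) c V w.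
Proof.
move=> cV; have [V0 V1 inc] := cV.
pose f i := V (inord i : 'I_N.+1).
have [|s [fs ss Hs]] := @adapted_basis _ _ N f.
  by move=> i iN; apply: chain_sub; rewrite // !inordK // ltnW.
have fN : f N = fullv by rewrite /f -V1; congr (V _); apply: val_inj; rewrite /= inordK.
have sD : size s = D by rewrite ss fN dimvf /= /dim /= mul1n.
have [g ug sE] := seq_rows sD fs.
exists (fun i => \dim (V i)), (mxvec g) => /=; rewrite mxvecK; split=> // i.
have Vi : V i = f i by rewrite /f inord_val.
have le_D : (\dim (V i) <= D)%N.
  by have := dimvS (subvf (V i)); rewrite dimvf /= /dim /= mul1n.
by rewrite -take_rows // -sE {1}Vi {1}(Hs i) ?Vi // -ltnS.
Qed.

Lemma coord_chain_dim V c w : Defs.coord (c := flag_space n d k) c V w ->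
  forall i, (c i <= D)%N.
Proof.
move=> [_ dV _] i; rewrite -dV.
by have := dimvS (subvf (V i)); rewrite dimvf /= /dim /= mul1n.
Qed.

Variable Q : 'M[k]_D.

Lemma flag_chain V : is_flag Q V -> is_chain V.
Proof. by case. Qed.

Section OrbitDimensions.
Variables (A : Xi n d) (V W : flag).
Hypothesis VW : orbO Q A (V, W).

Let v i := V (inord i).
Let w j := W (inord j).

Lemma v_sub i j : (i <= j <= N)%N -> (v i <= v j)%VS.
Proof.
move=> /andP[ij jN]; have [fV _ _] := VW; apply: chain_sub (flag_chain fV) _.
by rewrite !inordK // ltnS // (leq_trans ij).
Qed.

Lemma w_sub i j : (i <= j <= N)%N -> (w i <= w j)%VS.
Proof.
move=> /andP[ij jN]; have [_ fW _] := VW; apply: chain_sub (flag_chain fW) _.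
by rewrite !inordK // ltnS // (leq_trans ij).
Qed.

Lemma lift0_inord (i : 'I_N) : lift ord0 i = inord i.+1 :> 'I_N.+1.
Proof. by apply: val_inj; rewrite /= inordK // ltnS. Qed.

Lemma widen_inord (i : 'I_N) : widen_ord (leqnSn N) i = inord i :> 'I_N.+1.
Proof. by apply: val_inj; rewrite /= inordK // ltnS ltnW. Qed.

(** The entries of row i are the dimension jumps of V_i + V_{i+1} meet W_j as j grows, so they
    telescope; the dimension formula for a sum and an intersection then removes the summand V_i. *)
Lemma orbit_row_dim (i : 'I_N) j : (j <= N)%N ->
  (\sum_(s : 'I_N | (s < j)%N) (A i s : nat) + \dim (v i :&: w j) = \dim (v i.+1 :&: w j))%N.
Proof.
have [[V0 V1 _ _] [W0 W1 _ _] HA] := VW.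
suff H : forall j, (j <= N)%N -> (\sum_(s : 'I_N | (s < j)%N) (A i s : nat) + \dim (v i) =
    \dim (v i + v i.+1 :&: w j)%VS)%N.
  move=> jN; have := H j jN; have := dimv_sum_cap (v i) (v i.+1 :&: w j).
  rewrite capvA (capv_idPl (v_sub _)) ?leqnSn ?ltn_ord // => e1 e2.
  by apply/eqP; rewrite -(eqn_add2l (\dim (v i))) -e1 -e2 addnCA addnA.
elim=> [|m IH] mN.
  have -> : w 0%N = 0%VS by rewrite -W0; congr (W _); apply: val_inj; rewrite /= inordK.
  by rewrite capv0 addv0 big_pred0.
have im := HA i (Ordinal mN); rewrite /= !lift0_inord !widen_inord -/(v _) -/(v _) in im.
rewrite (bigD1 (Ordinal mN)) //= im -addnA.
rewrite (eq_bigl (fun s : 'I_N => (s < m)%N)); last first.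
  by move=> s; rewrite -val_eqE /= ltnS ltn_neqAle andbC.
rewrite IH ?(ltnW mN) // subnK //; apply: dimvS; apply: addvS => //.
by apply: capvS => //; apply: w_sub; rewrite leqnSn.
Qed.

Lemma orbit_dim i j : (i <= N)%N -> (j <= N)%N ->
  (\sum_(r : 'I_N | (r < i)%N) \sum_(s : 'I_N | (s < j)%N) (A r s : nat) = \dim (v i :&: w j))%N.
Proof.
move=> iN jN; elim: i iN => [|i IH] iN.
  have [[V0 _ _ _] _ _] := VW; have -> : v 0%N = 0%VS.
    by rewrite -V0; congr (V _); apply: val_inj; rewrite /= inordK.
  by rewrite cap0v dimv0 big_pred0.
rewrite (bigD1 (Ordinal iN)) //= [X in (_ + X)%N = _](eq_bigl (fun s : 'I_N => (s < i)%N)); last first.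
  by move=> s; rewrite -val_eqE /= ltnS ltn_neqAle andbC.
by rewrite IH ?(ltnW iN) //; apply: (@orbit_row_dim (Ordinal iN)).
Qed.
End OrbitDimensions.
End Flags.

(** * Local sections of the coordinates of a flag *)

Section GenericMatrix.
Variables (k : fieldType) (D m : nat) (h : 'I_(D * D) -> 'I_m).
Local Notation ev := (@evalr k _).

(** A matrix of indeterminates standing for the coordinates of a flag; [h] selects the factor when
    the point is a pair of flags. *)
Definition genmat : 'M[{mpoly k[m]}]_D := \matrix_(i, j) 'X_(h (mxvec_index i j)).

Definition evmx (w : 'rV[k]_m) p q (B : 'M[{mpoly k[m]}]_(p, q)) : 'M[k]_(p, q) :=
  map_mx (meval (fun i => w 0 i)) B.

Definition cstmx p q (B : 'M[k]_(p, q)) : 'M[{mpoly k[m]}]_(p, q) :=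
  map_mx (@mpolyC m k) B.

Lemma evmx_genmat w : evmx w genmat = vec_mx (\row_i w 0 (h i)).
Proof. by apply/matrixP => i j; rewrite !mxE mevalXU. Qed.

Lemma evmx_cst w p q (B : 'M[k]_(p, q)) : evmx w (cstmx B) = B.
Proof. by apply/matrixP => i j; rewrite !mxE mevalC. Qed.

Lemma evmxM w p q r (B : 'M[{mpoly k[m]}]_(p, q)) (C : 'M_(q, r)) :
  evmx w (B *m C) = evmx w B *m evmx w C.
Proof. exact: map_mxM. Qed.

Lemma evmxD w p q (B C : 'M[{mpoly k[m]}]_(p, q)) :
  evmx w (B + C) = evmx w B + evmx w C.
Proof. exact: map_mxD. Qed.

Lemma evmx_adj w p (B : 'M[{mpoly k[m]}]_p) : evmx w (\adj B) = \adj (evmx w B).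
Proof. exact: map_mx_adj. Qed.

Lemma ev_det w p (B : 'M[{mpoly k[m]}]_p) : ev (\det B) w = \det (evmx w B).
Proof. by rewrite /evalr -det_map_mx. Qed.

Lemma ev_entry w p q (B : 'M[{mpoly k[m]}]_(p, q)) i j : ev (B i j) w = evmx w B i j.
Proof. by rewrite mxE. Qed.

End GenericMatrix.

Section FlagSections.
Variables (n d : nat) (k : fieldType).
Local Notation N := n.*2.+1.
Local Notation D := d.*2.+1.
Local Notation flag := (flag_type n d k).
Local Notation fsp := (flag_space n d k).
Local Notation ev := (@evalr k _).

Local Notation cst := (@cstmx k (D * D) _ _).

Local Notation gen := (@genmat k D (D * D) id).

Section Cell.
Variables (c : 'I_N.+1 -> nat) (g0 : 'M[k]_D).
Hypothesis c_le : forall i, (c i <= D)%N.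
Hypothesis c_max : exists i, c i = D.
Local Notation pid i := (pid_mx (c i) : 'M[k]_D).
Local Notation copid i := (copid_mx (c i) : 'M[k]_D).

(* V_i g0^-1 is a complement of the span of the last D - c_i basis vectors *)
Definition transverse (V : flag) (i : 'I_N.+1) : Prop :=
  forall w : 'rV[k]_D, w \in V i -> w *m invmx g0 *m pid i = 0 -> w = 0.

(** The leading block of size [c i] of g g0^-1, completed by an identity block: its determinant is a
    principal minor, while the size does not depend on [i]. *)
Definition cell_mx (i : 'I_N.+1) (g : 'M[k]_D) : 'M[k]_D :=
  pid i *m (g *m invmx g0) *m pid i + copid i.

Let pp i : pid i *m pid i = pid i.
Proof. by rewrite pid_mx_id. Qed.
Let cp i : copid i *m pid i = 0.
Proof. by rewrite mul_copid_mx_pid. Qed.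

Lemma cell_mx_pid i g : cell_mx i g *m pid i =
  pid i *m (g *m invmx g0) *m pid i.
Proof. by rewrite mulmxDl -mulmxA pp cp addr0. Qed.

Lemma pid_cell_mx i g : pid i *m cell_mx i g =
  pid i *m (g *m invmx g0) *m pid i.
Proof. by rewrite mulmxDr !mulmxA pp mul_pid_mx_copid // addr0. Qed.

Lemma coord_memP V w (i : 'I_N.+1) (x : 'rV_D) : Defs.coord (c := fsp) c V w ->
  x \in V i <-> exists y : 'rV_D, x = y *m pid i *m vec_mx w.
Proof.
move=> [uw _ Vw]; rewrite Vw -/(cspan (fun j => (j < c i)%N) (vec_mx w)); split.
  move=> /(cspanP _ _ uw) H; exists (x *m invmx (vec_mx w)).
  rewrite -[LHS](mulmxKV uw); congr (_ *m _); apply/rowP => j; rewrite [RHS]mxE.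
  rewrite (bigD1 j) //= big1 => [|j' j'j]; last by rewrite !mxE (negbTE (_ : ~~ (_ == _ :> nat))) ?mulr0.
  rewrite !mxE eqxx /= addr0; case: ltnP => jc; first by rewrite mulr1.
  by rewrite mulr0 -[RHS](H j) -?leqNgt // mxE.
move=> [y ->]; apply: mulmx_cspan => j; rewrite -leqNgt => jc.
rewrite mxE big1 // => j' _; rewrite !mxE; case: eqP => [->|]; rewrite ?mulr0 //=.
by rewrite ltnNge jc mulr0.
Qed.

(** A left kernel vector of [cell_mx] is supported on the first [c i] entries; the corresponding
    combination of rows is a vector of V_i with zero projection, and conversely. *)
Lemma transverseP V w i : Defs.coord (c := fsp) c V w ->
  transverse V i <-> \det (cell_mx i (vec_mx w)) != 0.
Proof.
move=> Vw; have [uw _ _] := Vw; split=> [tV|det x /(coord_memP _ _ Vw)[y ->] yp].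
  apply/negP => /det0P [y y0 yH].
  have yphp : y *m (pid i *m (vec_mx w *m invmx g0) *m pid i) = 0.
    by rewrite -cell_mx_pid mulmxA yH mul0mx.
  have yp : y *m pid i = y.
    move: yH; rewrite mulmxDr yphp add0r mulmxBr mulmx1 => /eqP.
    by rewrite subr_eq0 => /eqP.
  have : y *m pid i *m vec_mx w = 0.
    apply: tV; first by apply/(coord_memP _ _ Vw); exists y.
    by rewrite -[RHS]yphp !mulmxA.
  rewrite yp => yw; case/eqP: y0.
  by rewrite -(mulmxK uw y) yw mul0mx.
have uH : cell_mx i (vec_mx w) \in unitmx by rewrite unitmxE unitfE.
suff -> : y *m pid i = 0 by rewrite mul0mx.
rewrite -(mulmxK uH (y *m _)) -[y *m _ *m cell_mx _ _]mulmxA pid_cell_mx.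
by rewrite !mulmxA in yp *; rewrite yp mul0mx.
Qed.

(* the index of the first term of the flag that contains the j-th row *)
Definition blk (j : 'I_D) : 'I_N.+1 :=
  [arg min_(i < xget ord0 [set i | c i = D] | (j < c i)%N) c i]%N.

Lemma blkP (j : 'I_D) : (j < c (blk j))%N /\ forall i, (j < c i)%N -> (c (blk j) <= c i)%N.
Proof.
rewrite /blk; case: arg_minnP => [|i ji H]; last by split.
by case: c_max => i0 ci0; case: xgetP => [y _ ->|/(_ i0)].
Qed.

(** By transversality this vector is unique, so it depends on [V] alone; [cell_rowP] expresses it as
    a fraction in an arbitrary coordinate vector. *)
Definition cell_row (V : flag) (j : 'I_D) : 'rV[k]_D :=
  xget 0 [set x | x \in V (blk j) /\ x *m invmx g0 *m pid (blk j) = delta_mx 0 j].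

Definition cell_section (V : flag) : 'rV[k]_(D * D) :=
  mxvec (\matrix_j cell_row V j).

Lemma cell_rowP V w j : Defs.coord (c := fsp) c V w -> transverse V (blk j) ->
  [/\ cell_row V j \in V (blk j),
      cell_row V j *m invmx g0 *m pid (blk j) = delta_mx 0 j &
      cell_row V j = delta_mx 0 j *m invmx (cell_mx (blk j) (vec_mx w)) *m
        pid (blk j) *m vec_mx w].
Proof.
move=> Vw tV; have [uw _ _] := Vw; have [jc _] := blkP j.
have /(transverseP _ Vw) det := tV.
have uH : cell_mx (blk j) (vec_mx w) \in unitmx by rewrite unitmxE unitfE.
pose r : 'rV[k]_D := delta_mx 0 j *m invmx (cell_mx (blk j) (vec_mx w)) *m pid (blk j) *m vec_mx w.
have rV : r \in V (blk j).
  by apply/(coord_memP _ _ Vw); exists (delta_mx 0 j *m invmx (cell_mx (blk j) (vec_mx w))).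
have rp : r *m invmx g0 *m pid (blk j) = delta_mx 0 j.
  rewrite /r; set dj := delta_mx 0 j *m _.
  have -> : dj *m pid (blk j) *m vec_mx w *m invmx g0 *m pid (blk j) =
      dj *m (cell_mx (blk j) (vec_mx w) *m pid (blk j)).
    by rewrite cell_mx_pid !mulmxA.
  rewrite mulmxA mulmxKV //; apply/rowP => a; rewrite mxE (bigD1 j) //= big1 => [|b bj].
    by rewrite !mxE !eqxx addr0 mul1r [a == j]eq_sym jc andbT.
  by rewrite !mxE (negbTE bj) andbF mul0r.
suff -> : cell_row V j = r by [].
rewrite /cell_row; case: xgetP => [x _ [xV xp]|/(_ r) []] //.
apply/eqP; rewrite -subr_eq0; apply/eqP; apply: tV; first by rewrite rpredB.
by rewrite !mulmxBl xp rp subrr.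
Qed.

Lemma cell_section_coord V w : Defs.coord (c := fsp) c V w ->
  (forall i, transverse V i) -> Defs.coord (c := fsp) c V (cell_section V).
Proof.
move=> Vw tV; have [uw dV Vs] := Vw; rewrite /= /cell_section mxvecK.
set g := \matrix_j _.
have gi j : row j (g *m invmx g0) = cell_row V j *m invmx g0 by rewrite row_mul rowK.
(* Row j agrees with the j-th unit vector in its first [c (blk j)] entries, and there are more than
   j of these; hence the matrix is upper unitriangular. *)
have tg : \det (g *m invmx g0) = 1.
  rewrite -det_tr det_trig; last first.
    apply/is_trig_mxP => i j ij; rewrite mxE.
    have [_ /rowP/(_ i) e _] := cell_rowP Vw (tV (blk j)); have [jc _] := blkP j.
    move: e; rewrite -gi mxE (bigD1 i) //= big1 => [|b bi].
      rewrite addr0 !mxE eqxx /= (ltn_trans ij jc) mulr1 => ->.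
      by rewrite -val_eqE /= (ltn_eqF ij).
    by rewrite !mxE -val_eqE in bi *; rewrite (negbTE bi) mulr0.
  apply: big1 => j _; rewrite mxE.
  have [_ /rowP/(_ j) e _] := cell_rowP Vw (tV (blk j)); have [jc _] := blkP j.
  move: e; rewrite -gi mxE (bigD1 j) //= big1 => [|b bi].
    by rewrite addr0 !mxE !eqxx /= jc mulr1 => ->.
  by rewrite !mxE -val_eqE in bi *; rewrite (negbTE bi) mulr0.
have ug : g \in unitmx.
  have : g *m invmx g0 \in unitmx by rewrite unitmxE unitfE tg oner_neq0.
  by rewrite unitmx_mul => /andP[].
split=> // i; apply/esym/eqP; rewrite -/(cspan (fun j : 'I_D => (j < c i)%N) g).
rewrite eqEdim dim_cspan // dV; apply/andP; split.
  apply: cspan_sub => j jc; have [rV _ _] := cell_rowP Vw (tV (blk j)).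
  rewrite rowK; apply: subvP rV; rewrite !Vs.
  (* By minimality of [blk j], its term is contained in every term of dimension greater than j. *)
  by apply: sub_cspan => a /leq_trans; apply; apply: (blkP j).2.
by rewrite -sum1_card -(big_ord_widen D (fun=> 1%N) (c_le i)) sum1_card card_ord.
Qed.

(** Points without coordinates of type [c] count as bad, so the complement is an open part of a
    single component. *)
Definition cell_bad : set fsp :=
  [set V | ~ ((exists w, Defs.coord (c := fsp) c V w) /\ forall i, transverse V i)].

Definition cell_gen (i : 'I_N.+1) : 'M[{mpoly k[D * D]}]_D :=
  cst (pid i) *m (gen *m cst (invmx g0)) *m cst (pid i) +
  cst (copid i).

Lemma vec_mxE w : evmx w (gen) = vec_mx w :> 'M[k]_D.
Proof. by rewrite evmx_genmat; congr vec_mx; apply/rowP => i; rewrite mxE. Qed.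

Lemma evmx_cell i w : evmx w (cell_gen i) = cell_mx i (vec_mx w).
Proof. by rewrite /cell_gen evmxD !evmxM !evmx_cst vec_mxE. Qed.

Lemma coord_type (c' : 'I_N.+1 -> nat) V w w' : Defs.coord (c := fsp) c V w ->
  Defs.coord (c := fsp) c' V w' -> c' = c.
Proof. by move=> [_ d1 _] [_ d2 _]; apply/funext => i; rewrite -d1 -d2. Qed.

Lemma zclosed_cell_bad : zclosed cell_bad.
Proof.
(* For another type the set of equations is empty, since that whole component is bad. For type [c],
   transversality fails for some [i] exactly when the product of the minors vanishes. *)
move=> c'; exists [set p | c' = c /\ p = \prod_i \det (cell_gen i)] => V w Vw; split.
  move=> nV p [ec ->]; rewrite ec in Vw; apply/eqP/negP => nz; apply: nV; split.
    by exists w.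
  move=> i; apply/(transverseP _ Vw); rewrite -evmx_cell -ev_det.
  by apply/negP => z; apply: nz; rewrite (bigD1 i) //= evalrM (eqP z) mul0r.
move=> H [[w' Vw'] tV]; have ec := coord_type Vw' Vw; rewrite ec in Vw.
have := H _ (conj ec erefl); apply/eqP.
rewrite (big_morph (fun p => ev p w) (fun p q => evalrM p q w) (evalr1 w)).
by apply/prodf_neq0 => i _; rewrite ev_det evmx_cell; apply/(transverseP _ Vw).
Qed.

Lemma cell_section_regular j : regular_on (~` cell_bad) (fun V : fsp => cell_section V 0 j).
Proof.
move=> V nV c' v Vv; have /contrapT [[w Vw] tV] := nV.
have ec := coord_type Vw Vv; rewrite ec in Vv *.
case/mxvec_indexP: j => a b.
(* Cramer's rule: the inverse of [cell_mx] is its adjugate divided by its determinant, which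
   provides numerator and denominator. *)
pose P := (delta_mx 0 a *m \adj (cell_gen (blk a)) *m cst (pid (blk a)) *m gen
   : 'rV[{mpoly k[D * D]}]_D) 0 b.
exists P, (\det (cell_gen (blk a))); split.
  by rewrite ev_det evmx_cell; apply/(transverseP _ Vv).
move=> y z ny yz; rewrite ev_det evmx_cell => det.
have /contrapT [_ ty] := ny.
have [_ _ e] := cell_rowP yz (ty (blk a)).
have uH : cell_mx (blk a) (vec_mx z) \in unitmx by rewrite unitmxE unitfE.
rewrite /cell_section mxvecE mxE e /P ev_entry !evmxM evmx_adj evmx_cell evmx_cst vec_mxE.
rewrite {1}/invmx uH -scalemxAr -!scalemxAl mxE mulrC; congr (_ * _).
by rewrite (_ : evmx z (delta_mx 0 a) = delta_mx 0 a) // /evmx map_delta_mx.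
Qed.

End Cell.
End FlagSections.

Section ProductSections.
Variable k : fieldType.

Lemma zclosed_preimage (T T' : cspace k) (h : T -> T') (C : set T') (e : ctype T -> ctype T')
    (s : 'I_(cdim T') -> 'I_(cdim T)) :
  (forall c x v, Defs.coord c x v -> Defs.coord (e c) (h x) (\row_i v 0 (s i))) ->
  zclosed C -> zclosed (h @^-1` C).
Proof.
move=> hc cC c; have [S HS] := cC (e c); exists (ren s @` S) => x v cv.
have H := HS _ _ (hc _ _ _ cv); split=> [/H Hp p [p' Sp' <-]|Hp].
  by rewrite evalr_ren; apply: Hp.
by apply/H => p Sp; rewrite -evalr_ren; apply: Hp; exists p.
Qed.

Lemma local_section_prod (T1 T2 : cspace k) (x1 : T1) (x2 : T2) :
  local_section x1 -> local_section x2 -> @local_section k (prod_space T1 T2) (x1, x2).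
Proof.
move=> [c1 [R1 [s1 [cR1 n1 cs1 rs1]]]] [c2 [R2 [s2 [cR2 n2 cs2 rs2]]]].
pose T := prod_space T1 T2.
have l_row (v : 'rV[k]_(cdim T1 + cdim T2)) : \row_i v 0 (lshift (cdim T2) i) = lsubmx v.
  by apply/rowP => i; rewrite !mxE.
have r_row (v : 'rV[k]_(cdim T1 + cdim T2)) : \row_i v 0 (rshift (cdim T1) i) = rsubmx v.
  by apply/rowP => i; rewrite !mxE.
exists (c1, c2), ((fst @^-1` R1) `|` (snd @^-1` R2)), (fun z => row_mx (s1 z.1) (s2 z.2)); split.
- apply: zclosedU.
    apply: (@zclosed_preimage T T1 fst R1 fst (@lshift (cdim T1) (cdim T2))) => // c x v.
    by move=> [cv _]; rewrite l_row.
  apply: (@zclosed_preimage T T2 snd R2 snd (@rshift (cdim T1) (cdim T2))) => // c x v.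
  by move=> [_ cv]; rewrite r_row.
- by case.
- move=> z nz; split; rewrite /= ?row_mxKl ?row_mxKr.
    by apply: cs1 => z1; apply: nz; left.
  by apply: cs2 => z2; apply: nz; right.
- move=> j; case: (split_ordP j) => a ->.
    apply: (@regular_on_ext k T _ (fun z => s1 z.1 0 a)); first by move=> z _; rewrite row_mxEl.
    apply: (@regular_on_pull k T T1 _ (~` R1) fst (fun y => s1 y 0 a)) => //.
      by move=> z nz z1; apply: nz; left.
    move=> c x v _ cv; exists c.1, (fun i => lsubmx i.2); split.
      by move=> y w _ [].
    move=> i; apply: (@loc_frac_ext _ _ _ _ _ v
      (fun z : T * 'rV[k]_(cdim T1 + cdim T2) => z.2 0 (lshift (cdim T2) i))).
      by move=> z _; rewrite mxE.
    exact: (@loc_frac_coo _ _ _ _ snd v (lshift (cdim T2) i)).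
  apply: (@regular_on_ext k T _ (fun z => s2 z.2 0 a)); first by move=> z _; rewrite row_mxEr.
  apply: (@regular_on_pull k T T2 _ (~` R2) snd (fun y => s2 y 0 a)) => //.
    by move=> z nz z1; apply: nz; right.
  move=> c x v _ cv; exists c.2, (fun i => rsubmx i.2); split.
    by move=> y w _ [].
  move=> i; apply: (@loc_frac_ext _ _ _ _ _ v
    (fun z : T * 'rV[k]_(cdim T1 + cdim T2) => z.2 0 (rshift (cdim T1) i))).
    by move=> z _; rewrite mxE.
  exact: (@loc_frac_coo _ _ _ _ snd v (rshift (cdim T1) i)).
Qed.
End ProductSections.

(** * Closedness of rank conditions and degeneration of orbits *)

Section FlagClosures.
Variables (n d : nat) (k : fieldType).
Local Notation N := n.*2.+1.
Local Notation D := d.*2.+1.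
Local Notation flag := (flag_type n d k).
Local Notation fsp := (flag_space n d k).
Local Notation ev := (@evalr k _).

Lemma dim_fullv : \dim (fullv : {vspace 'rV[k]_D}) = D.
Proof. by rewrite dimvf /= /dim /= mul1n. Qed.

Lemma local_section_flag (V : fsp) : is_chain V -> local_section V.
Proof.
move=> cV; have [c [w Vw]] := chain_coord cV.
have [ug dV _] := Vw.
have cle := coord_chain_dim Vw.
have cmax : exists i, c i = D.
  by exists ord_max; rewrite -dV; have [_ -> _] := cV; rewrite dim_fullv.
(* The cell is based at coordinates of [V] itself; there every [cell_mx] is the identity, so [V] is
   not bad. *)
exists c, (cell_bad c (vec_mx w)), (cell_section c (vec_mx w)); split.
- exact: zclosed_cell_bad.
- move=> []; split; first by exists w.
  move=> i; apply/(transverseP _ cle _ Vw).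
  rewrite /cell_mx mulmxV // mulmx1 pid_mx_id // /copid_mx addrCA subrr addr0.
  by rewrite det1 oner_neq0.
- by move=> V' /contrapT [[w' Vw'] tV']; apply: cell_section_coord Vw' _.
- by move=> j; apply: cell_section_regular.
Qed.

Lemma local_section_orbit (Q : 'M[k]_D) (A : Xi n d) x : orbO Q A x -> local_section x.
Proof.
case: x => V W [fV fW _]; apply: local_section_prod; apply: local_section_flag.
  exact: flag_chain fV.
exact: flag_chain fW.
Qed.

Definition rank_locus (a b : 'I_N.+1 -> nat) (r : 'I_N.+1 -> 'I_N.+1 -> nat) :
    set (flag_pairs n d k) :=
  [set VW : flag_pairs n d k | [/\ forall i, \dim (VW.1 i) = a i, forall j, \dim (VW.2 j) = b j &
     forall i j, (\dim (VW.1 i + VW.2 j)%VS <= r i j)%N]].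

Lemma zclosed_rank_locus a b r : zclosed (rank_locus a b r).
Proof.
case=> c1 c2.
pose G1 : 'M[{mpoly k[D * D + D * D]}]_D := @genmat k D _ (@lshift (D * D) (D * D)).
pose G2 : 'M[{mpoly k[D * D + D * D]}]_D := @genmat k D _ (@rshift (D * D) (D * D)).
(* At a coordinate vector, the row space of [B i j] is V_i + W_j, since [pid_mx] keeps just the rows
   spanning each term; the bound on the dimension is the vanishing of all larger minors. *)
pose B i j : 'M_(D + D, D) := col_mx (@cstmx k _ D D (pid_mx (c1 i)) *m G1) (@cstmx k _ D D (pid_mx (c2 j)) *m G2).
(* all polynomials are taken on the components of other types, where the locus is empty *)
exists [set p | (c1 = a /\ c2 = b) -> exists i j s (f : 'I_s -> 'I_(D + D)) (h : 'I_s -> 'I_D),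
   (r i j < s)%N /\ p = \det (mxsub f h (B i j))].
case=> V W v [/= Vv Wv].
have [uV dV Vs] := Vv; have [uW dW Ws] := Wv.
pose b0 i j : 'M[k]_(D + D, D) := col_mx (pid_mx (c1 i) *m vec_mx (lsubmx v)) (pid_mx (c2 j) *m vec_mx (rsubmx v)).
have evB i j : evmx v (B i j) = b0 i j.
  rewrite /evmx /B map_col_mx -!/(evmx v _) !evmxM !evmx_cst !evmx_genmat.
  have -> : \row_l v 0 (lshift (D * D) l) = lsubmx v by apply/rowP => l; rewrite !mxE.
  by have -> : \row_l v 0 (rshift (D * D) l) = rsubmx v by apply/rowP => l; rewrite !mxE.
have dimB i j : \dim (V i + W j)%VS = \rank (b0 i j).
  rewrite -dim_rows; congr (\dim _); apply/eqP; rewrite eqEsubv; apply/andP; split.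
    have pidr m (M : 'M[k]_D) (l : 'I_D) : (l < m)%N -> row l ((pid_mx m : 'M_D) *m M) = row l M.
      move=> lm; rewrite row_mul [RHS]rowE; congr (_ *m _); apply/rowP => l'; rewrite !mxE.
      by rewrite eqxx /= lm andbT -val_eqE eq_sym.
    rewrite subv_add Vs Ws; apply/andP; split; apply: cspan_sub => l lc.
      have -> : row l (vec_mx (lsubmx v)) = row (lshift D l) (b0 i j).
        by rewrite /b0 rowKu pidr.
      by apply/memv_span/map_f; rewrite mem_enum.
    have -> : row l (vec_mx (rsubmx v)) = row (rshift D l) (b0 i j).
      by rewrite /b0 rowKd pidr.
    by apply/memv_span/map_f; rewrite mem_enum.
  apply/span_subvP => x /mapP[l _ ->]; case: (split_ordP l) => l' ->.
    rewrite /b0 rowKu row_mul; apply/(subvP (addvSl _ _))/(coord_memP _ _ Vv).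
    by exists (delta_mx 0 l'); rewrite -rowE.
  rewrite /b0 rowKd row_mul; apply/(subvP (addvSr _ _))/(coord_memP _ _ Wv).
  by exists (delta_mx 0 l'); rewrite -rowE.
have evp i j s (f : 'I_s -> 'I_(D + D)) (h : 'I_s -> 'I_D) :
    ev (\det (mxsub f h (B i j))) v = \det (mxsub f h (b0 i j)).
  by rewrite ev_det -evB; congr (\det _); apply/matrixP => l l'; rewrite !mxE.
split=> [[/= ea eb er] p Hp|H].
  have [|i [j [s [f [h [rs ->]]]]]] := Hp.
    by split; apply/funext => i; rewrite -?ea -?eb.
  rewrite evp; apply/eqP; apply: contraTT rs => /rank_minor.
  by rewrite -dimB -leqNgt => /leq_trans; apply.
have [[ec1 ec2]|nec] := pselect (c1 = a /\ c2 = b); last first.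
  by have := H 1 (fun e => match nec e with end); rewrite evalr1 => /eqP; rewrite oner_eq0.
split=> [i|i|i j]; rewrite /= ?dV ?dW ?ec1 ?ec2 //.
rewrite leqNgt; apply/negP => rlt; have [f [h det]] := minor_rank (b0 i j).
case/eqP: det; rewrite -evp; apply: H => _.
by exists i, j, (\rank (b0 i j)), f, h; split=> //; rewrite -dimB.
Qed.

Section Degeneration.
Variables (Q : 'M[k]_D) (A A' : Xi n d).

(** On the orbit of [B] this is dim (V_i meet W_j). *)
Definition corner (B : Xi n d) (i j : nat) : nat :=
  (\sum_(r : 'I_N | (r < i)%N) \sum_(s : 'I_N | (s < j)%N) (B r s : nat))%N.

Lemma orbit_corner (B : Xi n d) VW i j : orbO Q B VW -> (i <= N)%N -> (j <= N)%N ->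
  corner B i j = \dim (VW.1 (inord i) :&: VW.2 (inord j)).
Proof. by case: VW => V W HB iN jN; apply: (orbit_dim HB). Qed.

Lemma orbit_corner_fst (B : Xi n d) VW i : orbO Q B VW -> (i <= N)%N ->
  corner B i N = \dim (VW.1 (inord i)).
Proof.
move=> HB iN; rewrite (orbit_corner HB) //; have [_ [_ W1 _ _] _] := HB.
by rewrite (_ : inord N = ord_max) ?W1 ?capvf //; apply: val_inj; rewrite /= inordK.
Qed.

Lemma orbit_corner_snd (B : Xi n d) VW j : orbO Q B VW -> (j <= N)%N ->
  corner B N j = \dim (VW.2 (inord j)).
Proof.
move=> HB jN; rewrite (orbit_corner HB) //; have [[_ V1 _ _] _ _] := HB.
by rewrite (_ : inord N = ord_max) ?V1 ?capfv //; apply: val_inj; rewrite /= inordK.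
Qed.

(** The orbit of [A] lies in the closed locus where the dimensions of the terms are fixed and those
    of V_i + W_j are at most their values on that orbit. A smaller sum means a larger intersection,
    so corners grow in the closure. *)
Lemma closure_corner : orb_le Q A' A -> orbO Q A' !=set0 ->
  [/\ forall i, (i <= N)%N -> corner A' i N = corner A i N,
      forall j, (j <= N)%N -> corner A' N j = corner A N j &
      forall i j, (i <= N)%N -> (j <= N)%N -> (corner A i j <= corner A' i j)%N].
Proof.
move=> le [VW OA'].
pose a (i : 'I_N.+1) := corner A i N; pose b (j : 'I_N.+1) := corner A N j.
have iN (i : 'I_N.+1) : (i <= N)%N by rewrite -ltnS.
have [ea eb er] : rank_locus a b (fun i j => a i + b j - corner A i j)%N VW.
  apply: (le VW OA') (@zclosed_rank_locus _ _ _) _ => VW' OA; split=> [i|i|i j].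
  - by rewrite /a (orbit_corner_fst OA) // inord_val.
  - by rewrite /b (orbit_corner_snd OA) // inord_val.
  - rewrite /a /b (orbit_corner_fst OA) // (orbit_corner_snd OA) // (orbit_corner OA) //.
    by rewrite !inord_val -dimv_sum_cap addnK.
have E1 i : (i <= N)%N -> corner A' i N = corner A i N.
  by move=> le_iN; rewrite (orbit_corner_fst OA') // ea /a inordK.
have E2 j : (j <= N)%N -> corner A' N j = corner A N j.
  by move=> le_jN; rewrite (orbit_corner_snd OA') // eb /b inordK.
split=> // i j le_iN le_jN; have := er (inord i) (inord j).
have := dimv_sum_cap (VW.1 (inord i)) (VW.2 (inord j)).
rewrite -(orbit_corner OA') // ea eb /a /b !inordK // => e.
(* Ensures that the natural subtraction in the bound on V_i + W_j is not truncated. *)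
have : (corner A i j <= corner A i N)%N.
  apply: leq_sum => r _; rewrite [leqRHS](bigID (fun s : 'I_N => (s < j)%N)) /=.
  rewrite (eq_bigl (fun s : 'I_N => (s < N)%N && (s < j)%N)) ?leq_addr // => s.
  by rewrite ltn_ord.
lia.
Qed.
End Degeneration.
End FlagClosures.

(** * The combinatorial order *)

Section Corners.
Variables (n d : nat).
Local Notation N := n.*2.+1.
Implicit Types A B : Xi n d.

Lemma big_ord_lt_split (F : 'I_N -> nat) j :
  (\sum_(s : 'I_N | (s < j)%N) F s + \sum_(s : 'I_N | (j <= s)%N) F s = \sum_s F s)%N.
Proof.
rewrite [RHS](bigID (fun s : 'I_N => (s < j)%N)) /=; congr (_ + _)%N.
by apply: eq_bigl => s; rewrite -leqNgt.
Qed.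

Lemma big_ord_leN (F : 'I_N -> nat) :
  (\sum_(s : 'I_N | (s < N)%N) F s = \sum_s F s)%N.
Proof. by apply: eq_bigl => s; rewrite ltn_ord. Qed.

Lemma cornerS A (i : 'I_N) j :
  (corner A i j + \sum_(s : 'I_N | (s < j)%N) (A i s : nat) = corner A i.+1 j)%N.
Proof.
rewrite /corner [RHS](bigD1 i) //= addnC; congr (_ + _)%N; apply: eq_bigl => s.
by rewrite -val_eqE /= ltnS ltn_neqAle andbC.
Qed.

Lemma corner_row A (i : 'I_N) : (corner A i N + \sum_j (A i j : nat) = corner A i.+1 N)%N.
Proof. by rewrite -cornerS big_ord_leN. Qed.

Lemma corner_col A (j : 'I_N) : (corner A N j + \sum_i (A i j : nat) = corner A N j.+1)%N.
Proof.
rewrite /corner !big_ord_leN -big_split; apply: eq_bigr => i _ /=.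
rewrite [RHS](bigD1 j) //= addnC; congr (_ + _)%N; apply: eq_bigl => s.
by rewrite -val_eqE /= ltnS ltn_neqAle andbC.
Qed.

Lemma corner_upper A (i j : 'I_N) :
  (corner A i.+1 j + \sum_(r : 'I_N | (r <= i)%N) \sum_(s : 'I_N | (j <= s)%N) (A r s : nat)
   = corner A i.+1 N)%N.
Proof.
rewrite /corner -big_split; apply: eq_bigr => r _ /=.
by rewrite big_ord_lt_split big_ord_leN.
Qed.

Lemma corner_lower A (i j : 'I_N) :
  (corner A i j.+1 + \sum_(r : 'I_N | (i <= r)%N) \sum_(s : 'I_N | (s <= j)%N) (A r s : nat)
   = corner A N j.+1)%N.
Proof. by rewrite /corner big_ord_lt_split big_ord_leN. Qed.

Lemma corner0l A j : corner A 0 j = 0%N.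
Proof. by rewrite /corner big_pred0. Qed.

Lemma corner0r A i : corner A i 0 = 0%N.
Proof. by rewrite /corner big1 // => r _; rewrite big_pred0. Qed.

(** The inequality is reversed because more degenerate positions have larger intersections. *)
Definition corner_le A B : Prop :=
  [/\ forall i, (i <= N)%N -> corner A i N = corner B i N,
      forall j, (j <= N)%N -> corner A N j = corner B N j &
      forall i j, (i <= N)%N -> (j <= N)%N -> (corner B i j <= corner A i j)%N].

Lemma corner_sqle A B : corner_le A B -> sqle A B.
Proof.
move=> [eR eC le]; split=> [i|j|i j ij|i j ij].
- by have := corner_row A i; have := corner_row B i; rewrite (eR i.+1) // (eR i) ?(ltnW (ltn_ord i)) //; lia.
- by have := corner_col A j; have := corner_col B j; rewrite (eC j.+1) // (eC j) ?(ltnW (ltn_ord j)) //; lia.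
- have := corner_upper A i j; have := corner_upper B i j.
  have := le i.+1 j (ltn_ord i) (ltnW (ltn_ord j)); rewrite (eR i.+1) //; lia.
- have := corner_lower A i j; have := corner_lower B i j.
  have := le i j.+1 (ltnW (ltn_ord i)) (ltn_ord j); rewrite (eC j.+1) //; lia.
Qed.

Lemma sqle_corner A B : sqle A B -> corner_le A B.
Proof.
move=> [eR eC leU leL].
have ER i : (i <= N)%N -> corner A i N = corner B i N.
  elim: i => [|i IH] iN; first by rewrite !corner0l.
  have := corner_row A (Ordinal iN); have := corner_row B (Ordinal iN).
  by rewrite /= eR IH ?(ltnW iN) // => -> ->.
have EC j : (j <= N)%N -> corner A N j = corner B N j.
  elim: j => [|j IH] jN; first by rewrite !corner0r.
  have := corner_col A (Ordinal jN); have := corner_col B (Ordinal jN).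
  by rewrite /= eC IH ?(ltnW jN) // => -> ->.
(* The corner at (i, j) complements the upper sum at (i - 1, j) within the row totals, or the lower
   sum at (i, j - 1) within the column totals. So the two off-diagonal families of inequalities
   reach every corner, the diagonal ones included. *)
split=> // i j iN jN; have [ij|ji] := leqP i j.
  move: jN; rewrite leq_eqVlt => /orP[/eqP ->|jN]; first by rewrite ER.
  case: i ij iN => [|i] ij iN; first by rewrite !corner0l.
  have := leU (Ordinal iN) (Ordinal jN) ij.
  have := corner_upper A (Ordinal iN) (Ordinal jN).
  have := corner_upper B (Ordinal iN) (Ordinal jN); rewrite /= (ER i.+1) //; lia.
move: iN; rewrite leq_eqVlt => /orP[/eqP ->|iN]; first by rewrite EC.
case: j ji jN => [|j] ji jN; first by rewrite !corner0r.
have := leL (Ordinal iN) (Ordinal jN) (ltnW ji).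
have := corner_lower A (Ordinal iN) (Ordinal jN).
have := corner_lower B (Ordinal iN) (Ordinal jN); rewrite /= (EC j.+1) //; lia.
Qed.

(** Each entry is a mixed second difference of corners. *)
Lemma corner_inj A B :
  (forall i j, (i <= N)%N -> (j <= N)%N -> corner A i j = corner B i j) -> A = B.
Proof.
move=> H; apply: val_inj; apply/matrixP => i j; apply: val_inj => /=.
have S (C : Xi n d) : ((corner C i j.+1 + \sum_(s : 'I_N | (s < j)%N) (C i s : nat)) + (C i j : nat)
     = corner C i.+1 j.+1)%N.
  rewrite -addnA -(cornerS C i j.+1); congr (_ + _)%N.
  rewrite [RHS](bigD1 j) //= addnC; congr (_ + _)%N; apply: eq_bigl => s.
  by rewrite -val_eqE /= ltnS ltn_neqAle andbC.
have iN := ltn_ord i; have jN := ltn_ord j.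
have := cornerS A i j; have := cornerS B i j; have := S A; have := S B.
rewrite !H ?(ltnW iN) ?(ltnW jN) //; lia.
Qed.

(** A strictly monotone measure for inductions and for choosing maximal terms. The constant bounds
    any sum of at most N^2 entries below 2d + 2, so the subtraction never truncates. *)
Definition rank_fun A : nat :=
  (\sum_(i < N.+1) \sum_(j < N.+1) (N * d.*2.+2 * N - corner A i j))%N.

Lemma corner_ub A i j : (corner A i j <= N * d.*2.+2 * N)%N.
Proof.
have b (P : pred 'I_N) (F : 'I_N -> nat) m : (forall s, F s <= m)%N -> (\sum_(s | P s) F s <= N * m)%N.
  move=> Fm; rewrite -[X in (X * _)%N]card_ord -sum_nat_const big_mkcond.
  by apply: leq_sum => s _; case: (P s).
rewrite mulnAC -mulnA; apply: (b) => r; apply: (b) => s; exact: ltnW.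
Qed.

Lemma rank_fun_lt A B : sqlt A B -> (rank_fun A < rank_fun B)%N.
Proof.
move=> [/sqle_corner [_ _ le] nAB].
have [[i j] ij] : exists p : 'I_N.+1 * 'I_N.+1, (corner B p.1 p.2 < corner A p.1 p.2)%N.
  apply: contrapT => /forallNP H; apply: nAB; apply: corner_inj => i j iN jN.
  apply/eqP; rewrite eqn_leq le // andbT leqNgt.
  by have /negP := H (Ordinal (iN : (i < N.+1)%N), Ordinal (jN : (j < N.+1)%N)).
have leO (i' j' : 'I_N.+1) : (N * d.*2.+2 * N - corner A i' j' <= N * d.*2.+2 * N - corner B i' j')%N.
  by apply: leq_sub2l; apply: le; rewrite -ltnS.
rewrite /rank_fun (bigD1 i) //= [X in (_ < X)%N](bigD1 i) //= -addSn; apply: leq_add.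
  rewrite (bigD1 j) //= [X in (_ < X)%N](bigD1 j) //= -addSn; apply: leq_add.
    by have := corner_ub A i j; move: ij => /=; lia.
  by apply: leq_sum => j' _; apply: leO.
by apply: leq_sum => i' _; apply: leq_sum => j' _; apply: leO.
Qed.

Lemma Xi_sym A i j : A i j = A (rev_ord i) (rev_ord j) :> nat.
Proof. by have /andP[_ /forallP/(_ i)/forallP/(_ j)/eqP ->] := XiP A. Qed.

Lemma rev_mid : rev_ord (mid n) = mid n.
Proof. by apply: val_inj; rewrite /= inordK; lia. Qed.

Lemma rev_ord_eq (j : 'I_N) : rev_ord j = j -> j = mid n.
Proof.
by move=> /(congr1 val) /= e; apply: val_inj; rewrite /= inordK; have := ltn_ord j; lia.
Qed.

(** Off the middle, the entries come in equal pairs at distinct places, and a sum equal to 1 leaves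
    no room for a nonzero pair. *)
Lemma mid_line (F : 'I_N -> nat) : (forall j, F j = F (rev_ord j)) ->
  (\sum_j F j = 1)%N -> F (mid n) = 1%N /\ forall j, j != mid n -> F j = 0%N.
Proof.
move=> sF F1.
have F0 j : j != mid n -> F j = 0%N.
  move=> jm; move: F1; rewrite (bigD1 j) //= (bigD1 (rev_ord j)) /=.
    rewrite -sF; lia.
  by apply: contra_neq jm => /rev_ord_eq.
split=> //; move: F1; rewrite (bigD1 (mid n)) //= big1 ?addn0 //.
Qed.

Lemma in_iXiP A : reflect
  ((\sum_j (A (mid n) j : nat) = 1)%N /\ (\sum_i (A i (mid n) : nat) = 1)%N) (in_iXi A).
Proof.
apply: (iffP and3P) => [[/eqP m1 /forallP r0 /forallP c0]|[r1 c1]].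
  split; rewrite (bigD1 (mid n)) //= m1 big1 // => j jm.
    by have := r0 j; rewrite jm => /eqP.
  by have := c0 j; rewrite jm => /eqP.
have [m1 r0] := @mid_line (fun j => A (mid n) j)
  (fun j => eq_trans (Xi_sym A _ j) (congr1 (fun i => A i (rev_ord j) : nat) rev_mid)) r1.
have [_ c0] := @mid_line (fun j => A j (mid n))
  (fun j => eq_trans (Xi_sym A j _) (congr1 (fun i => A (rev_ord j) i : nat) rev_mid)) c1.
by split; [rewrite m1|apply/forallP => j; apply/implyP => /r0 ->|
  apply/forallP => j; apply/implyP => /c0 ->].
Qed.

Lemma sqle_iXi A B : sqle A B -> in_iXi B -> in_iXi A.
Proof. by move=> [eR eC _ _] /in_iXiP[r1 c1]; apply/in_iXiP; rewrite eR eC. Qed.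

End Corners.

Lemma orb_le_sqle n d (k : fieldType) (Q : 'M[k]_(d.*2.+1)) (A' A : Xi n d) :
  orb_le Q A' A -> orbO Q A' !=set0 -> sqle A' A.
Proof. by move=> le OA'; apply/corner_sqle/(closure_corner le OA'). Qed.

(** * Nonemptiness of the orbits *)

Section Congruence.
Variable k : closedFieldType.
Hypothesis two_neq0 : 2%:R != 0 :> k.

(** Otherwise polarization gives 2 u Q v^T = 0 for all u and v, hence Q = 0. *)
Lemma sym_anisotropic m (Q : 'M[k]_m.+1) : Q^T = Q -> Q \in unitmx ->
  exists v : 'rV_m.+1, (v *m Q *m v^T) 0 0 != 0.
Proof.
move=> sQ uQ; apply: contrapT => /forallNP H.
have qv v : v *m Q *m v^T = 0 :> 'M_1.
  by apply/rowP => i; rewrite ord1 [RHS]mxE; apply/eqP/negPn/negP/(H v).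
have buv (u v : 'rV_m.+1) : u *m Q *m v^T = 0.
  have := qv (u + v); rewrite linearD /= !mulmxDl !mulmxDr !qv add0r addr0.
  have -> : v *m Q *m u^T = u *m Q *m v^T.
    transitivity (u *m Q *m v^T)^T; first by rewrite !trmx_mul trmxK sQ mulmxA.
    by apply/matrixP => i j; rewrite !ord1 mxE.
  move=> /rowP/(_ 0); rewrite !mxE -mulr2n -mulr_natl => /eqP.
  rewrite mulf_eq0 (negbTE two_neq0) /= => /eqP b0.
  by apply/rowP => i; rewrite ord1 !mxE.
have Q0 : Q = 0.
  apply/matrixP => i j; have /rowP/(_ 0) := buv (delta_mx 0 i) (delta_mx 0 j).
  by rewrite -rowE trmx_delta -colE !mxE.
by move: uQ; rewrite Q0 unitmxE det0 unitr0.
Qed.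

Lemma closed_sqrt (a : k) : exists s, s * s = a.
Proof.
have [s sP] := @solve_monicpoly k 2 (fun i => if i == 0%N then a else 0) isT.
by exists s; rewrite -expr2 sP !big_ord_recl big_ord0 /= expr0 mulr1 mul0r !addr0.
Qed.

Lemma sym_block m (M : 'M[k]_(1 + m)) : M^T = M ->
  M = block_mx (M 0 0)%:M (ursubmx M) (ursubmx M)^T (drsubmx M).
Proof.
move=> sM; rewrite -{1}(submxK M); congr block_mx; last by rewrite trmx_ursub sM.
rewrite [LHS]mx11_scalar; congr (_%:M); rewrite !mxE.
by congr (M _ _); apply: val_inj.
Qed.

Lemma sym_congr1 m (Q : 'M[k]_m) : Q^T = Q -> Q \in unitmx ->
  exists2 P, P \in unitmx & P *m Q *m P^T = 1%:M.
Proof.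
elim: m Q => [|m IH] Q sQ uQ.
  by exists 1%:M; [exact: unitmx1|rewrite [LHS]flatmx0 [RHS]flatmx0].
have [v vQ] := sym_anisotropic sQ uQ.
have v0 : v != 0 by apply: contra_neq vQ => ->; rewrite !mul0mx mxE.
(* An invertible matrix whose first row is proportional to [v]; changing basis by it puts a nonzero
   entry [a] in the corner. *)
pose R := row_ebase v; have uR : R \in unitmx := row_ebase_unit v.
have [c vE] : exists c, v = c *: row 0 R.
  have /submxP [C vC] : (v <= row 0 R)%MS.
    have := mulmx_ebase v; rewrite (_ : \rank v = 1%N); last by apply/eqP; rewrite rank_rV v0.
    move=> <-; rewrite -mulmxA; apply: submx_trans (submxMl _ _) _.
    have -> : (pid_mx 1 : 'M[k]_(1, m.+1)) = delta_mx 0 0.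
      by apply/matrixP => i j; rewrite !mxE !ord1 /= eq_sym andbT.
    by rewrite -rowE.
  by exists (C 0 0); rewrite vC [C]mx11_scalar mul_scalar_mx mxE eqxx mulr1n.
pose Q1 : 'M_(1 + m) := R *m Q *m R^T.
have sQ1 : Q1^T = Q1 by rewrite /Q1 !trmx_mul trmxK sQ mulmxA.
have uQ1 : Q1 \in unitmx by rewrite !unitmx_mul unitmx_tr uR uQ.
pose a := Q1 0 0.
have a0 : a != 0.
  apply: contra_neq vQ => a0; rewrite vE.
  rewrite -scalemxAl linearZ /= -scalemxAl -scalemxAr scalerA mxE.
  have -> : (row 0 R *m Q *m (row 0 R)^T) 0 0 = a.
    rewrite -row_mul mxE /a /Q1 [RHS]mxE; apply: eq_bigr => j _.
    by rewrite mxE [(row 0 R)^T j 0]mxE [row 0 R 0 j]mxE [R^T j 0]mxE.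
  by rewrite a0 mulr0.
(* [f] is the Schur complement of the corner entry [a], to which the induction hypothesis will
   apply. *)
pose b : 'rV_m := ursubmx Q1; pose f := drsubmx Q1 - a^-1 *: (b^T *m b).
have Q1E : Q1 = block_mx a%:M b b^T (drsubmx Q1).
  exact: sym_block sQ1.
have [s ss] := closed_sqrt a^-1.
have s0 : s != 0 by apply: contra_neq a0 => s0; rewrite -[a]invrK -ss s0 mul0r invr0.
(* Clears the first row and column by completing the square and scales [a] to 1, with [s] a square
   root of its inverse. *)
pose L : 'M_(1 + m) := block_mx s%:M 0 (- a^-1 *: b^T) 1%:M.
have uL : L \in unitmx.
  by rewrite unitmxE det_lblock det1 det_scalar mulr1 unitfE expf_neq0.
have LQ : L *m Q1 *m L^T = block_mx 1%:M 0 0 f.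
  rewrite Q1E /L tr_block_mx !mulmx_block !trmx0 !trmx1 tr_scalar_mx !mul0mx !mulmx0 !addr0 !mul1mx.
  rewrite linearZ /= trmxK !mulmx1.
  have ba : - a^-1 *: b^T *m a%:M + b^T = 0.
    by rewrite mul_mx_scalar scalerA mulrN mulfV // scaleN1r addNr.
  rewrite ba !mul0mx add0r; congr block_mx.
  - rewrite -!scalar_mxM; congr (_%:M).
    by rewrite mulrAC ss mulVf.
  - rewrite -scalar_mxM !mul_scalar_mx scalerA -mulrA mulrN mulfV //.
    by rewrite mulrN1 scaleNr addNr.
  - by rewrite /f addrC -scalemxAl scaleNr.
have uf : f \in unitmx.
  have : L *m Q1 *m L^T \in unitmx by rewrite !unitmx_mul !unitmx_tr uL uR uQ.
  by rewrite LQ unitmxE det_ublock det1 mul1r -unitmxE.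
have sf : f^T = f.
  by rewrite /f linearB linearZ /= trmx_mul trmxK trmx_drsub sQ1.
have [P2 uP2 P2f] := IH f sf uf.
pose B : 'M_(1 + m) := block_mx 1%:M 0 0 P2.
have uB : B \in unitmx by rewrite unitmxE det_ublock det1 mul1r -unitmxE.
exists (B *m L *m R); first by rewrite unitmx_mul uR andbT unitmx_mul uL uB.
have -> : B *m L *m R *m Q *m (B *m L *m R)^T = B *m (L *m Q1 *m L^T) *m B^T.
  by rewrite !trmx_mul /Q1 !mulmxA.
rewrite LQ /B tr_block_mx !mulmx_block !trmx0 !trmx1 !mul0mx !mulmx0 !mul1mx !addr0 !add0r.
by rewrite P2f !mulmx1 !mul0mx -scalar_mx_block.
Qed.

Lemma sym_congr m (Q Q' : 'M[k]_m) : Q^T = Q -> Q \in unitmx -> Q'^T = Q' -> Q' \in unitmx ->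
  exists2 P, P \in unitmx & P *m Q *m P^T = Q'.
Proof.
move=> sQ uQ sQ' uQ'; have [P uP PE] := sym_congr1 sQ uQ.
have [R uR RE] := sym_congr1 sQ' uQ'; exists (invmx R *m P).
  by rewrite unitmx_mul unitmx_inv uR.
transitivity (invmx R *m (P *m Q *m P^T) *m (invmx R)^T); first by rewrite trmx_mul !mulmxA.
rewrite PE -RE !mulmxA mulVmx // mul1mx -mulmxA -trmx_mul mulVmx //.
by rewrite trmx1 mulmx1.
Qed.
End Congruence.

(** * Flags spanned by a basis whose Gram matrix is a permutation matrix *)

Section LabelledBases.
Variables (n d : nat) (k : fieldType) (Q P : 'M[k]_(d.*2.+1)).
Local Notation N := n.*2.+1.
Local Notation D := d.*2.+1.
Variable tau : 'I_D -> 'I_D.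
Hypothesis tauK : involutive tau.
Hypothesis uP : P \in unitmx.
Hypothesis PQ : P *m Q *m P^T = \matrix_(r, s) (s == tau r)%:R.

Definition label_flag (lab : 'I_D -> 'I_N) : flag_type n d k :=
  [ffun i : 'I_N.+1 => cspan [pred r | (lab r < i)%N] P].

Lemma form_coord (z y : 'rV[k]_D) :
  (z *m P) *m Q *m (y *m P)^T = (\sum_r z 0 r * y 0 (tau r))%:M.
Proof.
rewrite trmx_mul !mulmxA -[z *m P *m Q]mulmxA -[z *m _ *m P^T]mulmxA PQ.
apply/rowP => i; rewrite ord1 [RHS]mxE eqxx mulr1n mxE (reindex_inj (inv_inj tauK)) /=.
apply: eq_bigr => r _; rewrite !mxE (bigD1 r) //= big1 => [|s sr].
  by rewrite mxE eqxx mulr1 addr0.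
by rewrite mxE (inj_eq (inv_inj tauK)) eq_sym (negbTE sr) mulr0.
Qed.

(** Row r pairs only with row [tau r], so the orthogonal of V_{N-i} is spanned by the rows r with
    [tau r] outside V_{N-i}; by the symmetry of the labels these are the rows with label less than
    i. *)
Lemma label_flagP (lab : 'I_D -> 'I_N) : (forall r, lab (tau r) = rev_ord (lab r)) ->
  is_flag Q (label_flag lab).
Proof.
move=> labt; split=> [|||i w].
- apply/eqP; rewrite ffunE -subv0; exact: cspan_sub.
- apply/eqP; rewrite eqEdim subvf dim_fullv ffunE dim_cspan //.
  rewrite (eq_card (_ : _ =i predT)) ?card_ord ?leqnn // => r.
  by rewrite !inE ltn_ord.
- by move=> i; rewrite !ffunE; apply: sub_cspan => r /= /leqW.
rewrite !ffunE; have [y wE] : exists y, w = y *m P by exists (w *m invmx P); rewrite mulmxKV.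
have yE : w *m invmx P = y by rewrite wE mulmxK.
split=> [/(cspanP _ _ uP) wi u /(cspanP _ _ uP) ui|H].
  rewrite yE in wi.
  have uE : u = (u *m invmx P) *m P by rewrite mulmxKV.
  rewrite uE wE form_coord big1 => [|r _]; first by apply/rowP => j; rewrite ord1 !mxE mul0rn.
  have [rl|rl] := ltnP (lab r) (rev_ord i); last by rewrite ui ?mul0r //= -leqNgt.
  rewrite [y 0 _]wi ?mulr0 //= -leqNgt labt /=; move: rl => /=.
  by have := ltn_ord i; have := ltn_ord (lab r); lia.
apply/(cspanP _ _ uP) => s /=; rewrite -leqNgt => si.
rewrite yE.
have /H : row (tau s) P \in cspan [pred r | (lab r < rev_ord i)%N] P.
  apply: row_cspan; rewrite /= labt /=.
  by have := ltn_ord i; have := ltn_ord (lab s); lia.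
rewrite rowE wE form_coord => /rowP/(_ 0); rewrite !mxE eqxx mulr1n.
rewrite (bigD1 (tau s)) //= big1 => [|r rs]; last by rewrite mxE (negbTE rs) andbF mul0r.
by rewrite mxE !eqxx mul1r addr0 tauK ?mulmxK.
Qed.

(** All subspaces involved are spanned by rows of the one basis [P], so dimensions count labels, and
    the difference of two of them counts the rows labelled (i, j). *)
Lemma label_orbit (A : Xi n d) (rw cl : 'I_D -> 'I_N) :
  (forall r, rw (tau r) = rev_ord (rw r)) -> (forall r, cl (tau r) = rev_ord (cl r)) ->
  (forall i j, #|[pred r | (rw r == i) && (cl r == j)]| = A i j) ->
  orbO Q A (label_flag rw, label_flag cl).
Proof.
move=> rwt clt cardA; split; [exact: label_flagP|exact: label_flagP|move=> i j /=].
rewrite !ffunE !cap_cspan // !add_cspan !dim_cspan // -cardA.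
rewrite /= !/bump !leq0n !add1n.
set X1 := (X in (#|X| - _)%N); set X2 := (X in (_ - #|X|)%N).
rewrite -(cardID X2 X1); have -> : #|[predI X1 & X2]| = #|X2|.
  by apply: eq_card => r; rewrite !inE /=; lia.
rewrite addKn; apply: eq_card => r; rewrite !inE /= -!val_eqE /=.
lia.
Qed.
End LabelledBases.

Local Close Scope classical_set_scope.
Section NonemptyOrbits.
Variables (n d : nat) (k : closedFieldType).
Local Notation N := n.*2.+1.
Local Notation D := d.*2.+1.
Hypothesis two_neq0 : 2%:R != 0 :> k.
Variable Q : 'M[k]_D.
Hypothesis sQ : Q^T = Q.
Hypothesis uQ : Q \in unitmx.
Variable A : Xi n d.

(** Takes a_ij boxes at each place (i, j), d.*2.+1 in total; they will index a basis of the
    space. *)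
Definition cells : {set 'I_N * 'I_N * 'I_(d.*2.+2)} :=
  finset (fun x : 'I_N * 'I_N * 'I_(d.*2.+2) => (x.2 < A x.1.1 x.1.2)%N).

Lemma card_cell i j : #|[set x in cells | x.1 == (i, j)]| = A i j.
Proof.
have -> : [set x in cells | x.1 == (i, j)] =
   [set ((i, j), m) | m in [set m : 'I_(d.*2.+2) | (m < A i j)%N]].
  apply/setP => -[[i' j'] m]; rewrite !inE /=; apply/andP/imsetP.
    by move=> [mA /eqP[ei ej]]; exists m; rewrite ?inE -?ei -?ej.
  by move=> [m']; rewrite inE => m'A [-> -> ->].
rewrite card_imset => [|m m' []//]; rewrite -sum1dep_card.
by rewrite -(big_ord_widen _ (fun=> 1%N) (ltnW (ltn_ord (A i j)))) sum1_card card_ord.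
Qed.

Lemma card_cells : #|cells| = D.
Proof.
have /andP[/eqP sumA _] := XiP A.
transitivity (\sum_i \sum_j (A i j : nat))%N; last exact: sumA.
rewrite pair_big /= -sum1_card (partition_big fst predT) //=.
apply: eq_bigr => -[i j] _; rewrite sum1dep_card /= -card_cell.
by apply: eq_card => x; rewrite !inE.
Qed.

Definition cell_of (r : 'I_D) := enum_val (cast_ord (esym card_cells) r).

Lemma cell_ofP r : cell_of r \in cells.
Proof. exact: enum_valP. Qed.

Lemma cell_of_inj : injective cell_of.
Proof. by move=> r s /enum_val_inj /cast_ord_inj. Qed.

Lemma cell_of_surj x : x \in cells -> exists r, cell_of r = x.
Proof.
move=> xC; exists (cast_ord card_cells (enum_rank_in xC x)).
by rewrite /cell_of cast_ordK enum_rankK_in.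
Qed.

Definition rev_cell (x : 'I_N * 'I_N * 'I_(d.*2.+2)) := ((rev_ord x.1.1, rev_ord x.1.2), x.2).

(** The half-turn symmetry of [A] is an involution on boxes. In a basis whose Gram matrix is the
    permutation matrix of this involution, labelling boxes by row and by column gives the two
    flags. *)
Lemma orbit_nonempty : (orbO Q A !=set0)%classic.
Proof.
have /choice [tau tauP] r : exists s, cell_of s = rev_cell (cell_of r).
  by apply: cell_of_surj; have := cell_ofP r; rewrite !inE /= -Xi_sym.
have tauK : involutive tau.
  move=> r; apply: cell_of_inj; rewrite !tauP /rev_cell /= !rev_ordK.
  by case: (cell_of r) => -[].
pose S : 'M[k]_D := \matrix_(r, s) (s == tau r)%:R.
have sS : S^T = S.
  by apply/matrixP => r s; rewrite !mxE -(inj_eq (inv_inj tauK)) tauK eq_sym.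
have uS : S \in unitmx.
  suff SS : S *m S = 1%:M by have [] := mulmx1_unit SS.
  apply/matrixP => r s; rewrite !mxE (bigD1 (tau r)) //= big1 => [|t tr].
    by rewrite !mxE eqxx mul1r addr0 tauK eq_sym.
  by rewrite !mxE (negbTE tr) mul0r.
have [P uP PQ] := sym_congr two_neq0 sQ uQ sS uS.
exists (label_flag P (fun r => (cell_of r).1.1), label_flag P (fun r => (cell_of r).1.2)).
apply: (label_orbit tauK uP PQ) => [r|r|i j]; rewrite ?tauP //.
rewrite -card_cell -(card_imset _ cell_of_inj); apply: eq_card => x.
rewrite inE; apply/imsetP/andP => [[r]|[xC /eqP xij]].
  rewrite inE => /andP[/eqP <- /eqP <-] ->; split; first exact: cell_ofP.
  by rewrite -surjective_pairing.
have [r rx] := cell_of_surj xC; exists r => //.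
by rewrite inE rx xij /= !eqxx.
Qed.
End NonemptyOrbits.
Local Open Scope classical_set_scope.

(** * Negative Laurent polynomials *)

Section LaurentPolynomials.

Lemma vpow0 : vpow 0 = 1.
Proof. by apply: val_inj; rewrite /= expr0z. Qed.

Lemma vpowD a b : vpow (a + b) = vpow a * vpow b.
Proof. by apply: val_inj; rewrite /= expfzDr // vfrac_neq0. Qed.

Lemma vpowK a : vpow a * vpow (- a) = 1.
Proof. by rewrite -vpowD subrr vpow0. Qed.

Definition neg_sum (p : {poly int}) : Laurent :=
  \sum_(i < size p) vpow (- (i.+1)%:Z) *~ p`_i.

Lemma neg_sum_widen (p : {poly int}) m : (size p <= m)%N ->
  neg_sum p = \sum_(i < m) vpow (- (i.+1)%:Z) *~ p`_i.
Proof.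
move=> pm; rewrite /neg_sum (big_ord_widen m (fun i => vpow (- (i.+1)%:Z) *~ p`_i) pm).
rewrite big_mkcond; apply: eq_bigr => i _; case: ltnP => // ip.
by rewrite nth_default // mulr0z.
Qed.

Lemma negative_laurent0 : negative_laurent 0.
Proof. by exists 0; rewrite size_poly0 big_ord0. Qed.

Lemma negative_laurentB x y :
  negative_laurent x -> negative_laurent y -> negative_laurent (x - y).
Proof.
move=> [p ->] [q ->]; exists (p - q); rewrite -!/(neg_sum _).
pose m := maxn (size p) (size q).
rewrite !(@neg_sum_widen _ m) ?leq_maxl ?leq_maxr //; last first.
  by rewrite (leq_trans (size_polyD _ _)) // size_polyN.
by rewrite -sumrB; apply: eq_bigr => i _; rewrite coefB mulrzBr.
Qed.

Lemma negative_laurentD x y :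
  negative_laurent x -> negative_laurent y -> negative_laurent (x + y).
Proof.
move=> nx ny; rewrite -[y]opprK -[- y]add0r; apply: negative_laurentB => //.
by apply: negative_laurentB => //; apply: negative_laurent0.
Qed.

Lemma negative_laurent_vpow z m : (z < 0)%R -> negative_laurent (vpow z *+ m).
Proof.
move=> z0; elim: m => [|m IH]; first by rewrite mulr0n; apply: negative_laurent0.
rewrite mulrS; apply: negative_laurentD => //.
have [i ->] : exists i : nat, z = - (i.+1)%:Z.
  by exists `|z|.-1; rewrite prednK ?absz_gt0 ?ltz0_abs ?opprK // lt_eqF.
exists 'X^i; rewrite size_polyXn big_ord_recr /= coefXn eqxx mulr1z big1 ?add0r // => j _.
by rewrite coefXn (ltn_eqF (ltn_ord j)) mulr0z.
Qed.

Lemma negative_laurent_sum (I : Type) (r : seq I) (P : pred I) (F : I -> Laurent) :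
  (forall i, P i -> negative_laurent (F i)) -> negative_laurent (\sum_(i <- r | P i) F i).
Proof.
by move=> H; apply: big_ind => //; [exact: negative_laurent0|exact: negative_laurentD].
Qed.

Lemma laurent_val_sum (I : Type) (r : seq I) (F : I -> Laurent) :
  laurent_val (\sum_(i <- r) F i) = \sum_(i <- r) laurent_val (F i).
Proof. exact: (raddf_sum (val : Laurent -> {fraction {poly int}})). Qed.

Lemma laurent_valMz (x : Laurent) z : laurent_val (x *~ z) = laurent_val x *~ z.
Proof. exact: (raddfMz (val : Laurent -> {fraction {poly int}})). Qed.

Lemma vfrac_polyE m (e : 'I_m -> nat) (c : 'I_m -> int) :
  \sum_i (vfrac ^+ e i) *~ c i = tofrac (\sum_i c i *: 'X^(e i)).
Proof.
rewrite rmorph_sum; apply: eq_bigr => i _ /=.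
rewrite -[c i in RHS]intz scaler_int rmorphMz /=; congr (_ *~ _). exact: esym (rmorphXn _ _ _).
Qed.

(** After multiplication by v^m, with m the size of [p], one side has exponents below m and the
    other exponents above m, so all coefficients vanish. *)
Lemma neg_sum_bar_eq0 p :
  neg_sum p = \sum_(i < size p) vpow (i.+1)%:Z *~ p`_i -> neg_sum p = 0.
Proof.
rewrite /neg_sum; move: (size p) => m /(congr1 laurent_val).
rewrite !laurent_val_sum => /(congr1 (fun x => x * vfrac ^+ m)); rewrite !mulr_suml.
have nv := vfrac_neq0; have vE z : laurent_val (vpow z) = vfrac ^ z by [].
rewrite (eq_bigr (fun i : 'I_m => (vfrac ^+ (m - i.+1)) *~ p`_i)); last first.
  move=> i _; rewrite laurent_valMz -mulrzl -mulrA mulrzl; congr (_ *~ _).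
  by rewrite vE !exprnP -expfzDr // addrC -subzn.
rewrite [RHS](eq_bigr (fun i : 'I_m => (vfrac ^+ (i.+1 + m)) *~ p`_i)); last first.
  move=> i _; rewrite laurent_valMz -mulrzl -mulrA mulrzl; congr (_ *~ _).
  by rewrite vE !exprnP -expfzDr.
rewrite !vfrac_polyE => /eqP; rewrite tofrac_eq => /eqP/polyP e.
apply: big1 => j _; suff -> : p`_j = 0 by rewrite mulr0z.
have := e (m - j.+1)%N; rewrite !coef_sum (bigD1 j) //= coefZ coefXn eqxx mulr1.
rewrite big1 ?addr0 => [->|i ij]; last first.
  rewrite coefZ coefXn; case: eqP => [h|]; last by rewrite mulr0.
  by case/eqP: ij; apply: val_inj => /=; have := ltn_ord i; have := ltn_ord j; lia.
apply: big1 => i _; rewrite coefZ coefXn; case: eqP => [h|]; last by rewrite mulr0.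
by have := ltn_ord j; lia.
Qed.
End LaurentPolynomials.

(** * Unitriangular bases and the bar involution *)

Section StandardBasis.
Variables (n d : nat) (k : fieldType) (Q : 'M[k]_(d.*2.+1)).
Implicit Types (A B : Xi n d) (x : Sj n d).

Lemma stdE A B : std Q A B = vpow ((proj_dim Q A)%:Z - (orb_dim Q A)%:Z) * (B == A)%:R.
Proof. by rewrite /std /eb !ffunE. Qed.

Lemma std_neq A B : B != A -> std Q A B = 0.
Proof. by move=> /negbTE BA; rewrite stdE BA mulr0. Qed.

Lemma std_diag_eq0 A (c : Laurent) : c * std Q A A = 0 -> c = 0.
Proof.
rewrite stdE eqxx mulr1 => /(congr1 (fun y => y * vpow (- ((proj_dim Q A)%:Z - (orb_dim Q A)%:Z)))).
by rewrite -mulrA vpowK mulr1 mul0r.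
Qed.

Lemma sum_std_at (I : finType) (P : pred I) (f : I -> Laurent) (h : I -> Xi n d) B :
  (\sum_(i | P i) f i *: std Q (h i)) B = \sum_(i | P i) f i * std Q (h i) B.
Proof. by rewrite sum_ffunE; apply: eq_bigr => i _; rewrite ffunE. Qed.

Lemma SiP x : Si Q x <-> forall B, ~~ in_iXi B -> x B = 0.
Proof.
split=> [[c ->] B nB|H].
  rewrite sum_std_at big1 // => A _; rewrite std_neq ?mulr0 //.
  by apply: contraNneq nB => ->; apply: valP.
exists (fun A : iXi n d => x (val A) * vpow (- ((proj_dim Q (val A))%:Z - (orb_dim Q (val A))%:Z))).
apply/ffunP => B; rewrite sum_std_at; case iB: (in_iXi B); last first.
  rewrite H ?iB // big1 // => A _; rewrite std_neq ?mulr0 //.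
  by apply: contraFneq iB => ->; apply: valP.
rewrite (bigD1 (Sub B iB)) //= big1 => [|A AB].
  by rewrite addr0 stdE eqxx mulr1 -mulrA [vpow (- _) * _]mulrC vpowK mulr1.
rewrite std_neq ?mulr0 //; apply: contraNneq AB => BA.
by apply/eqP/val_inj; rewrite /= BA.
Qed.

Definition unitri (A : Xi n d) (b : Sj n d) : Prop :=
  exists c : Xi n d -> Laurent, (forall A', negative_laurent (c A')) /\
    b = std Q A + \sum_(A' | `[< sqlt A' A >]) c A' *: std Q A'.

Lemma unitri_at A b B : unitri A b -> ~ sqlt B A -> b B = std Q A B.
Proof.
move=> [c [_ ->]] nBA; rewrite ffunE sum_std_at big1 ?addr0 // => A' /asboolP A'A.
by rewrite std_neq ?mulr0 //; apply: contra_not_neq nBA => ->.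
Qed.

Lemma sqlt_iXi A B : sqlt B A -> in_iXi A -> in_iXi B.
Proof. by move=> [/sqle_iXi BA _]; apply: BA. Qed.

(** The order preserves row and column sums, so every lower term of an index in [iXi] is again in
    [iXi]; expansions over the two index sets are interchangeable. *)
Lemma unitri_iXi (A : iXi n d) b : unitri (val A) b <->
  exists c : iXi n d -> Laurent, (forall A' : iXi n d, negative_laurent (c A')) /\
    b = std Q (val A) +
      \sum_(A' : iXi n d | `[< sqlt (val A') (val A) >]) c A' *: std Q (val A').
Proof.
have E (c : Xi n d -> Laurent) : \sum_(A' | `[< sqlt A' (val A) >]) c A' *: std Q A' =
    \sum_(A' : iXi n d | `[< sqlt (val A') (val A) >]) c (val A') *: std Q (val A').
  rewrite (reindex_omap (val : iXi n d -> Xi n d) insub) => [|B /asboolP BA]; last first.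
    have iB := sqlt_iXi BA (valP A).
    by rewrite insubT.
  by apply: eq_bigl => B; rewrite valK eqxx andbT.
split=> [[c [cn ->]]|[c [cn ->]]]; first by exists (c \o val); split=> [A'|]; [exact: cn|rewrite E].
exists (fun B => if insub B is Some B' then c B' else 0); split.
  by move=> B; case: insubP => [B' _ _|_] //; apply: negative_laurent0.
by rewrite E; congr (_ + _); apply: eq_bigr => B _; rewrite valK.
Qed.

Lemma unitri_Si A b : unitri A b -> in_iXi A -> Si Q b.
Proof.
move=> ub iA; apply/SiP => B nB; rewrite (unitri_at ub) ?std_neq //.
  by apply: contraNneq nB => ->.
by move=> /sqlt_iXi /(_ iA) iB; rewrite iB in nB.
Qed.

(** The coefficient of [b] at [A] is that of [std Q A], a power of v and hence nonzero. *)
Lemma Si_unitri A b : unitri A b -> Si Q b -> in_iXi A.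
Proof.
move=> ub /SiP H; apply/negPn/negP => /H; rewrite (unitri_at ub); last by case.
rewrite -[std _ _ _]mul1r => /std_diag_eq0 /eqP.
by rewrite oner_eq0.
Qed.

Section Basis.
Variable b : iXi n d -> Sj n d.
Hypothesis ub : forall A : iXi n d, unitri (val A) (b A).

Definition bspan x : Prop := exists c : {ffun iXi n d -> Laurent}, x = \sum_A c A *: b A.

Lemma bspanD x y : bspan x -> bspan y -> bspan (x + y).
Proof.
move=> [c ->] [c' ->]; exists [ffun A => c A + c' A]; rewrite -big_split.
by apply: eq_bigr => A _; rewrite ffunE scalerDl.
Qed.

Lemma bspanZ a x : bspan x -> bspan (a *: x).
Proof.
move=> [c ->]; exists [ffun A => a * c A]; rewrite scaler_sumr.
by apply: eq_bigr => A _; rewrite ffunE scalerA.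
Qed.

Lemma bspan_sum (I : Type) (r : seq I) (P : pred I) (F : I -> Sj n d) :
  (forall i, P i -> bspan (F i)) -> bspan (\sum_(i <- r | P i) F i).
Proof.
move=> H; apply: big_ind => //; last exact: bspanD.
by exists [ffun=> 0]; rewrite big1 // => A _; rewrite ffunE scale0r.
Qed.

Lemma bspan_b (A : iXi n d) : bspan (b A).
Proof.
exists [ffun B => (B == A)%:R]; rewrite (bigD1 A) //= ffunE eqxx scale1r big1 ?addr0 // => B.
by rewrite ffunE => /negbTE ->; rewrite scale0r.
Qed.

Lemma bspan_std (A : iXi n d) : bspan (std Q (val A)).
Proof.
have [m] := ubnP (rank_fun (val A)); elim: m A => // m IH A rA.
have /unitri_iXi [c [_ bA]] := ub A.
rewrite (_ : std Q (val A) = b A +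
  (-1) *: \sum_(A' : iXi n d | `[< sqlt (val A') (val A) >]) c A' *: std Q (val A')); last first.
  by rewrite bA scaleN1r addrK.
apply: bspanD; first exact: bspan_b.
apply/bspanZ/bspan_sum => B /asboolP /rank_fun_lt BA; apply/bspanZ/IH.
by apply: leq_trans BA _; rewrite -ltnS.
Qed.

(** At an index of maximal [rank_fun] among the nonzero coefficients, no other term of the sum
    contributes. *)
Lemma b_free (f : iXi n d -> Laurent) : \sum_A f A *: b A = 0 -> forall A : iXi n d, f A = 0.
Proof.
move=> sum0 A0; apply/eqP/negPn/negP => fA0.
case: (@arg_maxnP _ A0 (fun A : iXi n d => f A != 0) (fun A : iXi n d => rank_fun (val A)) fA0) => A fA max.
case/eqP: fA; have := congr1 (fun x : Sj n d => x (val A)) sum0.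
rewrite sum_ffunE (bigD1 A) //= [RHS]ffunE ffunE (unitri_at (ub A)); last by case.
rewrite big1 ?addr0; last first.
  move=> B BA; rewrite ffunE; have [->|fB] := eqVneq (f B) 0; first by rewrite scale0r.
  rewrite (unitri_at (ub B)) ?std_neq ?scaler0 // 1?eq_sym ?(inj_eq val_inj) //.
  by move=> /rank_fun_lt; rewrite ltnNge => /negP; apply; apply: max.
by move=> /std_diag_eq0.
Qed.

Lemma unitri_basis : is_basis_Si Q b.
Proof.
split=> [A|x [c ->]]; first by apply: unitri_Si (ub A) (valP A).
have [c' Hc'] : bspan (\sum_A c A *: std Q (val A)).
  by apply: bspan_sum => A _; apply/bspanZ/bspan_std.
exists c'; split=> // c'' e; apply/ffunP => A; apply/eqP; rewrite -subr_eq0; apply/eqP.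
move: A; apply: b_free; under eq_bigr do rewrite scalerBl.
by rewrite sumrB -Hc' -e subrr.
Qed.
End Basis.

Section Bar.
Variables (can : Xi n d -> Sj n d) (bar : {additive Sj n d -> Sj n d}).
Hypothesis u_can : forall A, unitri A (can A).
Hypothesis bar_can : forall A, bar (can A) = can A.
Hypothesis bar_v : forall (z : int) x, bar (vpow z *: x) = vpow (- z) *: bar x.

(** [c'] is [c] with v replaced by its inverse: semilinearity for powers of v extends to [c] by
    additivity. *)
Lemma bar_negative c : negative_laurent c -> exists c' : Laurent,
  (forall x, bar (c *: x) = c' *: bar x) /\ (c = c' -> c = 0).
Proof.
move=> [p ->]; exists (\sum_(i < size p) vpow (i.+1)%:Z *~ p`_i); split=> [x|].
  rewrite !scaler_suml raddf_sum; apply: eq_bigr => i _ /=.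
  by rewrite -!scalerMzl raddfMz bar_v opprK.
exact: neg_sum_bar_eq0.
Qed.

(** Solving the expansion of the invariant element [can A] for [std Q A] and applying [bar] leaves
    [can A] minus the bars of lower terms, which by induction do not reach indices of rank at least
    that of [A]. *)
Lemma bar_std A B : (rank_fun A <= rank_fun B)%N -> bar (std Q A) B = std Q A B.
Proof.
have [m] := ubnP (rank_fun A); elim: m A => // m IH A rA AB.
have [c [cn canA]] := u_can A.
have /choice [c' Hc'] B' := bar_negative (cn B').
have barA : bar (std Q A) = can A - \sum_(A' | `[< sqlt A' A >]) c' A' *: bar (std Q A').
  rewrite -{1}(bar_can A) {1}canA raddfD raddf_sum /=.
  under eq_bigr do rewrite (Hc' _).1.
  by rewrite addrK.
rewrite barA ffunE (unitri_at (u_can A)); last by move=> /rank_fun_lt; rewrite ltnNge AB.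
rewrite [X in _ + X](_ : _ = 0) ?addr0 // ffunE sum_ffunE big1 ?oppr0 // => A' /asboolP A'A.
have rA' := rank_fun_lt A'A; rewrite ffunE IH.
- by rewrite std_neq ?scaler0 //; apply: contraTneq AB => ->; rewrite -ltnNge.
- by apply: leq_trans rA' _; rewrite -ltnS.
- exact: leq_trans (ltnW rA') AB.
Qed.

(** At an index of maximal rank with nonzero coefficient, [bar_std] leaves one contribution to the
    bar image, so that coefficient is invariant under inverting v and therefore zero. *)
Lemma bar_negative_eq0 (I : finType) (h : I -> Xi n d) (f : I -> Laurent) :
  injective h -> (forall i, negative_laurent (f i)) ->
  bar (\sum_i f i *: std Q (h i)) = \sum_i f i *: std Q (h i) -> forall i, f i = 0.
Proof.
move=> h_inj fn fix_sum i0; apply/eqP/negPn/negP => fi0.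
case: (@arg_maxnP _ i0 (fun i => f i != 0) (fun i => rank_fun (h i)) fi0) => i fi max.
have /choice [f' Hf'] j := bar_negative (fn j).
case/eqP: fi; apply: (Hf' i).2.
apply/eqP; rewrite -subr_eq0; apply/eqP; apply: (@std_diag_eq0 (h i)).
have barE : bar (\sum_i f i *: std Q (h i)) (h i) = f' i * std Q (h i) (h i).
  rewrite (raddf_sum bar) sum_ffunE (bigD1 i isT) big1 => [|j ji].
    by apply: etrans (addr0 _) _; rewrite /= (Hf' i).1 ffunE bar_std.
  have [->|fj] := eqVneq (f j) 0; first by rewrite scale0r raddf0 ffunE.
  rewrite (Hf' j).1 ffunE bar_std; last exact: max.
  by rewrite std_neq ?scaler0 // eq_sym (inj_eq h_inj).
have sumE : (\sum_i f i *: std Q (h i)) (h i) = f i * std Q (h i) (h i).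
  rewrite sum_std_at (bigD1 i isT) big1 => [|j ji]; first exact: addr0.
  by rewrite std_neq ?mulr0 // eq_sym (inj_eq h_inj).
by rewrite mulrBl -barE -sumE fix_sum subrr.
Qed.

End Bar.
End StandardBasis.

(** * The canonical basis *)

Lemma zclosure_sub (k : fieldType) (T : cspace k) (Z : set T) : Z `<=` zclosure Z.
Proof. by move=> x Zx C _; apply. Qed.

Section CanonicalBasis.
Variables (n d : nat) (k : closedFieldType) (Q : 'M[k]_(d.*2.+1)) (l : nat).
Hypothesis two_neq0 : 2%:R != 0 :> k.
Hypothesis sQ : Q^T = Q.
Hypothesis uQ : Q \in unitmx.
Hypothesis l_prime : prime l.
Variable IC : forall A : Xi n d, complex (zclosure (orbO Q A)).
Hypothesis IC_spec : forall A, is_IC l (IC A).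

(** The sum over all degrees is a finitely supported one; the vanishing bound supplies an explicit
    finite range containing its support. *)
Lemma ICpoly_widen (A' A : Xi n d) m :
  (forall i, (m <= i)%N -> stalk_dim (IC A) l i (orbO Q A') = 0%N) ->
  ICpoly l IC A' A = \sum_(i < m) vpow (i%:Z - (orb_dim Q A)%:Z + (orb_dim Q A')%:Z) *+
    stalk_dim (IC A) l i (orbO Q A').
Proof.
move=> H; rewrite /ICpoly (fsbigE (iota 0 m)) ?iota_uniq //; last first.
  by move=> i _; rewrite mem_iota /= add0n -leqNgt => /H ->.
rewrite -(big_mkord xpredT (fun i : nat => vpow (i%:Z - (orb_dim Q A)%:Z + (orb_dim Q A')%:Z) *+
    stalk_dim (IC A) l i (orbO Q A'))) /index_iota subn0.
by apply: eq_bigl => i; rewrite in_setT.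
Qed.

Lemma ICpoly_diag A : ICpoly l IC A A = 1.
Proof.
have [cA _] := IC_spec A.
have sA : orbO Q A `<=` zclosure (orbO Q A) := @zclosure_sub _ _ _.
have secA x : orbO Q A x -> local_section x := @local_section_orbit _ _ _ Q A x.
rewrite (@ICpoly_widen A A 1).
  rewrite big_ord1 (constant_stalk_dim0 l_prime secA sA) //; last exact: orbit_nonempty.
  by rewrite mulr1n sub0r addNr vpow0.
by case=> // i _; apply: (constant_stalk_dimS l_prime secA sA).
Qed.

Lemma ICpoly_negative A' A : orb_le Q A' A -> A' <> A -> negative_laurent (ICpoly l IC A' A).
Proof.
move=> le nA; have [_ /(_ A' le nA) H] := IC_spec A.
have secA' x : orbO Q A' x -> local_section x := @local_section_orbit _ _ _ Q A' x.
(* The exponent is negative exactly below the codimension. Should the truncated difference be 0, the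
   range is empty and all degrees vanish, so the two orbit dimensions need no comparison. *)
rewrite (@ICpoly_widen A' A (orb_dim Q A - orb_dim Q A')).
  apply: negative_laurent_sum => i _; apply: negative_laurent_vpow.
  by have := ltn_ord i; lia.
move=> i mi; apply: (vanishing_stalk_dim l_prime secA' le).
by apply: (H i).1; lia.
Qed.

Lemma can_unitri A : unitri Q A (can l IC A).
Proof.
(* The closure order implies the combinatorial one; coefficients are extended by 0 to the indices
   below [A] that are not in the closure. *)
exists (fun A' => if `[< orb_le Q A' A >] && (A' != A) then ICpoly l IC A' A else 0); split.
  move=> A'; case: ifP => [/andP[/asboolP le /eqP]|_]; last exact: negative_laurent0.
  exact: ICpoly_negative.
rewrite /can (bigD1 A) /=; last by apply/asboolP; apply: zclosure_sub.
rewrite ICpoly_diag scale1r; congr (_ + _).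
rewrite big_mkcond [RHS]big_mkcond; apply: eq_bigr => A' _.
case: ifP => [/andP[/asboolP le /eqP nA]|_].
  rewrite ifT //; apply/asboolP; split=> //.
  by apply: orb_le_sqle le _; apply: orbit_nonempty.
by case: ifP; rewrite ?scale0r.
Qed.

End CanonicalBasis.

Unset Implicit Arguments.

Theorem theorem5p9 (n d : nat) (n_gt0 : (0 < n)%N) (d_gt0 : (0 < d)%N)
  (F : finFieldType) (F_odd : odd #|F|)
  (J : 'M[F]_(d.*2.+1)) (J_sym : J^T = J) (J_nondeg : J \in unitmx)
  (k : closedFieldType) (iota : {rmorphism F -> k})
  (k_algebraic : forall x : k, algebraicOver iota x)
  (l : nat) (l_prime : prime l) (l_inv : l%:R != 0 :> k)
  (IC : forall A : Xi n d, complex (zclosure (orbO (map_mx iota J) A)))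
  (IC_spec : forall A, is_IC l (IC A))
  (bar : {additive Sj n d -> Sj n d}) (bar_spec : is_bar l IC bar) :
  (forall b : iXi n d -> Sj n d,
     is_canonical_basis_Si (map_mx iota J) bar b <->
     forall A, b A = can l IC (val A)) /\
  Bj l IC `&` Si (map_mx iota J) = [set can l IC A | A in [set A | in_iXi A]].
Proof.
have two_F : 2%:R != 0 :> F.
  (* In characteristic 2 the order of [F] would be a power of 2 greater than 1, hence even. *)
  apply: contraTneq F_odd => two0; have ch2 : 2%N \in [pchar F] by rewrite inE /= two0.
  have := finNzRing_gt1 F; rewrite (card_pprimeChar ch2) oddX orbF.
  by apply: contraTneq => ->.
have two_k : 2%:R != 0 :> k by rewrite -(rmorph_nat iota) fmorph_eq0.
have sQ : (map_mx iota J)^T = map_mx iota J by rewrite map_trmx J_sym.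
have uQ : map_mx iota J \in unitmx by rewrite map_unitmx.
have uc := can_unitri two_k sQ uQ l_prime IC_spec.
have [bar_v bar_can] := bar_spec.
split; last first.
  apply/seteqP; split=> [x [[A _ <-] SA]|x [A iA <-]].
    by exists A => //; apply: Si_unitri (uc A) SA.
  by split; [exists A|apply: unitri_Si (uc A) iA].
move=> b; split=> [[_ bar_b ub] A|bE].
  have [c [cn bA]] := ub A; have /unitri_iXi [c' [c'n canA]] := uc (val A).
  (* The leading terms [std] cancel in the difference. Extension by 0 makes every coefficient lie in
     v^-1 Z[v^-1], as needed for a sum over all of [iXi]. *)
  pose f (B : iXi n d) := if `[< sqlt (val B) (val A) >] then c B - c' B else 0.
  have fE : b A - can l IC (val A) = \sum_B f B *: std (map_mx iota J) (val B).
    rewrite bA canA opprD addrACA subrr add0r -sumrB big_mkcond.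
    apply: eq_bigr => B _; rewrite /f; case: ifP => _; last by rewrite scale0r.
    by rewrite scalerBl.
  have f0 : forall B, f B = 0.
    apply: (bar_negative_eq0 uc bar_can bar_v val_inj).
      move=> B; rewrite /f; case: ifP => _; last exact: negative_laurent0.
      exact: negative_laurentB.
    by rewrite -fE raddfB /= bar_b bar_can.
  apply/eqP; rewrite -subr_eq0 fE big1 // => B _.
  by rewrite f0 scale0r.
split.
- by apply: unitri_basis => A; rewrite bE.
- by move=> A; rewrite bE.
- by move=> A; rewrite bE; apply/unitri_iXi.
Qed.
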